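(* For any $\gamma>0$, $\beta\in(0,1]$, $L>0$ there exist two constants $c,C>0$ depending only on $\gamma,\beta$ and $L$ such that for all integers $K\ge1$ and $n\ge2$, $$c\,\min\big\{(K/n)^{\beta/(2\beta+1)},\,n^{-\beta/(2\beta+2)}\big\}\ \le\ \overline\psi_{n^{-\gamma}}(n,\mathcal{G}_{K,\beta})\ \le\ C\,\min\big\{(K/n)^{\beta/(2\beta+1)}(\log n)^{3/2},\,n^{-\beta/(2\beta+2)}\big\}.$$
   Context: For a real function $f$, $\mathrm{Supp}(f)=f^{-1}(\mathbb{R}\setminus\{0\})$. $\mathcal{L}_\beta$ is the set of $f:[0,1]^2\to\mathbb{R}$ with $f\ge0$, $\int f=1$, such that $\mathrm{Supp}(f)=[r_1,R_1]\times[r_2,R_2]$ for some $r_1,r_2,R_1,R_2\in[0,1]$, and $|f(z)-f(z')|\le L\|z-z'\|_\infty^\beta$ for all $z,z'\in\mathrm{Supp}(f)$. $\mathcal{F}_K$ is the set of functions $(x,y)\mapsto\sum_{k=1}^Ku_k(x)v_k(y)$ on $[0,1]^2$ with $u_k,v_k\in L_1[0,1]$. $\mathcal{G}_{K,\beta}=\mathcal{L}_\beta\cap\mathcal{F}_K$. $\mathbb{P}_f$ is the probability when $X_1,\dots,X_n$ are iid with density $f$. For $\delta>0$, $$\overline\psi_\delta(n,\mathcal{G}_{K,\beta})=\inf\Big\{t>0:\ \inf_{\widetilde f}\ \sup_{f\in\mathcal{G}_{K,\beta}}\mathbb{P}_f\big(\|\widetilde f(X_1,\dots,X_n)-f\|_{L_1}>t\big)\le\delta\Big\},$$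 where $\inf_{\widetilde f}$ is over all density estimators based on $X_1,\dots,X_n$ and $\|\cdot\|_{L_1}$ is the norm of $L_1([0,1]^2,\mathrm{Leb})$. $\log$ is the natural logarithm. *)

(* Defs.v *)
From HB Require Import structures.
From mathcomp Require Import all_boot all_order all_algebra.
From mathcomp Require Import all_classical all_reals all_analysis.
Import Order.TTheory GRing.Theory Num.Theory.
Import numFieldNormedType.Exports.

Set Implicit Arguments.
Unset Strict Implicit.
Unset Printing Implicit Defensive.

Local Open Scope classical_set_scope.
Local Open Scope ring_scope.
Local Open Scope ereal_scope.

(* Functions on [0,1]^2 are represented by functions on R * R, whose values
   outside the square are irrelevant (estimators) or zero (densities). *)

Definition unit_square (R : realType) : set (R * R) :=
  `[0%R, 1%R]%classic `*` `[0%R, 1%R]%classic.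

Definition leb2 (R : realType) := (@lebesgue_measure R \x @lebesgue_measure R).

Definition supp (R : realType) (f : R * R -> R) : set (R * R) :=
  [set z | f z != 0%R].

(* supp is taken in the whole plane, so [supp f = rectangle] also says that f
   vanishes outside the unit square; the norm on R * R is the max norm. *)
Definition holder_density (R : realType) (beta L : R) : set (R * R -> R) :=
  [set f | [/\ forall z, (0 <= f z)%R,
    \int[@leb2 R]_(z in @unit_square R) (f z)%:E = 1,
    exists r1 R1 r2 R2 : R,
      [/\ r1 \in `[0%R, 1%R], R1 \in `[0%R, 1%R],
          r2 \in `[0%R, 1%R], R2 \in `[0%R, 1%R] &
          supp f = `[r1, R1]%classic `*` `[r2, R2]%classic] &
    forall z z', supp f z -> supp f z' ->
      (`|f z - f z'| <= L * `|z - z'| `^ beta)%R]].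

Definition low_rank (R : realType) (K : nat) : set (R * R -> R) :=
  [set f | exists u v : 'I_K -> R -> R,
    [/\ forall k, (@lebesgue_measure R).-integrable `[0%R, 1%R] (EFin \o u k),
        forall k, (@lebesgue_measure R).-integrable `[0%R, 1%R] (EFin \o v k) &
        forall x y, x \in `[0%R, 1%R] -> y \in `[0%R, 1%R] ->
          f (x, y) = (\sum_(k < K) u k x * v k y)%R]].

Definition low_rank_holder_density (R : realType) (K : nat) (beta L : R) :
  set (R * R -> R) := holder_density beta L `&` @low_rank R K.

(* The law of n iid points with density f, i.e. the n-fold product of f dLeb,
   as an iterated integral: the integral over A of f(z_1) ... f(z_n). *)
Fixpoint iid_prob (R : realType) (f : R * R -> R) (n : nat) :
    set (n.-tuple (R * R)) -> \bar R :=
  match n with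
  | 0%N => fun A => \d_([tuple] : 0.-tuple (R * R)) A
  | m.+1 => fun A => \int[@leb2 R]_z
      ((f z)%:E * iid_prob f [set s : m.-tuple (R * R) | A [tuple of z :: s]])
  end.

(* ||g - f|| in L_1([0,1]^2) *)
Definition L1_dist (R : realType) (g f : R * R -> R) : \bar R :=
  \int[@leb2 R]_(z in @unit_square R) `|(g z)%:E - (f z)%:E|.

(* Joint measurability in (sample, point) makes every loss event measurable; an
   estimate need not itself be a density. *)
Definition estimators (R : realType) (n : nat) :
    set (n.-tuple (R * R) -> R * R -> R) :=
  [set fh | measurable_fun [set: n.-tuple (R * R) * (R * R)]
              (fun p => fh p.1 p.2) /\
    forall s, (@leb2 R).-integrable (@unit_square R) (EFin \o fh s)].

(* All infima and suprema are taken in \bar R, so none has a default value. *)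
Definition minimax_quantile (R : realType) (delta : R) (n : nat)
    (G : set (R * R -> R)) : \bar R :=
  ereal_inf [set t%:E | t in [set t : R | (0 < t)%R /\
    ereal_inf [set ereal_sup
        [set iid_prob f [set s : n.-tuple (R * R) | t%:E < L1_dist (fh s) f]
          | f in G]
      | fh in @estimators R n] <= delta%:E]].

(* Main.v *)
Require Import Defs.
From HB Require Import structures.
From mathcomp Require Import all_boot all_order all_algebra.
From mathcomp Require Import all_classical all_reals all_analysis.
From mathcomp Require Import measurable_realfun ring lra zify.
Import Order.TTheory GRing.Theory Num.Theory.
Import numFieldNormedType.Exports.

(** Both rates balance the resolution of a grid against the information carried
    by n points, and the rank bound K only changes how many free parameters a
    grid with a given mesh has.

    Lower bound.  Perturb the uniform density by a signed bump on each of the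
    p x m tiles of the square.  The bumps factor, with an oscillating factor in
    x, so that every perturbation has integral zero, and one nonnegative factor
    in y per strip, so that grouping the tiles by strips gives rank at most
    m + 1 (rank 1 if m = 1).  An amplitude a of order p^(-beta) keeps the Holder
    constant bounded.  The L_1 distance of two such densities is of order a times
    their proportion of different signs ([fam_separation]), so an estimate is
    within a small multiple of a of only a Hamming ball of sign patterns
    ([hamming_ball]).  On the other hand, the n-fold densities have
    second moment at most (1 + a^2)^n relative to the uniform law, so their
    total mass on events covering each sample only a few times is small
    ([many_hypotheses]): if n a^2 is at most a small multiple of p m, every
    estimator fails with probability near 1 for some sign pattern, in
    particular above 2^(-gamma) >= n^(-gamma).  The choice of m as the smaller
    of K - 1 and n^(1/(2 beta + 2)), up to constants, and of p as
    (n/m)^(1/(2 beta + 1)) gives both rates at once.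

    Upper bound.  The support is an unknown rectangle and f is smooth only
    inside it.  The bounding box of the first half of the sample misses little
    mass ([sample_box_mass]); it lies in the support, so f is Holder on it.  The
    values of f at the points of a p x p grid of this box, times its area, form
    a matrix with bounded entries, small increments and rank at most K
    ([sampled_bound], [sampled_increment1], [sampled_low_rank]), and every
    matrix entrywise close to it gives a step function close to f in L_1
    ([sampled_close]).  A finite net of N such matrices is a finite list of
    candidates, among which the second half of the sample selects by the rule of
    Yatracos: compare the candidates only on the sets where one is smaller than
    another, whose N^2 empirical frequencies are all accurate
    ([box_estimator_risk]).  The error is of order e as soon as n e^2 exceeds a
    multiple of log N + gamma log n ([net_upper_bound], [log_condition]).

    It remains to count.  Increments in steps of size e give log N of order p^2
    ([smooth_net]) and, with p = n^(1/(2 beta + 2)), the second rate.  A matrix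
    of rank K is a product of 2 K rows of p + 1 numbers, but the factors must
    be bounded for their quantization to be harmless: the columns spanning a
    maximal volume do this ([max_volume_factor]), log N is of order K p log n
    ([low_rank_net]), and p = (n/K)^(1/(2 beta + 1)) gives the first rate up to
    logarithms.  When a rate is not small, the estimator 0, whose error is
    exactly 1, is good enough. *)

Set Implicit Arguments.
Unset Strict Implicit.
Unset Printing Implicit Defensive.

Local Open Scope classical_set_scope.
Local Open Scope ring_scope.

(** * Integration against the law of the sample *)

(** The integral of a nonnegative function is a supremum over the simple
    functions below it, so it is monotone even on nonmeasurable functions; the
    probabilities of the sections of an arbitrary event are such functions. *)
Lemma ge0_le_integralT d (T : measurableType d) (R : realType)
    (mu : {measure set T -> \bar R}) (D : set T) (f g : T -> \bar R) :
  (forall x, D x -> 0 <= f x)%E -> (forall x, D x -> f x <= g x)%E ->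
  (\int[mu]_(x in D) f x <= \int[mu]_(x in D) g x)%E.
Proof.
move=> f0 fg; have g0 x : D x -> (0 <= g x)%E.
  by move=> Dx; exact: le_trans (f0 x Dx) (fg x Dx).
rewrite !ge0_integralE//; apply: ge_ereal_sup => _ [/= h hf <-].
apply: ereal_sup_ubound => /=; exists h => // x.
apply: le_trans (hf x) _; rewrite /patch; case: ifPn => // /[!inE]; exact: fg.
Qed.

HB.instance Definition _ (R : realType) := Measure.copy (@leb2 R)
  ((@lebesgue_measure R \x @lebesgue_measure R)%E : {measure set (measurableTypeR R * measurableTypeR R)%type -> \bar R}).
Lemma leb2_sigma_finite (R : realType) : sigma_finite setT (@leb2 R).
Proof.
have /sigma_finiteP[F [TF ndF Foo]] := sigma_finiteT (@lebesgue_measure R).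
exists (fun n => F n `*` F n).
 rewrite -setXTT TF predeqE => -[x y]; split.
    move=> [/= [n _ Fnx] [k _ Gky]]; exists (maxn n k) => //; split.
    - by move: x Fnx; exact/subsetPset/ndF/leq_maxl.
    - by move: y Gky; exact/subsetPset/ndF/leq_maxr.
  by move=> [n _ []/= ? ?]; split; exists n.
move=> k; have [? ?] := Foo k.
split; first exact: measurableX.
by rewrite /leb2 product_measure1E// lte_mul_pinfty// ge0_fin_numE.
Qed.
HB.instance Definition _ (R : realType) := Measure_isSigmaFinite.Build _ _ _ (@leb2 R) (@leb2_sigma_finite R).

Lemma measurable_cmul d (T : measurableType d) (R : realType) (c : R) (f : T -> R) :
  measurable_fun setT f -> measurable_fun setT (fun x => c * f x).
Proof. by move=> mf; apply: (measurable_funM (f := cst c)). Qed.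

Section iid.
Variable R : realType.
Implicit Types (f : R * R -> R).

Lemma iid_prob_ge0 f n (A : set (n.-tuple (R * R))) :
  (forall z, 0 <= f z) -> (0 <= iid_prob f A)%E.
Proof.
move=> f0; elim: n A => [|n IH] A /=; first by [].
by apply: integral_ge0 => z _; rewrite mule_ge0// lee_fin.
Qed.

(** A union bound over exponential moments, with the last n2 points left free:
    the products of the phi j over the first n1 points integrate to powers of
    I j by independence.  With n2 = 0 this is Chernoff's method; with n2 > 0 it
    conditions on a first subsample.  The bound is
    only needed where f does not vanish, so that the first points may be taken
    in the support. *)
Lemma iid_prob_le_sum (J : finType) f (phi : J -> R * R -> R) (I : J -> R)
    (n1 n2 : nat) (q : R) (c : J -> R) (A : set (seq (R * R))) :
  measurable_fun setT f -> (forall z, 0 <= f z) ->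
  (\int[@leb2 R]_z (f z)%:E = 1)%E ->
  (forall j, measurable_fun setT (phi j)) -> (forall j z, 0 <= phi j z) ->
  (forall j, \int[@leb2 R]_z (f z * phi j z)%:E <= (I j)%:E)%E ->
  0 <= q -> (forall j, 0 <= c j) ->
  (forall s1 : seq (R * R), size s1 = n1 -> all (fun z => f z != 0) s1 ->
     (iid_prob f [set s2 : n2.-tuple (R * R) | A (s1 ++ s2)] <=
      (q + \sum_j c j * \prod_(z <- s1) phi j z)%:E)%E) ->
  (iid_prob f [set s : (n1 + n2).-tuple (R * R) | A s] <=
    (q + \sum_j c j * I j ^+ n1)%:E)%E.
Proof.
move=> mf f0 f1 mphi phi0 hI q0.
have I0 j : 0 <= I j.
  rewrite -lee_fin; apply: le_trans (hI j); apply: integral_ge0 => z _.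
  by rewrite lee_fin mulr_ge0.
elim: n1 c A => [|n1 IH] c A c0 hA.
  have := hA [::] erefl isT; congr (_ <= _)%E.
  by congr (_ + _)%:E; apply: eq_bigr => j _; rewrite big_nil expr0.
rewrite addSn /=.
have step z : f z != 0 -> (iid_prob f [set s : (n1 + n2).-tuple (R * R) | A (z :: s)] <=
    (q + \sum_j (c j * phi j z) * I j ^+ n1)%:E)%E.
  move=> fz; apply: (IH (fun j => c j * phi j z) (fun s => A (z :: s))).
    by move=> j; rewrite mulr_ge0.
  move=> s1 s1n fs1; have := hA (z :: s1); rewrite /= s1n fz => /(_ erefl fs1).
  congr (_ <= _)%E; congr (_ + _)%:E; apply: eq_bigr => j _.
  by rewrite big_cons mulrA.
apply: (@le_trans _ _ (\int[@leb2 R]_z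
    ((q * f z)%:E + \sum_j (c j * I j ^+ n1 * (f z * phi j z))%:E))%E).
  apply: ge0_le_integralT => z _.
    by rewrite mule_ge0 ?lee_fin ?iid_prob_ge0.
  apply: (@le_trans _ _ ((f z)%:E *
    (q + \sum_j (c j * phi j z) * I j ^+ n1)%:E)%E).
    have [->|fz] := eqVneq (f z) 0; first by rewrite !mul0e.
    by apply: lee_pmul => //; rewrite ?lee_fin ?iid_prob_ge0// step.
  rewrite sumEFin -EFinM -EFinD lee_fin mulrDr mulr_sumr (mulrC (f z)) lerD2l.
  by apply: ler_sum => j _; rewrite le_eqVlt; apply/orP; left; apply/eqP; ring.
have mfphi j : measurable_fun setT (fun z => f z * phi j z).
  exact: measurable_funM.
rewrite ge0_integralD//=; last first.
- apply: emeasurable_sum => j; apply/measurable_EFinP; apply: measurable_cmul; exact: mfphi.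
- by move=> z _; apply: sume_ge0 => j _; rewrite lee_fin !mulr_ge0 ?exprn_ge0.
- by apply/measurable_EFinP; apply: measurable_cmul.
- by move=> z _; rewrite lee_fin mulr_ge0.
rewrite ge0_integral_sum//; last 2 first.
- by move=> j; apply/measurable_EFinP; apply: measurable_cmul; exact: mfphi.
- by move=> j z _; rewrite lee_fin !mulr_ge0 ?exprn_ge0.
under eq_integral do rewrite EFinM.
rewrite ge0_integralZl_EFin//; last 2 first.
- by move=> z _; rewrite lee_fin.
- exact/measurable_EFinP.
rewrite f1 mule1 EFinD leeD2l// -sumEFin; apply: lee_sum => j _.
under eq_integral do rewrite EFinM.
rewrite ge0_integralZl_EFin//; last 3 first.
- by move=> z _; rewrite lee_fin mulr_ge0.
- apply/measurable_EFinP; exact: (mfphi j).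
- by rewrite mulr_ge0// exprn_ge0.
apply: (@le_trans _ _ ((c j * I j ^+ n1)%:E * (I j)%:E)%E).
  by apply: lee_wpmul2l; rewrite ?lee_fin ?mulr_ge0 ?exprn_ge0.
by rewrite -EFinM lee_fin -mulrA -exprSr.
Qed.

(** The parameter t stands for the points already drawn: the statement must be
    uniform in T for the induction on n, which moves one point from the sample
    to the parameter. *)
Lemma measurable_iid_prob d (T : measurableType d) f n
    (A : set (T * n.-tuple (R * R))) :
  measurable_fun setT f -> (forall z, 0 <= f z) -> measurable A ->
  measurable_fun setT (fun t => iid_prob f [set s | A (t, s)]).
Proof.
move=> mf f0; elim: n d T A => [|n IH] d T A mA /=.
  rewrite (_ : (fun _ => _) = EFin \o \1_([set t : T | A (t, [tuple])])).
    apply/measurable_EFinP; apply: measurable_indic.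
    rewrite (_ : [set t | _] = (fun t => (t, [tuple])) @^-1` A)//.
    rewrite -[X in measurable X]setTI; apply: measurable_fun_pair => //.
  by apply/funext => t /=; rewrite diracE /indic; congr (_%:R%:E); 
    apply/idP/idP; rewrite !inE.
have mF : measurable_fun setT (fun p : T * (R * R) =>
    (f p.2)%:E * iid_prob f
      [set s : n.-tuple (R * R) | A (p.1, [tuple of p.2 :: s])])%E.
  apply: emeasurable_funM.
    by apply/measurable_EFinP; apply: measurableT_comp.
  apply: (IH _ _ [set q : T * (R * R) * n.-tuple (R * R) | A (q.1.1, [tuple of q.1.2 :: q.2])]).
  rewrite -[X in measurable X]setTI.
  apply: (_ : measurable_fun setT (fun q : T * (R * R) * n.-tuple (R * R) =>
     (q.1.1, [the n.+1.-tuple (R * R) of q.1.2 :: q.2]))) => //.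
  apply: measurable_fun_pair.
    exact: (measurableT_comp measurable_fst measurable_fst).
  apply: measurable_cons => //.
  exact: (measurableT_comp measurable_snd measurable_fst).
have := @measurable_fun_fubini_tonelli_F _ _ _ _ R (@leb2 R) _ mF; apply.
by move=> p; rewrite mule_ge0 ?lee_fin ?iid_prob_ge0.
Qed.

Lemma measurable_cons_pair n (A : set (n.+1.-tuple (R * R))) : measurable A ->
  measurable [set p : (R * R) * n.-tuple (R * R) | A [tuple of p.1 :: p.2]].
Proof.
move=> mA; rewrite -[X in measurable X]setTI.
apply: (_ : measurable_fun setT (fun q : (R * R) * n.-tuple (R * R) =>
  [the n.+1.-tuple (R * R) of q.1 :: q.2])) => //.
exact: measurable_cons.
Qed.

Lemma measurable_cons_section n (A : set (n.+1.-tuple (R * R))) z :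
  measurable A -> measurable [set s : n.-tuple (R * R) | A [tuple of z :: s]].
Proof.
move=> mA; rewrite -[X in measurable X]setTI.
apply: (_ : measurable_fun setT (fun s : n.-tuple (R * R) =>
  [the n.+1.-tuple (R * R) of z :: s])) => //.
exact: measurable_cons.
Qed.

Lemma measurable_iid_prob_cons f n (A : set (n.+1.-tuple (R * R))) :
  measurable_fun setT f -> (forall z, 0 <= f z) -> measurable A ->
  measurable_fun setT
    (fun z : R * R => iid_prob f [set s : n.-tuple (R * R) | A [tuple of z :: s]]).
Proof.
move=> mf f0 mA.
exact: (measurable_iid_prob mf f0 (measurable_cons_pair mA)).
Qed.

Lemma iid_prob_setC f n (A : set (n.-tuple (R * R))) :
  measurable_fun setT f -> (forall z, 0 <= f z) ->
  (\int[@leb2 R]_z (f z)%:E = 1)%E -> measurable A ->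
  (iid_prob f A + iid_prob f (~` A) = 1)%E.
Proof.
move=> mf f0 f1; elim: n A => [|n IH] A mA /=.
  rewrite !diracE in_setC; case: (_ \in A) => /=; by rewrite ?adde0 ?add0e.
have mC := measurableC mA.
rewrite -ge0_integralD//; first last.
- by apply: emeasurable_funM; [exact/measurable_EFinP|exact: (measurable_iid_prob_cons _ _ mC)].
- by move=> z _; rewrite mule_ge0 ?lee_fin ?iid_prob_ge0.
- by apply: emeasurable_funM; [exact/measurable_EFinP|exact: measurable_iid_prob_cons].
- by move=> z _; rewrite mule_ge0 ?lee_fin ?iid_prob_ge0.
rewrite -f1; apply: eq_integral => z _.
rewrite -ge0_muleDr ?iid_prob_ge0//.
by rewrite (IH [set s : n.-tuple (R * R) | A [tuple of z :: s]]) ?mule1//; exact: measurable_cons_section.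
Qed.

(** The counterpart of [iid_prob_le_sum] for several laws at once: a pointwise
    inequality between weighted n-fold densities restricted to events and
    products of the phi j is integrated one point at a time.  The events must
    be measurable here, as the sum over t has to be exchanged with the integral. *)
Lemma sum_iid_prob_le (Th J : finType) (f : Th -> R * R -> R)
    (phi : J -> R * R -> R) (I : J -> R) n (w : Th -> R) (c : J -> R)
    (A : Th -> set (n.-tuple (R * R))) :
  (forall t, measurable_fun setT (f t)) -> (forall t z, 0 <= f t z) ->
  (forall j, measurable_fun setT (phi j)) -> (forall j z, 0 <= phi j z) ->
  (forall j, \int[@leb2 R]_z (phi j z)%:E <= (I j)%:E)%E ->
  (forall t, 0 <= w t) -> (forall j, 0 <= c j) ->
  (forall t, measurable (A t)) ->
  (forall s : n.-tuple (R * R),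
     \sum_t w t * \1_(A t) s * \prod_(z <- s) f t z <=
     \sum_j c j * \prod_(z <- s) phi j z) ->
  (\sum_t (w t)%:E * iid_prob (f t) (A t) <= (\sum_j c j * I j ^+ n)%:E)%E.
Proof.
move=> mf f0 mphi phi0 hI.
have I0 j : 0 <= I j.
  rewrite -lee_fin; apply: le_trans (hI j); apply: integral_ge0 => z _.
  by rewrite lee_fin.
elim: n w c A => [|n IH] w c A w0 c0 mA hA /=.
  have := hA [tuple]; rewrite -lee_fin => h; apply: le_trans (le_trans h _).
    rewrite -sumEFin; apply: lee_sum => t _.
    by rewrite big_nil mulr1 EFinM diracE indicE.
  rewrite lee_fin; apply: ler_sum => j _.
  by rewrite big_nil expr0.
have mP t : measurable_fun setT (fun z : R * R =>
    ((f t z)%:E * iid_prob (f t) [set s : n.-tuple (R * R) | A t [tuple of z :: s]])%E).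
  by apply: emeasurable_funM; [exact/measurable_EFinP|exact: measurable_iid_prob_cons].
have P0 t z : (0 <= (f t z)%:E * iid_prob (f t)
    [set s : n.-tuple (R * R) | A t [tuple of z :: s]])%E.
  by rewrite mule_ge0 ?lee_fin ?iid_prob_ge0.
rewrite (eq_bigr (fun t => \int[@leb2 R]_z ((w t)%:E * ((f t z)%:E * iid_prob (f t)
    [set s : n.-tuple (R * R) | A t [tuple of z :: s]])))%E); last first.
  by move=> t _; rewrite ge0_integralZl_EFin//; exact: mP.
rewrite -ge0_integral_sum//; last 2 first.
- move=> t; apply: emeasurable_funM => //; exact: mP.
- by move=> t z _; rewrite mule_ge0 ?lee_fin.
apply: (@le_trans _ _ (\int[@leb2 R]_z
    (\sum_j (c j * I j ^+ n)%:E * (phi j z)%:E))%E).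
  apply: ge0_le_integralT => z _.
    by apply: sume_ge0 => t _; rewrite mule_ge0 ?lee_fin.
  under eq_bigr do rewrite muleA -EFinM.
  apply: (le_trans (IH (fun t => w t * f t z) (fun j => c j * phi j z)
    (fun t => [set s : n.-tuple (R * R) | A t [tuple of z :: s]]) _ _ _ _)).
  - by move=> t; rewrite mulr_ge0.
  - by move=> j; rewrite mulr_ge0.
  - by move=> t; exact: measurable_cons_section.
  - move=> s; have := hA [tuple of z :: s]; congr (_ <= _).
      by apply: eq_bigr => t _; rewrite /= big_cons mulrA -!mulrA; congr (_ * _);
        rewrite mulrCA.
    by apply: eq_bigr => j _; rewrite /= big_cons mulrA.
  rewrite -sumEFin; apply: lee_sum => j _; rewrite -EFinM lee_fin.
  by rewrite mulrAC.
rewrite ge0_integral_sum//; last 2 first.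
- move=> j; apply: emeasurable_funM => //; apply/measurable_EFinP; exact: mphi.
- by move=> j z _; rewrite mule_ge0 ?lee_fin// ?mulr_ge0// ?exprn_ge0.
rewrite -sumEFin; apply: lee_sum => j _.
rewrite ge0_integralZl_EFin//; last 3 first.
- by move=> z _; rewrite lee_fin.
- apply/measurable_EFinP; exact: mphi.
- by rewrite mulr_ge0// exprn_ge0.
apply: (@le_trans _ _ ((c j * I j ^+ n)%:E * (I j)%:E)%E).
  by apply: lee_wpmul2l; rewrite ?lee_fin ?mulr_ge0 ?exprn_ge0.
by rewrite -EFinM lee_fin -mulrA -exprSr.
Qed.

End iid.

(** * The loss, and failure under many hypotheses *)

Section basics.
Variable R : realType.
Implicit Types (f g : R * R -> R).

Lemma measurable_unit_square : measurable (@unit_square R).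
Proof. exact: measurableX. Qed.

Lemma unit_squareE (z : R * R) :
  @unit_square R z <-> (0 <= z.1 <= 1) /\ (0 <= z.2 <= 1).
Proof. by rewrite /unit_square /= !in_itv. Qed.

Lemma lebesgue_itvcc (a b : R) : a <= b ->
  @lebesgue_measure R `[a, b]%classic = (b - a)%:E.
Proof.
move=> ab; rewrite lebesgue_measure_itv/= lte_fin.
by case: ltgtP ab => // -> _; rewrite subrr.
Qed.

Lemma leb2_rect (a b c d : R) : a <= b -> c <= d ->
  @leb2 R (`[a, b]%classic `*` `[c, d]%classic) = ((b - a) * (d - c))%:E.
Proof.
move=> ab cd; transitivity
  (@lebesgue_measure R `[a, b]%classic * @lebesgue_measure R `[c, d]%classic)%E.
  exact: product_measure1E.
by rewrite !lebesgue_itvcc.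
Qed.

Lemma leb2_unit_square : @leb2 R (@unit_square R) = 1%E.
Proof. by rewrite /unit_square leb2_rect ?ler01// subr0 mulr1. Qed.

Lemma integral_leb2_indic (A : set (R * R)) : measurable A ->
  (\int[@leb2 R]_z (\1_A z)%:E = @leb2 R A)%E.
Proof.
move=> mA; have := @integral_indic _ _ R (@leb2 R) setT measurableT A mA.
by rewrite setIT.
Qed.

Lemma integral_unit_square (h : R * R -> \bar R) :
  (forall z, ~ @unit_square R z -> h z = 0%E) ->
  (\int[@leb2 R]_(z in @unit_square R) h z = \int[@leb2 R]_z h z)%E.
Proof.
move=> h0; rewrite integral_mkcond; apply: eq_integral => z _.
rewrite /patch; case: ifPn => // /negP; rewrite inE => /h0 ->//.
Qed.

Lemma measurable_L1_dist d (T : measurableType d) (fh : T -> R * R -> R) f :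
  measurable_fun setT (fun p : T * (R * R) => fh p.1 p.2) ->
  measurable_fun setT f ->
  measurable_fun setT (fun s => L1_dist (fh s) f).
Proof.
move=> mfh mf; rewrite /L1_dist.
pose F (p : T * (R * R)) := (`|fh p.1 p.2 - f p.2| * \1_(@unit_square R) p.2)%:E.
rewrite (_ : (fun s => _) = fun s => (\int[@leb2 R]_z F (s, z))%E); last first.
  apply/funext => s; rewrite integral_mkcond; apply: eq_integral => z _.
  rewrite /F /= indicE /patch; case: ifPn => _; first by rewrite mulr1.
  by rewrite mulr0.
have mF : measurable_fun setT F.
  apply/measurable_EFinP; apply: measurable_funM.
    apply: measurableT_comp => //; apply: measurable_funB => //.
    exact: (measurableT_comp mf).
  exact: (measurableT_comp (measurable_indic measurable_unit_square)).
have := @measurable_fun_fubini_tonelli_F _ _ _ _ R (@leb2 R) _ mF; apply.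
by move=> p; rewrite lee_fin mulr_ge0// indicE ler0n.
Qed.

Lemma measurable_L1_le n (fh : n.-tuple (R * R) -> R * R -> R) f (t : R) :
  @estimators R n fh -> measurable_fun setT f ->
  measurable [set s | (L1_dist (fh s) f <= t%:E)%E].
Proof.
move=> [mfh _] mf; rewrite -[X in measurable X]setTI.
exact: (emeasurable_fun_infty_c _ (measurable_L1_dist mfh mf)).
Qed.

Lemma L1_dist_triangle (g f1 f2 : R * R -> R) :
  measurable_fun setT g -> measurable_fun setT f1 -> measurable_fun setT f2 ->
  (L1_dist f1 f2 <= L1_dist g f1 + L1_dist g f2)%E.
Proof.
move=> mg m1 m2; rewrite /L1_dist -ge0_integralD//; first last.
- by apply/measurable_EFinP; apply: measurable_funTS; apply: measurableT_comp => //; exact: measurable_funB.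
- by apply/measurable_EFinP; apply: measurable_funTS; apply: measurableT_comp => //; exact: measurable_funB.
- exact: measurable_unit_square.
apply: ge0_le_integralT => // z _; rewrite lee_fin.
rewrite (distrC (g z)); exact: ler_distD.
Qed.

End basics.

Lemma sum_option (V : nmodType) (T : finType) (F : option T -> V) :
  \sum_o F o = F None + \sum_i F (Some i).
Proof.
rewrite (bigD1 None)//=; congr (_ + _).
rewrite (reindex_omap Some id); last by case.
by apply: eq_bigl => i /=; rewrite eqxx.
Qed.

Section many_hypotheses.
Variable R : realType.

(** A Bayes risk bound without conditional expectations.  On the event that the
    estimate is close to f i, the n-fold density P of f i satisfies
    P <= k / 2 + P^2 / (2 k).  Summed over i, the first terms contribute at
    most k B / 2, as a sample is close to at most B hypotheses, and the second
    ones at most X^n / (2 k) each. *)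
Lemma many_hypotheses (Th : finType) (f : Th -> R * R -> R) n
    (fh : n.-tuple (R * R) -> R * R -> R) (t B X k : R) :
  (0 < #|Th|)%N ->
  (forall i, measurable_fun setT (f i)) -> (forall i z, 0 <= f i z) ->
  (forall i z, ~ @unit_square R z -> f i z = 0) ->
  (forall i, \int[@leb2 R]_z (f i z)%:E = 1)%E ->
  (forall i, \int[@leb2 R]_z (f i z ^+ 2)%:E <= X%:E)%E ->
  @estimators R n fh -> 0 < k -> 0 <= B ->
  (forall s : n.-tuple (R * R),
     #|[pred i | `[< (L1_dist (fh s) (f i) <= t%:E)%E >]]|%:R <= B) ->
  exists i : Th, ((1 - (k * B / (2 * #|Th|%:R) + X ^+ n / (2 * k)))%:E <=
    iid_prob (f i) [set s | (t%:E < L1_dist (fh s) (f i))%E])%E.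
Proof.
move=> Th0 mf f0 fsq f1 hX efh k0 B0 hB.
pose A i := [set s | (L1_dist (fh s) (f i) <= t%:E)%E].
have mA i : measurable (A i) by exact: measurable_L1_le.
(* None stands for the uniform law, Some i for the second moment of f i. *)
pose phi (o : option Th) : R * R -> R :=
  if o is Some i then fun z => f i z ^+ 2 else \1_(@unit_square R).
pose I (o : option Th) : R := if o is Some i then X else 1.
pose c (o : option Th) : R := if o is Some i then (2 * k)^-1 else k * B / 2.
have key : (\sum_i 1%:E * iid_prob (f i) (A i) <= (\sum_o c o * I o ^+ n)%:E)%E.
  apply: (@sum_iid_prob_le R Th (option Th) f phi I n (fun=> 1) c A) => //.
  - case=> [i|] /=; first exact: measurable_funX.
    apply: measurable_indic; exact: (@measurable_unit_square R).
  - by case=> [i|] z /=; [rewrite exprn_ge0|rewrite indicE].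
  - case=> [i|] /=; first exact: hX.
    by rewrite integral_leb2_indic ?leb2_unit_square//; exact: (@measurable_unit_square R).
  - case=> [i|] /=; first by rewrite invr_ge0 mulr_ge0// ltW.
    by rewrite divr_ge0// mulr_ge0// ltW.
  move=> s; have [/allP ssq|/allPn[z zs zsq]] := boolP (all (fun z => z \in @unit_square R) s); last first.
    rewrite big1 ?sumr_ge0//.
      move=> o _; rewrite mulr_ge0 ?prodr_ge0//; case: o => [i|] //=.
      - by rewrite invr_ge0 mulr_ge0// ltW.
      - by rewrite divr_ge0// mulr_ge0// ltW.
      - by move=> z' _; rewrite exprn_ge0.
    move=> i _; suff -> : \prod_(z <- s) f i z = 0 by rewrite mulr0.
    apply/eqP; rewrite prodf_seq_eq0; apply/hasP; exists z => //=.
    by rewrite fsq//; apply: contraNnot zsq => ?; rewrite inE.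
  rewrite sum_option /=.
  have -> : \prod_(z <- s) (\1_(@unit_square R) z : R) = 1.
    by rewrite big_seq big1// => z /ssq; rewrite indicE => ->.
  rewrite mulr1.
  have h i : 1 * \1_(A i) s * \prod_(z <- s) f i z <=
      k / 2 * \1_(A i) s + (2 * k)^-1 * \prod_(z <- s) f i z ^+ 2.
    rewrite prodrXl mul1r indicE; set P := \prod_(z <- s) f i z.
    case: (s \in A i); rewrite ?mul1r ?mulr1 ?mul0r ?mulr0 ?add0r; last first.
      by rewrite mulr_ge0 ?sqr_ge0// invr_ge0 mulr_ge0// ltW.
    rewrite -subr_ge0 (_ : _ - _ = (2 * k)^-1 * (P - k) ^+ 2); last by field; rewrite gt_eqF.
    by rewrite mulr_ge0 ?sqr_ge0// invr_ge0 mulr_ge0// ltW.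
  apply: (le_trans (ler_sum _ (fun i _ => h i))).
  rewrite big_split /= lerD2r -mulr_sumr (mulrAC k B) ler_wpM2l//.
    by rewrite divr_ge0// ltW.
  apply: le_trans (hB s); rewrite -sum1_card natr_sum [leRHS]big_mkcond /=.
  apply: ler_sum => i _; rewrite indicE.
  rewrite unfold_in /=; case: asboolP => h'; first by case: (_ \in _).
  by rewrite memNset.
pose x i : R := fine (iid_prob (f i) (A i)).
have AC i := iid_prob_setC (mf i) (f0 i) (f1 i) (mA i).
have xE i : iid_prob (f i) (A i) = (x i)%:E.
  rewrite fineK// ge0_fin_numE ?iid_prob_ge0//.
  rewrite (@le_lt_trans _ _ 1%E) ?ltry// -(AC i) leeDl//.
  exact: iid_prob_ge0.
set q := k * B / _ + _.
have xq : \sum_i x i <= q * #|Th|%:R.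
  rewrite -lee_fin -sumEFin; apply: (@le_trans _ _ (\sum_o c o * I o ^+ n)%:E).
    by apply: le_trans key; apply: lee_sum => i _; rewrite mul1e xE.
  rewrite lee_fin sum_option /= sumr_const expr1n mulr1 -mulr_natr /q.
  rewrite mulrDl lerD// le_eqVlt; apply/orP; left; apply/eqP.
    by field; rewrite pnatr_eq0 -lt0n Th0.
  by field; rewrite gt_eqF.
have [i hi] : exists i, x i <= q.
  apply/not_existsP => h; have {}h i : q < x i by rewrite ltNge; apply/negP/h.
  move: xq; apply/negP; rewrite -ltNge mulr_natr -sumr_const.
  move/card_gt0P: Th0 => [i0 _].
  rewrite (bigD1 i0)//= [ltRHS](bigD1 i0)//= ltr_leD// ler_sum// => i _.
  exact: ltW.
exists i; have := AC i.
rewrite (_ : ~` A i = [set s | (t%:E < L1_dist (fh s) (f i))%E]); last first.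
  by apply/seteqP; split => s /=; rewrite /A /= ltNge => /negP.
rewrite xE; case: (iid_prob _ _) => [y| |]//=.
move=> [xy]; rewrite lee_fin; lra.
Qed.
End many_hypotheses.

(** * Sign patterns and bumps *)

(** Chernoff's bound on the volume of a Hamming ball in a cube of dimension 8 r:
    weigh a pattern by 4^(-distance), with total mass (5/4)^(8 r), and use
    4 (5/4)^8 <= 24. *)
Lemma hamming_ball (R : realType) (I : finType) (r : nat) (th0 : {ffun I -> bool}) :
  #|I| = (8 * r)%N ->
  (#|[pred th : {ffun I -> bool} | (#|[pred i | th i != th0 i]| <= r)%N]|%:R : R)
    <= 24 ^+ r.
Proof.
move=> cI.
(* The weight 4^(-distance), as a product over coordinates. *)
pose F (th : {ffun I -> bool}) : R := \prod_i (if th i != th0 i then 4^-1 else 1).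
have sF : \sum_th F th = (5 / 4) ^+ (8 * r).
  rewrite /F -(bigA_distr_bigA (fun i b => if b != th0 i then 4^-1 else 1 : R)).
  rewrite (eq_bigr (fun=> 5 / 4 : R)); last first.
    by move=> i _; rewrite big_bool; case: (th0 i) => /=; lra.
  by rewrite prodr_const cI.
have Fge (th : {ffun I -> bool}) : (#|[pred i | th i != th0 i]| <= r)%N -> (4^-1) ^+ r <= F th.
  move=> h; rewrite /F -big_mkcond /= prodr_const.
  by rewrite ler_wiXn2l//; lra.
have h : #|[pred th : {ffun I -> bool} | (#|[pred i | th i != th0 i]| <= r)%N]|%:R
    * (4^-1) ^+ r <= (5 / 4 : R) ^+ (8 * r).
  rewrite -sF mulr_natl -sumr_const big_mkcond /=; apply: ler_sum => th _.
  rewrite unfold_in /=; case: ifPn => [/Fge//|_].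
  by apply: prodr_ge0 => i _; case: ifP => _; lra.
have : (4^-1 : R) ^+ r > 0 by rewrite exprn_gt0.
move=> h4; rewrite -(ler_pM2r h4); apply: le_trans h _.
by rewrite exprM -exprMn; apply: lerXn2r; rewrite ?nnegrE; lra.
Qed.

Section bumps.
Variable R : realType.
Implicit Types s x y : R.

Definition vee s : R := Num.max 0 (s * (1 - s)).
(** Odd about the middle of its support, hence of integral zero. *)
Definition wave s : R := vee s * (1 - 2 * s).

Lemma vee_ge0 s : 0 <= vee s.
Proof. by rewrite /vee le_max lexx. Qed.

Lemma vee_neq0 s : vee s != 0 -> 0 < s < 1.
Proof.
by rewrite /vee maxEle; case: ifPn; rewrite ?eqxx// => h1 h2; nra.
Qed.

Lemma vee_in s : 0 <= s <= 1 -> vee s = s * (1 - s).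
Proof. by move=> h; apply/max_idPr; nra. Qed.

Lemma vee_out s : ~~ (0 <= s <= 1) -> vee s = 0.
Proof. by move=> h; apply/eqP; apply: contraNT h => /vee_neq0; lra. Qed.

Lemma vee_le s : vee s <= 1 / 4.
Proof.
have [h|/vee_out ->] := boolP (0 <= s <= 1); last lra.
by rewrite vee_in//; have := sqr_ge0 (s - 1 / 2); nra.
Qed.

Lemma vee_lip s s' : `|vee s - vee s'| <= `|s - s'|.
Proof.
have [h|h] := boolP (0 <= s <= 1); have [h'|h'] := boolP (0 <= s' <= 1).
- rewrite !vee_in// (_ : _ - _ = (s - s') * (1 - s - s')); last by ring.
  by rewrite normrM ler_piMr// ler_norml; lra.
- rewrite (vee_in h) (vee_out h') subr0 ger0_norm; last by nra.
  by move: h'; rewrite negb_and -!ltNge => /orP[] h'; case: ger0P => ?; nra.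
- rewrite (vee_out h) (vee_in h') sub0r normrN ger0_norm; last by nra.
  by move: h; rewrite negb_and -!ltNge => /orP[] h; case: ger0P => ?; nra.
- by rewrite !vee_out// subrr normr0.
Qed.

Lemma wave_neq0 s : wave s != 0 -> 0 < s < 1.
Proof. by rewrite mulf_eq0 negb_or => /andP[/vee_neq0]. Qed.

Lemma wave_le1 s : `|wave s| <= 1.
Proof.
have [h|h] := boolP (0 <= s <= 1); last by rewrite /wave vee_out// mul0r normr0.
rewrite normrM ger0_norm ?vee_ge0// mulr_ile1 ?vee_ge0 ?normr_ge0//.
  by apply: le_trans (vee_le s) _; lra.
by rewrite ler_norml; lra.
Qed.

Lemma wave_lip s s' : `|wave s - wave s'| <= 2 * `|s - s'|.
Proof.
wlog h : s s' / 0 <= s <= 1.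
  have [h|h] := boolP (0 <= s <= 1); first exact.
  have [h'|h'] := boolP (0 <= s' <= 1) => H.
    by rewrite distrC (distrC s); exact: H.
  by rewrite /wave !vee_out// !mul0r subrr normr0 mulr_ge0.
have [h'|h'] := boolP (0 <= s' <= 1); last first.
  rewrite {2}/wave (vee_out h') mul0r subr0 /wave normrM.
  apply: (@le_trans _ _ (`|vee s| * 1)).
    by rewrite ler_wpM2l// ler_norml; lra.
  have := vee_lip s s'; rewrite (vee_out h') subr0 mulr1 => H.
  by apply: le_trans H _; rewrite mulr_natl mulr2n lerDl.
rewrite /wave (_ : _ - _ = (vee s - vee s') * (1 - 2 * s) - vee s' * (2 * (s - s'))); last by ring.
apply: le_trans (ler_normB _ _) _; rewrite !normrM (_ : 2 * `|s - s'| = `|s - s'| * 1 + 2^-1 * (2 * `|s - s'|)); last by field.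
apply: lerD; first by apply: ler_pM => //; [exact: vee_lip|rewrite ler_norml; lra].
rewrite (ger0_norm (vee_ge0 _)) (ger0_norm (_ : 0 <= 2))// ler_wpM2r// ?mulr_ge0//.
by apply: le_trans (vee_le _) _; lra.
Qed.

Lemma measurable_vee : measurable_fun setT vee.
Proof.
rewrite (_ : vee = (cst 0 \max (fun s : R => s * (1 - s)))); last first.
  by apply/funext => s.
apply: measurable_maxr => //; apply: measurable_funM => //.
exact: measurable_funB.
Qed.

Lemma measurable_wave : measurable_fun setT wave.
Proof.
apply: measurable_funM; first exact: measurable_vee.
by apply: measurable_funB => //; exact: measurable_cmul.
Qed.

Definition xbump (p j : nat) x : R := wave (p%:R * x - j%:R).
(** A single strip needs no localization in y, and the constant factor keeps the
    rank equal to 1 when K = 1. *)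
Definition ybump (m k : nat) y : R :=
  if m == 1%N then 1 else vee (m%:R * y - k%:R).

Lemma natr_between (j k : nat) x : j%:R < x < j%:R + 1 -> k%:R < x < k%:R + 1 -> j = k.
Proof.
move=> /andP[h1 h2] /andP[h3 h4]; apply/eqP; rewrite eqn_leq.
by apply/andP; split; rewrite -ltnS -(ltr_nat R) -natr1; lra.
Qed.

Lemma xbump_neq0 p j j' x : xbump p j x != 0 -> xbump p j' x != 0 -> j = j'.
Proof.
by move=> /wave_neq0 h1 /wave_neq0 h2; apply: (@natr_between _ _ (p%:R * x)); lra.
Qed.

Lemma ybump_neq0 m k k' y : (k < m)%N -> (k' < m)%N ->
  ybump m k y != 0 -> ybump m k' y != 0 -> k = k'.
Proof.
rewrite /ybump; case: (m =P 1%N) => [->|_]; first by rewrite !ltnS !leqn0 => /eqP-> /eqP->.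
by move=> _ _ /vee_neq0 h1 /vee_neq0 h2; apply: (@natr_between _ _ (m%:R * y)); lra.
Qed.

Lemma xbump_le1 p j x : `|xbump p j x| <= 1. Proof. exact: wave_le1. Qed.

Lemma ybump_le1 m k y : `|ybump m k y| <= 1.
Proof.
rewrite /ybump; case: eqP => _; first by rewrite normr1.
by rewrite ger0_norm ?vee_ge0//; apply: le_trans (vee_le _) _; lra.
Qed.

Lemma xbump_lip p j x x' : `|xbump p j x - xbump p j x'| <= 2 * p%:R * `|x - x'|.
Proof.
apply: le_trans (wave_lip _ _) _; rewrite -mulrA ler_wpM2l//.
by rewrite opprB addrA subrK -mulrBr normrM ger0_norm.
Qed.

Lemma ybump_lip m k y y' : `|ybump m k y - ybump m k y'| <= m%:R * `|y - y'|.
Proof.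
rewrite /ybump; case: eqP => _; first by rewrite subrr normr0 mulr_ge0.
apply: le_trans (vee_lip _ _) _.
by rewrite opprB addrA subrK -mulrBr normrM ger0_norm.
Qed.

Lemma xbump_ge p j x : 1 / 8 <= p%:R * x - j%:R <= 3 / 8 -> 1 / 64 <= `|xbump p j x|.
Proof.
rewrite /xbump /wave; set s := _ - _ => h; rewrite vee_in; last lra.
have h8 : 1 / 8 * (5 / 8) * (1 / 4) <= s * (1 - s) * (1 - 2 * s).
  by rewrite !ler_pM//; lra.
by rewrite ger0_norm; lra.
Qed.

Lemma ybump_ge m k y : 1 / 4 <= m%:R * y - k%:R <= 3 / 4 -> 1 / 8 <= `|ybump m k y|.
Proof.
move=> h; rewrite /ybump; case: eqP => _; first by rewrite normr1; lra.
by rewrite vee_in ?ger0_norm; nra.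
Qed.

Lemma measurable_xbump p j : measurable_fun setT (xbump p j).
Proof.
apply: (measurableT_comp measurable_wave).
by apply: measurable_funB => //; exact: measurable_cmul.
Qed.

Lemma measurable_ybump m k : measurable_fun setT (ybump m k).
Proof.
rewrite /ybump; case: eqP => _ //.
apply: (measurableT_comp measurable_vee).
by apply: measurable_funB => //; exact: measurable_cmul.
Qed.

(** An explicit primitive is (s (1 - s))^2 / 2 with s = p x - j, which vanishes
    at both ends of the support. *)
Lemma integral_xbump p j : (j < p)%N ->
  (\int[@lebesgue_measure R]_(x in `[0%R, 1%R]) (xbump p j x)%:E = 0)%E.
Proof.
move=> jp.
have p0 : 0 < p%:R :> R by rewrite ltr0n (leq_ltn_trans _ jp).
pose a : R := j%:R / p%:R; pose b : R := (j%:R + 1) / p%:R.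
have ab : a < b by rewrite ltr_pM2r ?invr_gt0//; lra.
have a0 : 0 <= a by rewrite divr_ge0.
have b1 : b <= 1 by rewrite ler_pdivrMr// mul1r natr1 ler_nat.
pose F (x : R) : R := (p%:R * x - j%:R) ^+ 2 * (1 - (p%:R * x - j%:R)) ^+ 2 / 2 / p%:R.
pose g (x : R) : R := (p%:R * x - j%:R) * (1 - (p%:R * x - j%:R)) * (1 - 2 * (p%:R * x - j%:R)).
transitivity (\int[@lebesgue_measure R]_(x in `[a, b]) (g x)%:E)%E.
  rewrite integral_mkcond [RHS]integral_mkcond; apply: eq_integral => x _.
  rewrite /patch !mem_setE !in_itv /=.
  have -> : (a <= x <= b) = (0 <= p%:R * x - j%:R <= 1).
    by rewrite /a /b ler_pdivrMr// ler_pdivlMr// (mulrC x) subr_ge0 lerBlDr (addrC 1).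
  case: (boolP (0 <= p%:R * x - j%:R <= 1)) => hx.
    rewrite (_ : (0 <= x <= 1) = true) /xbump /wave ?vee_in//.
    have j1 : j%:R + 1 <= p%:R :> R by rewrite natr1 ler_nat.
    have j0 : 0 <= j%:R :> R by [].
    by apply/andP; split; [rewrite -(pmulr_rge0 _ p0)|rewrite -(ler_pM2l p0) mulr1]; lra.
  by rewrite /xbump /wave vee_out// mul0r; case: ifP.
have dF x : is_derive x 1 F (g x).
  rewrite /F; apply: is_derive_eq; rewrite /g.
  by rewrite /GRing.scale /=; field; rewrite gt_eqF.
have cg : continuous g.
  move=> x; apply: differentiable_continuous; apply/derivable1_diffP; rewrite /g; apply: ex_derive.
have cF : continuous F.
  by move=> x; apply: differentiable_continuous; apply/derivable1_diffP; apply: ex_derive.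
rewrite (@continuous_FTC2 _ g F)//; last 3 first.
- by apply: continuous_subspaceT.
- split.
  + by move=> x _; apply: ex_derive.
  + by apply: cvg_at_right_filter; exact: cF.
  + by apply: cvg_at_left_filter; exact: cF.
- by move=> x _; rewrite derive1E; apply: derive_val.
rewrite /F /a /b; rewrite -EFinB; congr EFin.
by field; rewrite gt_eqF.
Qed.

End bumps.

(** * A family of perturbations of the uniform density *)

Section plane.
Variable R : realType.
Implicit Types (h : R * R -> R) (z : R * R).

Lemma norm_pair1 z z' : `|z.1 - z'.1| <= `|z - z'|.
Proof. by rewrite [leRHS]prod_normE le_max lexx. Qed.

Lemma norm_pair2 z z' : `|z.2 - z'.2| <= `|z - z'|.
Proof. by rewrite [leRHS]prod_normE le_max lexx orbT. Qed.

Lemma measurable_coord1 (g : R -> R) :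
  measurable_fun setT g -> measurable_fun setT (fun z : R * R => g z.1).
Proof. by move=> mg; exact: (measurableT_comp mg). Qed.

Lemma measurable_coord2 (g : R -> R) :
  measurable_fun setT g -> measurable_fun setT (fun z : R * R => g z.2).
Proof. by move=> mg; exact: (measurableT_comp mg). Qed.

Lemma leb2_unit_square_lty : (@leb2 R (@unit_square R) < +oo)%E.
Proof. by rewrite leb2_unit_square ltry. Qed.

Lemma lebesgue_itv01_lty : (@lebesgue_measure R `[0%R, 1%R]%classic < +oo)%E.
Proof. by rewrite lebesgue_itvcc ?ler01// ltry. Qed.

Lemma bounded_integrable_square h M : measurable_fun setT h ->
  (forall z, @unit_square R z -> `|h z| <= M) ->
  (@leb2 R).-integrable (@unit_square R) (EFin \o h).
Proof.
move=> mh hM; apply: measurable_bounded_integrable.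
- exact: (@measurable_unit_square R).
- exact: leb2_unit_square_lty.
- exact: measurable_funTS.
- exists M; split; first exact: num_real.
  by move=> x Mx z sz; apply: le_trans (hM z sz) (ltW Mx).
Qed.

Lemma integral_prod_eq0 (b d : R -> R) M :
  measurable_fun setT b -> measurable_fun setT d ->
  (forall x, `|b x| <= M) -> (forall y, `|d y| <= M) ->
  (\int[@lebesgue_measure R]_(x in `[0%R, 1%R]) (b x)%:E = 0)%E ->
  (\int[@leb2 R]_(z in @unit_square R) (b z.1 * d z.2)%:E = 0)%E.
Proof.
move=> mb md bM dM b0.
have intf : (@leb2 R).-integrable (@unit_square R) (EFin \o (fun z => b z.1 * d z.2)).
  apply: (@bounded_integrable_square _ (M * M)).
    by apply: measurable_funM; [exact: measurable_coord1|exact: measurable_coord2].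
  by move=> z _; rewrite normrM ler_pM.
rewrite integral_mkcond.
have intf' : (@leb2 R).-integrable setT ((EFin \o (fun z => b z.1 * d z.2)) \_ (@unit_square R)).
  have H := @integrable_mkcond _ _ R (@leb2 R) _ (EFin \o (fun z : R * R => b z.1 * d z.2)) (@measurable_unit_square R).
  exact: H.1 intf.
have := @integral21_prod_meas1 _ _ _ _ R (@lebesgue_measure R) (@lebesgue_measure R) _ intf'.
rewrite -[(_ \x _)%E]/(@leb2 R) => <-.
rewrite -(integral0 (@lebesgue_measure R) setT); apply: eq_integral => y _.
rewrite /fubini_G /patch /=.
transitivity ((\1_`[0%R,1%R]%classic y * d y)%:E * (\int[@lebesgue_measure R]_(x in `[0%R, 1%R]) (b x)%:E))%E; last by rewrite b0 mule0.
rewrite -integralZl//; last first.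
  apply: measurable_bounded_integrable => //.
  - exact: lebesgue_itv01_lty.
  - exact: measurable_funTS.
  - exists M; split; first exact: num_real.
    by move=> x Mx z sz; apply: le_trans (bM z) (ltW Mx).
rewrite [RHS]integral_mkcond; apply: eq_integral => x _; rewrite /patch.
rewrite indicE /unit_square in_setX /=.
case: (x \in _); case: (y \in _) => //=; rewrite ?mul0r ?mul0e ?mul1r//.
by rewrite -EFinM mulrC.
Qed.

Lemma integral_square_affine h (al c : R) M : measurable_fun setT h ->
  (forall z, `|h z| <= M) ->
  (\int[@leb2 R]_(z in @unit_square R) (h z)%:E = 0)%E ->
  (\int[@leb2 R]_(z in @unit_square R) (al + c * h z)%:E = al%:E)%E.
Proof.
move=> mh hM h0.
have ih : (@leb2 R).-integrable (@unit_square R) (EFin \o h).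
  by apply: (bounded_integrable_square (M := M)).
have ia : (@leb2 R).-integrable (@unit_square R) (EFin \o (fun=> al)).
  exact: (bounded_integrable_square (M := `|al|)).
under eq_integral do rewrite EFinD EFinM.
rewrite integralD//; last 2 first.
- exact: (@measurable_unit_square R).
- by apply: integrableZl => //; exact: (@measurable_unit_square R).
rewrite integralZl//; last exact: (@measurable_unit_square R).
rewrite h0 mule0 adde0 integral_cst; last exact: (@measurable_unit_square R).
by transitivity (al%:E * @leb2 R (@unit_square R))%E => //; rewrite leb2_unit_square mule1.
Qed.

End plane.

Section family.
Variables (R : realType) (p m : nat).
Hypotheses (p_gt0 : (0 < p)%N) (m_gt0 : (0 < m)%N) (m_le_p : (m <= p)%N).
Local Notation I := ('I_p * 'I_m)%type.
Implicit Types (i : I) (z : R * R) (th : {ffun I -> bool}).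

Definition tile i z : R := xbump p i.1 z.1 * ybump m i.2 z.2.
Definition pert th z : R := \sum_i (-1) ^+ (th i) * tile i z.
(** The uniform density perturbed by one signed bump per tile; the sum defining
    the perturbation has at most one nonzero term at each point. *)
Definition fam (a : R) th z : R := \1_(@unit_square R) z * (1 + a * pert th z).

Lemma tile_neq0 i z : tile i z != 0 ->
  xbump p i.1 z.1 != 0 /\ ybump m i.2 z.2 != 0.
Proof. by rewrite /tile mulf_eq0 negb_or => /andP[]. Qed.

Lemma tile_active z : exists i0, forall i, i != i0 -> tile i z = 0.
Proof.
have [[i0 hi0]|h] := pselect (exists i, tile i z != 0); last first.
  exists (Ordinal p_gt0, Ordinal m_gt0) => i _; apply/eqP/negPn/negP => hi.
  by apply: h; exists i.
exists i0 => i ii0; apply/eqP; apply: contraNT ii0.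
move=> /tile_neq0[a b]; move: hi0 => /tile_neq0[a0 b0].
apply/eqP; case: i i0 a b a0 b0 => [i1 i2] [j1 j2] /= a b a0 b0.
congr (_, _); apply/val_inj => /=.
  exact: (xbump_neq0 a a0).
exact: (ybump_neq0 (ltn_ord _) (ltn_ord _) b b0).
Qed.

Lemma sum_active (F : I -> R) i0 : (forall i, i != i0 -> F i = 0) -> \sum_i F i = F i0.
Proof. by move=> h; rewrite (bigD1 i0)//= big1 ?addr0. Qed.

Lemma pert_active th z : exists2 i0, (forall i, i != i0 -> tile i z = 0) &
  pert th z = (-1) ^+ (th i0) * tile i0 z.
Proof.
have [i0 h] := tile_active z; exists i0 => //; apply: sum_active => i /h ->.
by rewrite mulr0.
Qed.

Lemma tile_le1 i z : `|tile i z| <= 1.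
Proof. by rewrite normrM mulr_ile1 ?xbump_le1 ?ybump_le1. Qed.

Lemma pert_le1 th z : `|pert th z| <= 1.
Proof.
have [i0 _ ->] := pert_active th z.
by rewrite normrM normrX normrN1 expr1n mul1r tile_le1.
Qed.

Lemma tile_lip i z z' : `|tile i z - tile i z'| <= 3 * p%:R * `|z - z'|.
Proof.
rewrite /tile; set u := xbump _ _ _; set v := ybump _ _ _; set u' := xbump _ _ _; set v' := ybump _ _ _.
rewrite (_ : _ - _ = (u - u') * v + u' * (v - v')); last by ring.
apply: le_trans (ler_normD _ _) _; rewrite normrM [X in _ + X]normrM.
apply: (@le_trans _ _ (2 * p%:R * `|z - z'| * 1 + 1 * (m%:R * `|z - z'|))).
  apply: lerD; apply: ler_pM => //; rewrite ?xbump_le1 ?ybump_le1//.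
    by apply: le_trans (xbump_lip _ _ _ _) _; rewrite ler_wpM2l ?mulr_ge0// norm_pair1.
  by apply: le_trans (ybump_lip _ _ _ _) _; rewrite ler_wpM2l ?mulr_ge0// norm_pair2.
rewrite mulr1 mul1r -mulrDl ler_wpM2r// (_ : 3 * p%:R = 2 * p%:R + p%:R); last by ring.
by rewrite lerD2l ler_nat.
Qed.

(** The two points may lie in different tiles; then each of the two bumps
    vanishes at the other point, which costs a factor 2 in the constant. *)
Lemma pert_lip th z z' : `|pert th z - pert th z'| <= 6 * p%:R * `|z - z'|.
Proof.
have [i0 h0 ->] := pert_active th z; have [i1 h1 ->] := pert_active th z'.
have s1 (b : bool) (x : R) : `|(-1) ^+ b * x| = `|x|.
  by rewrite normrM normrX normrN1 expr1n mul1r.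
have n0 : 0 <= 3 * p%:R * `|z - z'| by rewrite !mulr_ge0.
rewrite (_ : 6 * _ * _ = 3 * p%:R * `|z - z'| + 3 * p%:R * `|z - z'|); last by ring.
have [->|i01] := eqVneq i0 i1.
  by rewrite -mulrBr s1; apply: le_trans (tile_lip _ _ _) _; rewrite lerDl.
rewrite (_ : _ - _ = (-1) ^+ th i0 * (tile i0 z - tile i0 z') -
   (-1) ^+ th i1 * (tile i1 z' - tile i1 z)); last first.
  by rewrite (h1 i0 i01) (h0 i1) 1?eq_sym// !subr0.
apply: le_trans (ler_normB _ _) _; rewrite !s1; apply: lerD; first exact: tile_lip.
by rewrite distrC; exact: tile_lip.
Qed.

Lemma measurable_tile i : measurable_fun setT (tile i).
Proof.
apply: measurable_funM.
  by apply: measurable_coord1; exact: measurable_xbump.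
by apply: measurable_coord2; exact: measurable_ybump.
Qed.

Lemma measurable_pert th : measurable_fun setT (pert th).
Proof.
apply: measurable_sum => i; apply: measurable_cmul.
exact: measurable_tile.
Qed.

Lemma measurable_fam a th : measurable_fun setT (fam a th).
Proof.
apply: measurable_funM.
  by apply: measurable_indic; exact: (@measurable_unit_square R).
by apply: measurable_funD => //; apply: measurable_cmul; exact: measurable_pert.
Qed.

Lemma integral_pert th : (\int[@leb2 R]_(z in @unit_square R) (pert th z)%:E = 0)%E.
Proof.
rewrite /pert; under eq_integral do rewrite -sumEFin.
rewrite integral_sum//=; first last.
- move=> i; apply: (bounded_integrable_square (M := 1)).
    by apply: measurable_cmul; exact: measurable_tile.
  by move=> z _; rewrite normrM normrX normrN1 expr1n mul1r tile_le1.
- exact: (@measurable_unit_square R).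
rewrite big1// => i _.
rewrite /tile; under eq_integral do rewrite mulrA.
apply: (@integral_prod_eq0 R (fun x => (-1) ^+ th i * xbump p i.1 x) (ybump m i.2) 1).
- by apply: measurable_cmul; exact: measurable_xbump.
- exact: measurable_ybump.
- by move=> x; rewrite normrM normrX normrN1 expr1n mul1r xbump_le1.
- exact: ybump_le1.
under eq_integral do rewrite EFinM.
rewrite integralZl//; first by rewrite integral_xbump// mule0.
apply: measurable_bounded_integrable => //.
- exact: lebesgue_itv01_lty.
- by apply: measurable_funTS; exact: measurable_xbump.
- exists 1; split; first exact: num_real.
  by move=> x Mx z sz; apply: le_trans (xbump_le1 _ _ _) (ltW Mx).
Qed.

Lemma fam_in a th z : @unit_square R z -> fam a th z = 1 + a * pert th z.
Proof. by move=> sz; rewrite /fam indicE mem_set// mul1r. Qed.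

Lemma fam_out a th z : ~ @unit_square R z -> fam a th z = 0.
Proof. by move=> sz; rewrite /fam indicE memNset// mul0r. Qed.

Lemma integral_fam a th : (\int[@leb2 R]_z (fam a th z)%:E = 1)%E.
Proof.
rewrite -integral_unit_square; last by move=> z /fam_out ->.
rewrite -(@integral_square_affine R (pert th) 1 a 1) ?integral_pert//.
- by apply: eq_integral => z; rewrite inE => /fam_in ->.
- exact: measurable_pert.
- exact: pert_le1.
Qed.

Lemma integral_fam2 a th :
  (\int[@leb2 R]_z (fam a th z ^+ 2)%:E <= (1 + a ^+ 2)%:E)%E.
Proof.
rewrite -integral_unit_square; last by move=> z /fam_out ->; rewrite expr0n.
rewrite -(@integral_square_affine R (pert th) (1 + a ^+ 2) (2 * a) 1) ?integral_pert//; last 2 first.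
- exact: measurable_pert.
- exact: pert_le1.
apply: ge0_le_integralT => z sz; rewrite lee_fin ?sqr_ge0// fam_in//.
have : pert th z ^+ 2 <= 1.
  by rewrite -real_normK ?num_real// expr_le1// pert_le1.
move=> h; have : a ^+ 2 * pert th z ^+ 2 <= a ^+ 2 by rewrite ler_piMr ?sqr_ge0.
by lra.
Qed.

Section small.
Variable a : R.
Hypothesis a2 : 0 <= a <= 1 / 2.

Lemma fam_ge_half th z : @unit_square R z -> 1 / 2 <= fam a th z.
Proof.
move=> sz; rewrite fam_in//; have := pert_le1 th z; rewrite ler_norml => /andP[h _].
case/andP: a2 => a0 a1; have := ler_wpM2l a0 h; lra.
Qed.

Lemma fam_ge0 th z : 0 <= fam a th z.
Proof.
have [sz|/fam_out ->//] := pselect (@unit_square R z).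
by apply: le_trans (fam_ge_half th sz); lra.
Qed.

(** At distances below 1 / p the Lipschitz bound is stronger than the Holder
    one, and beyond it the oscillation of the perturbation, at most 2, suffices. *)
Lemma fam_holder_density (beta L : R) th : 0 < beta <= 1 ->
  a * (6 * p%:R `^ beta) <= L -> holder_density beta L (fam a th).
Proof.
move=> hb aL; split.
- exact: fam_ge0.
- rewrite integral_unit_square ?integral_fam//.
  by move=> z /fam_out ->.
- exists 0, 1, 0, 1; rewrite !in_itv /= !lexx ler01; split=> //.
  apply/seteqP; split => z; rewrite /supp /=.
    by move=> h; apply: contrapT => /(fam_out a th) h'; rewrite h' eqxx in h.
  by move=> sz; rewrite gt_eqF//; apply: lt_le_trans (fam_ge_half th sz); lra.
move=> z z'.
have sq w : supp (fam a th) w -> unit_square w.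
  by move=> h; apply: contrapT => /(fam_out a th) h'; move: h; rewrite /supp /= h' eqxx.
move=> /sq sz /sq sz'; rewrite !fam_in// opprD addrACA subrr add0r -mulrBr.
have a0 : 0 <= a by case/andP: a2.
rewrite normrM (ger0_norm a0).
have p0 : 0 < p%:R :> R by rewrite ltr0n.
suff h : `|pert th z - pert th z'| <= 6 * p%:R `^ beta * `|z - z'| `^ beta.
  apply: (@le_trans _ _ (a * (6 * p%:R `^ beta * `|z - z'| `^ beta))).
    by rewrite ler_wpM2l.
  by rewrite mulrA ler_wpM2r// powR_ge0.
rewrite -mulrA -powRM//.
have [h1|h1] := leP (p%:R * `|z - z'|) 1.
  apply: le_trans (pert_lip _ _ _) _; rewrite -mulrA ler_wpM2l//.
  have [->|nz] := eqVneq (p%:R * `|z - z'|) 0; first exact: powR_ge0.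
  apply: ger1_powR; last lra.
  by rewrite h1 lt0r nz mulr_ge0.
apply: (@le_trans _ _ (1 + 1)).
  by apply: le_trans (ler_normB _ _) _; apply: lerD; exact: pert_le1.
apply: (@le_trans _ _ (6 * 1)); first lra.
have E1 : 1 `^ beta = 1 :> R by rewrite powR1.
by rewrite ler_wpM2l// -[leLHS]E1; apply: ge0_ler_powR; rewrite ?nnegrE; lra.
Qed.

(** A part of the tile on which the bump is bounded below. *)
Definition spot i : set (R * R) :=
  `[(i.1%:R + 1 / 8) / p%:R, (i.1%:R + 3 / 8) / p%:R]%classic `*`
  `[(i.2%:R + 1 / 4) / m%:R, (i.2%:R + 3 / 4) / m%:R]%classic.

Let p0 : 0 < p%:R :> R. Proof. by rewrite ltr0n. Qed.
Let m0 : 0 < m%:R :> R. Proof. by rewrite ltr0n. Qed.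

Lemma spotP i z : spot i z <->
  (1 / 8 <= p%:R * z.1 - i.1%:R <= 3 / 8) /\ (1 / 4 <= m%:R * z.2 - i.2%:R <= 3 / 4).
Proof.
rewrite /spot /= !in_itv /= !ler_pdivrMr// !ler_pdivlMr//.
by split=> -[h1 h2]; split; lra.
Qed.

Lemma tile_spot i z : spot i z -> 1 / 512 <= `|tile i z|.
Proof.
move=> /spotP[/xbump_ge h1 /ybump_ge h2]; rewrite /tile normrM.
by apply: le_trans (ler_pM _ _ h1 h2); lra.
Qed.

Lemma spot_square i z : spot i z -> @unit_square R z.
Proof.
move=> /spotP[h1 h2]; apply/unit_squareE.
have i1 : i.1%:R + 1 <= p%:R :> R by rewrite natr1 ler_nat.
have i2 : i.2%:R + 1 <= m%:R :> R by rewrite natr1 ler_nat.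
have j1 : 0 <= i.1%:R :> R by [].
have j2 : 0 <= i.2%:R :> R by [].
have z10 : 0 <= z.1 by rewrite -(pmulr_rge0 _ p0); lra.
have z20 : 0 <= z.2 by rewrite -(pmulr_rge0 _ m0); lra.
have z11 : z.1 <= 1 by rewrite -(ler_pM2l p0); lra.
have z21 : z.2 <= 1 by rewrite -(ler_pM2l m0); lra.
by rewrite z10 z20 z11 z21.
Qed.

Lemma leb2_spot i : @leb2 R (spot i) = (8 * (p * m)%:R)^-1%:E.
Proof.
rewrite /spot leb2_rect ?ler_pM2r ?invr_gt0//; [|lra|lra].
by congr EFin; rewrite natrM; field; rewrite !gt_eqF.
Qed.

Lemma measurable_spot i : measurable (spot i).
Proof. exact: measurableX. Qed.

(** On the spot of each tile where the signs differ the densities differ by at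
    least a / 256, and a spot has area 1 / (8 p m). *)
Lemma fam_separation th th' :
  ((a * #|[pred i | th i != th' i]|%:R / (2 ^+ 11 * (p * m)%:R))%:E <=
    L1_dist (fam a th) (fam a th'))%E.
Proof.
have a0 : 0 <= a by case/andP: a2.
rewrite /L1_dist integral_unit_square; last first.
  by move=> z sz; rewrite !fam_out// subee// abse0.
have c0 : 0 <= a / 256 := divr_ge0 a0 (ler0n _ 256).
pose w i : R := if th i != th' i then a / 256 else 0.
have w0 i : 0 <= w i by rewrite /w; case: ifP.
(* At each point at most one term is nonzero, on both sides. *)
have key z : \sum_i w i * \1_(spot i) z <=
    `|fam a th z - fam a th' z|.
  have [sz|sz] := pselect (@unit_square R z); last first.
    rewrite big1// => i _; rewrite indicE memNset ?mulr0//.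
    by move=> /spot_square.
  rewrite !fam_in// opprD addrACA subrr add0r -mulrBr.
  have [i0 h0 E0] := pert_active th z.
  have E1 : pert th' z = (-1) ^+ (th' i0) * tile i0 z.
    by apply: sum_active => i /h0 ->; rewrite mulr0.
  have hs i : i != i0 -> \1_(spot i) z = 0 :> R.
    move=> /h0 h; rewrite indicE memNset// => /tile_spot.
    by rewrite h normr0; lra.
  rewrite E0 E1 -mulrBl.
  rewrite (sum_active (i0 := i0)); last by move=> i /hs ->; rewrite mulr0.
  rewrite /w; case: ifPn => thi; last by rewrite mul0r.
  have [s0|s0] := pselect (spot i0 z); last first.
    by rewrite indicE memNset// mulr0.
  rewrite indicE mem_set// mulr1 2!normrM (ger0_norm a0) mulrA.
  have -> : `|(-1) ^+ th i0 - (-1) ^+ th' i0| = 2 :> R.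
    move: thi; case: (th i0); case: (th' i0) => //= _; rewrite expr0 expr1.
      by rewrite -opprD normrN ger0_norm//; lra.
    by rewrite opprK ger0_norm//; lra.
  apply: le_trans (ler_wpM2l _ (tile_spot s0)); last by rewrite mulr_ge0.
  by lra.
apply: (@le_trans _ _ (\int[@leb2 R]_z (\sum_i w i * \1_(spot i) z)%:E)%E); last first.
  apply: ge0_le_integralT => z _; last by rewrite -EFinB lee_fin key.
  by rewrite lee_fin sumr_ge0// => i _; rewrite mulr_ge0// indicE ler0n.
under eq_integral do rewrite -sumEFin.
rewrite ge0_integral_sum//; last 2 first.
- move=> i; apply/measurable_EFinP; apply: measurable_cmul; apply: measurable_indic.
  exact: measurable_spot.
- by move=> i z _; rewrite lee_fin mulr_ge0// indicE ler0n.
have E i : (\int[@leb2 R]_z (w i * \1_(spot i) z)%:E =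
    (w i / (8 * (p * m)%:R))%:E)%E.
  under eq_integral do rewrite EFinM.
  rewrite ge0_integralZl_EFin//.
  - rewrite integral_leb2_indic; last exact: measurable_spot.
    by rewrite leb2_spot.
  - by apply/measurable_EFinP; apply: measurable_indic; exact: measurable_spot.
rewrite (eq_bigr _ (fun i _ => E i)) sumEFin lee_fin -mulr_suml /w -big_mkcond /=.
rewrite sumr_const -mulr_natr.
rewrite le_eqVlt; apply/orP; left; apply/eqP; rewrite natrM; field.
by rewrite !gt_eqF.
Qed.

End small.

Lemma bounded_integrable01 (h : R -> R) M : measurable_fun setT h ->
  (forall x, `|h x| <= M) ->
  (@lebesgue_measure R).-integrable `[0%R, 1%R] (EFin \o h).
Proof.
move=> mh hM; apply: measurable_bounded_integrable => //.
- exact: lebesgue_itv01_lty.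
- exact: measurable_funTS.
- exists M; split; first exact: num_real.
  by move=> x Mx z sz; apply: le_trans (hM z) (ltW Mx).
Qed.

Lemma integrable01_cst (c : R) :
  (@lebesgue_measure R).-integrable `[0%R, 1%R] (EFin \o (cst c : R -> R)).
Proof. by apply: (@bounded_integrable01 _ `|c|). Qed.

(** Padding with zero summands: the rank may be anything up to K. *)
Lemma low_rank_nat (K r : nat) (U V : nat -> R -> R) (f : R * R -> R) :
  (r <= K)%N ->
  (forall k, (@lebesgue_measure R).-integrable `[0%R, 1%R] (EFin \o U k)) ->
  (forall k, (@lebesgue_measure R).-integrable `[0%R, 1%R] (EFin \o V k)) ->
  (forall x y, x \in `[0%R, 1%R] -> y \in `[0%R, 1%R] ->
     f (x, y) = \sum_(k < r) U k x * V k y) ->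
  @low_rank R K f.
Proof.
move=> rK iU iV fE.
exists (fun k : 'I_K => if (k < r)%N then U k else cst 0), (fun k : 'I_K => V k).
split.
- by move=> k; case: ifP => // _; exact: integrable01_cst.
- by move=> k.
move=> x y hx hy; rewrite fE//.
rewrite (big_ord_widen K (fun k => U k x * V k y))// big_mkcond /=.
by apply: eq_bigr => k _; case: ifP => //; rewrite mul0r.
Qed.

(** Group the tiles by strips: each strip is one product of a function of x and
    a function of y, and the constant 1 is one more summand, which merges with
    the only strip if m = 1. *)
Lemma fam_low_rank a th K : (if m == 1%N then 1 <= K else m < K)%N ->
  @low_rank R K (fam a th).
Proof.
pose s1 (i : I) : R := (-1) ^+ th i.
pose W (k : nat) x : R := a * \sum_(i : I) (if i.2 == k :> nat then s1 i * xbump p i.1 x else 0).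
have s1n i (x : R) : `|s1 i * x| = `|x|.
  by rewrite normrM normrX normrN1 expr1n mul1r.
have mW k : measurable_fun setT (W k).
  apply: measurable_cmul; apply: measurable_sum => i; case: (_ == _) => //.
  by apply: measurable_cmul; exact: measurable_xbump.
have bW k x : `|W k x| <= `|a| * \sum_(i : I) 1.
  rewrite normrM ler_wpM2l//; apply: le_trans (ler_norm_sum _ _ _) _.
  by apply: ler_sum => i _; case: ifP => _; rewrite ?normr0// s1n xbump_le1.
have i1 := integrable01_cst 1.
have sq x y : x \in `[0%R, 1%R] -> y \in `[0%R, 1%R] -> @unit_square R (x, y).
  by [].
have pE x y : a * pert th (x, y) = \sum_(k < m) W k x * ybump m k y.
  rewrite /pert (partition_big (fun i : I => i.2) predT)//= mulr_sumr.
  apply: eq_bigr => k _; rewrite /W -big_mkcond -mulrA; congr (_ * _); rewrite mulr_suml.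
  by apply: eq_bigr => i /eqP <-; rewrite /tile mulrA.
case: ifP => [/eqP m1|m1] hK.
  apply: (@low_rank_nat K 1 (fun k => cst 1 \+ W k) (fun=> cst 1)) => // [k|x y hx hy].
    apply: (@bounded_integrable01 _ (1 + `|a| * \sum_(i : I) 1)).
      by apply: measurable_funD.
    by move=> x; apply: le_trans (ler_normD _ _) _; rewrite normr1 lerD2l.
  rewrite fam_in; last exact: sq.
  rewrite big_ord1 /= mulr1 pE m1 big_ord1 /= /ybump eqxx mulr1//.
apply: (@low_rank_nat K m.+1 (fun k => if k is k'.+1 then W k' else cst 1)
  (fun k => if k is k'.+1 then ybump m k' else cst 1)) => //.
- move=> [|k] //; apply: bounded_integrable01; [exact: mW|exact: bW].
- by move=> [|k] //; apply: (@bounded_integrable01 _ 1); [exact: measurable_ybump|exact: ybump_le1].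
move=> x y hx hy; rewrite fam_in; last exact: sq.
by rewrite big_ord_recl /= mulr1 pE.
Qed.

End family.

(** * The lower bound *)

Section lower.
Variable R : realType.

Lemma estimator_measurable n (fh : n.-tuple (R * R) -> R * R -> R) s :
  @estimators R n fh -> measurable_fun setT (fh s).
Proof.
move=> [mfh _].
have := measurableT_comp mfh (_ : measurable_fun setT (fun z : R * R => (s, z))).
by apply; exact: measurable_fun_pair.
Qed.

Lemma expR_half_le2 : expR (1 / 2 : R) <= 2.
Proof.
have := expR_ge1Dx (- (1 / 2) : R); rewrite expRN => h.
have h0 : 0 < expR (1 / 2 : R) := expR_gt0 _.
have : (1 / 2) * expR (1 / 2) <= (expR (1 / 2))^-1 * expR (1 / 2) :> R.
  by rewrite ler_pM2r//; lra.
by rewrite mulVf ?gt_eqF//; lra.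
Qed.

Lemma chi2_le (a : R) (n r : nat) : n%:R * a ^+ 2 <= r%:R / 2 ->
  (1 + a ^+ 2) ^+ n <= 2 ^+ r.
Proof.
move=> h; apply: (@le_trans _ _ (expR (a ^+ 2) ^+ n)).
  by rewrite lerXn2r ?nnegrE ?expR_ge0 ?expR_ge1Dx// addr_ge0 ?sqr_ge0.
rewrite -expRM_natl; apply: (@le_trans _ _ (expR (r%:R * (1 / 2)))).
  by rewrite ler_expR; lra.
rewrite expRM_natl lerXn2r ?nnegrE ?expR_ge0//; exact: expR_half_le2.
Qed.

(** The numerical core of the lower bound.  With 8 r tiles there are 256^r sign
    patterns, at most 24^r of which are close to an estimate, and the moment
    (1 + a^2)^n is at most 2^r; [many_hypotheses] at k = 4^r then bounds a
    success probability by (96/256)^r / 2 + (2/4)^r / 2 <= 2^(-r).  The constant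
    2^15 is chosen so that, by [fam_separation], two patterns within a / 2^15 of
    the same estimate differ in at most r signs. *)
Lemma cube_lower_bound (k : R) (kE : k = 2 ^+ 15) (p' m r n K : nat) (a beta L t : R)
    (fh : n.-tuple (R * R) -> R * R -> R) :
  (0 < p')%N -> (0 < m)%N -> (m <= 8 * p')%N -> r = (p' * m)%N ->
  (if m == 1%N then 1 <= K else m < K)%N ->
  0 < beta <= 1 ->
  0 < a <= 1 / 2 -> a * (6 * (8 * p')%:R `^ beta) <= L ->
  n%:R * a ^+ 2 <= r%:R / 2 -> t <= a / k ->
  @estimators R n fh ->
  ((1 - (1 / 2) ^+ r)%:E <= ereal_sup
    [set iid_prob f [set s : n.-tuple (R * R) | (t%:E < L1_dist (fh s) f)%E]
          | f in low_rank_holder_density K beta L])%E.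
Proof.
move=> p0 m0 mp rE hK hb ha aL na ta efh.
have [p pE] : exists p, p = (8 * p')%N by exists (8 * p')%N.
rewrite -pE in mp aL.
have p_gt0 : (0 < p)%N by rewrite pE muln_gt0.
have ha2 : 0 <= a <= 1 / 2 by lra.
pose I := ('I_p * 'I_m)%type.
have cI : #|{: I}| = (8 * r)%N by rewrite card_prod !card_ord rE pE mulnA.
have cTh : #|{: {ffun I -> bool}}|%:R = 256 ^+ r :> R.
  by rewrite card_ffun card_bool cI natrX exprM -natrX.
pose B : R := 24 ^+ r.
have hB (s : n.-tuple (R * R)) : #|[pred i : {ffun I -> bool} | `[< (L1_dist (fh s) (fam a i) <= t%:E)%E >]]|%:R <= B.
  have [[th0 h0]|h] := pselect (exists th : {ffun I -> bool}, (L1_dist (fh s) (fam a th) <= t%:E)%E); last first.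
    rewrite (_ : #|_| = 0%N) ?exprn_ge0//; apply: eq_card0 => th.
    by apply/negbTE/negP => /asboolP h'; apply: h; exists th.
  apply: le_trans (hamming_ball R th0 cI); rewrite ler_nat; apply: subset_leq_card.
  apply/fintype.subsetP => th /asboolP h; rewrite unfold_in.
  have mfs := estimator_measurable s efh.
  have := le_trans (fam_separation p_gt0 m0 ha2 th th0) (L1_dist_triangle mfs
    (measurable_fam a th) (measurable_fam a th0)).
  move=> /le_trans /(_ (leeD h h0)); rewrite -EFinD lee_fin => hd.
  rewrite -(ler_nat R); move: hd.
  set d := #|_|; have -> : (p * m)%:R = 8 * r%:R :> R by rewrite -natrM rE pE mulnA.
  have r0 : 0 < r%:R :> R by rewrite ltr0n rE muln_gt0 p0.
  rewrite ler_pdivrMr; last by rewrite mulr_gt0 ?exprn_gt0 ?mulr_gt0.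
  move=> hd; case/andP: ha => a0 _; rewrite -(ler_pM2l a0); apply: le_trans hd _.
  have : (t + t) * (2 ^+ 11 * (8 * r%:R)) <= (a / k + a / k) * (2 ^+ 11 * (8 * r%:R)).
    by apply: ler_wpM2r; [rewrite mulr_ge0 ?exprn_ge0 ?mulr_ge0 ?(ltW r0)|exact: lerD].
  by move=> /le_trans; apply; rewrite kE le_eqVlt; apply/orP; left; apply/eqP; field.
have r4 : 0 < 4 ^+ r :> R by rewrite exprn_gt0.
have [||th Hth] := @many_hypotheses R {ffun I -> bool} (fam a) n fh t B
    (1 + a ^+ 2) (4 ^+ r)
  _ (measurable_fam a) (fam_ge0 p_gt0 m0 ha2) (fam_out a) (integral_fam p_gt0 m0 a)
  (integral_fam2 p_gt0 m0 a) efh r4 _ hB.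
- by apply/card_gt0P; exists [ffun=> true].
- by rewrite exprn_ge0.
apply: (@le_trans _ _ (iid_prob (fam a th) [set s | (t%:E < L1_dist (fh s) (fam a th))%E])).
  apply: le_trans Hth; rewrite lee_fin lerD2l lerN2 cTh.
  have -> : (1 / 2) ^+ r = (1 / 2) ^+ r / 2 + (1 / 2) ^+ r / 2 :> R by field.
  apply: lerD.
    rewrite invfM mulrA mulrAC ler_pM2r ?invr_gt0// -exprMn -exprVn -exprMn.
    by rewrite lerXn2r ?nnegrE; lra.
  rewrite invfM mulrCA mulrC ler_pM2r ?invr_gt0// ler_pdivrMr//.
  by apply: le_trans (chi2_le na) _; rewrite -exprMn lerXn2r ?nnegrE; lra.
apply: ereal_sup_ubound; exists (fam a th) => //; split.
  exact: fam_holder_density.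
exact: fam_low_rank.
Qed.

Lemma nat_between (x : R) : 1 <= x -> exists2 q : nat, (0 < q)%N & x <= q%:R <= 2 * x.
Proof.
move=> x1; exists (Num.truncn x).+1 => //.
have /andP[h1 h2] := truncn_itv (le_trans ler01 x1).
by rewrite (ltW h2) -natr1; lra.
Qed.

Lemma nat_below (x : R) : 1 <= x -> exists2 q : nat, (0 < q)%N & x / 2 <= q%:R <= x.
Proof.
move=> x1; exists (Num.truncn x); first by rewrite truncn_gt0.
have /andP[h1 h2] := truncn_itv (le_trans ler01 x1).
rewrite h1 andbT; have : 1 <= (Num.truncn x)%:R :> R by rewrite ler1n truncn_gt0.
by move: h2; rewrite -natr1; lra.
Qed.

Lemma powR_invl (x r : R) : 0 <= x -> (x^-1) `^ r = (x `^ r)^-1.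
Proof. by move=> x0; rewrite -powR_inv1// -powRrM mulN1r powRN. Qed.

Lemma powR_le (x y r : R) : 0 <= r -> 0 <= x -> x <= y -> x `^ r <= y `^ r.
Proof. by move=> r0 x0 xy; apply: ge0_ler_powR; rewrite ?nnegrE// (le_trans x0). Qed.

Lemma powR_le_base (x r : R) : 1 <= x -> 0 <= r <= 1 -> x `^ r <= x.
Proof. by move=> x1 /andP[r0 r1]; rewrite -[leRHS]powRr1 ?ler_powR// (le_trans ler01). Qed.

Lemma powR_rootK (x s : R) : 0 <= x -> 0 < s -> (x `^ (1 / s)) `^ s = x.
Proof. by move=> x0 s0; rewrite -powRrM mul1r mulVf ?gt_eqF// powRr1. Qed.

Lemma powRK_root (x s : R) : 0 <= x -> 0 < s -> (x `^ s) `^ (1 / s) = x.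
Proof. by move=> x0 s0; rewrite -powRrM mul1r mulfV ?gt_eqF// powRr1. Qed.

Section balance.
Variables (beta : R) (n : nat).
Hypotheses (b0 : 0 < beta) (n1 : (1 <= n)%N).
Local Notation x := (n%:R `^ (1 / (2 * beta + 2)) : R).

Let b1 : 0 < 2 * beta + 1. Proof. by rewrite addr_gt0 ?mulr_gt0. Qed.
Let b2 : 0 < 2 * beta + 2. Proof. by rewrite addr_gt0 ?mulr_gt0. Qed.
Let n1R : 1 <= n%:R :> R. Proof. by rewrite ler1n. Qed.
Let n0R : 0 < n%:R :> R. Proof. by rewrite ltr0n. Qed.

Lemma x_ge1 : 1 <= x.
Proof. by rewrite -[leLHS](powRr0 n%:R) ler_powR// divr_ge0// ltW. Qed.

Lemma x_rate : (x / n%:R) `^ (beta / (2 * beta + 1)) = n%:R `^ (- (beta / (2 * beta + 2))).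
Proof.
have -> : x / n%:R = n%:R `^ (1 / (2 * beta + 2) - 1).
  by rewrite powRD ?powR_inv1// ?(ltW n0R)//; apply/implyP => _; rewrite gt_eqF.
rewrite -powRrM; congr (_ `^ _); field.
by rewrite !gt_eqF.
Qed.

Variable m : nat.
Hypothesis m1 : (1 <= m)%N.
Local Notation Q := ((n%:R / m%:R) `^ (1 / (2 * beta + 1)) : R).
Let m0R : 0 < m%:R :> R. Proof. by rewrite ltr0n. Qed.

Lemma x_le_Q : m%:R <= x -> x <= Q.
Proof.
move=> mx; rewrite -[leLHS](@powRK_root x (2 * beta + 1))// ?powR_ge0//.
apply: powR_le; [by rewrite divr_ge0// ltW|exact: powR_ge0|].
rewrite ler_pdivlMr//.
apply: (@le_trans _ _ (x `^ (2 * beta + 1) * x)); first by rewrite ler_wpM2l ?powR_ge0.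
rewrite [X in _ * X](_ : x = x `^ 1); last by rewrite powRr1// powR_ge0.
rewrite -powRD; last by apply/implyP => _; rewrite gt_eqF// powR_gt0.
by rewrite -addrA (_ : 1 + 1 = 2 :> R)// powR_rootK.
Qed.

Lemma balanceQ : (m%:R / n%:R) `^ (beta / (2 * beta + 1)) = Q `^ (- beta).
Proof.
rewrite powRN -powRrM (_ : 1 / (2 * beta + 1) * beta = beta / (2 * beta + 1)); last first.
  by rewrite mul1r mulrC.
rewrite -powR_invl ?divr_ge0//; congr (_ `^ _).
by rewrite invf_div.
Qed.

(** The equation that determines the mesh: the amplitude Q^(-beta) spreads n
    observations so that each of the m Q tiles receives bounded information. *)
Lemma balance_n : n%:R * (Q `^ (- beta)) ^+ 2 = m%:R * Q.
Proof.
have Q0 : 0 < Q by rewrite powR_gt0// divr_gt0.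
have QE : Q `^ (2 * beta + 1) = n%:R / m%:R by apply: powR_rootK => //; rewrite divr_ge0.
move: Q0 QE; move: Q => q Q0 QE.
rewrite [X in X * _](_ : n%:R = m%:R * q `^ (2 * beta + 1)); last by rewrite QE mulrC divfK// gt_eqF.
rewrite -powR_mulrn ?powR_ge0// -powRrM -mulrA -powRD; last first.
  by apply/implyP => _; rewrite gt_eqF.
by congr (_ * _); rewrite (_ : _ + _ = 1 :> R) ?powRr1 ?(ltW Q0)//; ring.
Qed.

End balance.

Lemma powR_double (x y e : R) : 0 <= e <= 1 -> 0 <= x -> 0 <= y -> x <= 2 * y ->
  x `^ e <= 2 * y `^ e.
Proof.
move=> /andP[e0 e1] x0 y0 xy; apply: le_trans (powR_le e0 x0 xy) _.
rewrite powRM// ler_wpM2r ?powR_ge0//; apply: powR_le_base; rewrite ?e0//.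
by rewrite ler1n.
Qed.

(** The minimum of the two rates is governed by the number m of strips, which
    can be neither larger than K - 1 (to respect the rank) nor usefully larger
    than n^(1/(2 beta + 2)), where the two rates agree. *)
Lemma lower_strips (beta : R) (K n : nat) : 0 < beta -> (1 <= K)%N -> (1 <= n)%N ->
  exists m : nat, [/\ (1 <= m)%N, (if m == 1 then 1 <= K else m < K)%N,
   m%:R <= n%:R `^ (1 / (2 * beta + 2)) &
   Num.min ((K%:R / n%:R) `^ (beta / (2 * beta + 1))) (n%:R `^ (- (beta / (2 * beta + 2))))
   <= 2 * (m%:R / n%:R) `^ (beta / (2 * beta + 1))].
Proof.
move=> b0 K1 n1.
have [mc mc0 /andP[mc1 mc2]] := nat_below (x_ge1 b0 n1).
have hb : 0 <= beta / (2 * beta + 1) <= 1.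
  have b1 : 0 < 2 * beta + 1 by lra.
  by rewrite divr_ge0 ?(ltW b0) ?(ltW b1)//= ler_pdivrMr//; lra.
have n0 : 0 < n%:R :> R by rewrite ltr0n.
have [h|h] := leqP (maxn 1 K.-1) mc.
  exists (maxn 1 K.-1); split.
  - exact: leq_maxl.
  - by case: eqP => //; lia.
  - by apply: le_trans mc2; rewrite ler_nat.
  rewrite ge_min; apply/orP; left; apply: (powR_double hb); rewrite ?divr_ge0//.
  by rewrite mulrA ler_pM2r ?invr_gt0// -natrM ler_nat; lia.
exists mc; split => //.
  by case: eqP => // _; lia.
rewrite ge_min; apply/orP; right; rewrite -(x_rate b0 n1); apply: (powR_double hb);
  rewrite ?divr_ge0 ?powR_ge0//.
by rewrite mulrA ler_pM2r ?invr_gt0//; lra.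
Qed.

Lemma half_power_small (d : R) : 0 < d -> exists2 r : nat, (0 < r)%N & (1 / 2) ^+ r < d.
Proof.
move=> d0; have [r hr] : exists r : nat, d^-1 < r%:R.
  by exists (Num.truncn d^-1).+1; exact: truncnS_gt.
exists r; first by rewrite -(ltr0n R) (lt_trans _ hr)// invr_gt0.
have : r%:R <= 2 ^+ r :> R by rewrite -natrX ler_nat ltnW// ltn_expl.
move=> /(lt_le_trans hr) h; rewrite mul1r exprVn invf_plt ?posrE ?exprn_gt0//.
Qed.

(** Refining the mesh by a constant factor r0 makes the failure probability
    1 - 2^(-r0) exceed 2^(-gamma), hence n^(-gamma), while the amplitude only
    changes by a constant. *)
Lemma minimax_lower_bound (gamma beta L : R) : 0 < gamma -> 0 < beta <= 1 -> 0 < L ->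
  exists2 c : R, 0 < c & forall K n : nat, (1 <= K)%N -> (2 <= n)%N ->
      ((c * Num.min ((K%:R / n%:R) `^ (beta / (2 * beta + 1)))
                    (n%:R `^ (- (beta / (2 * beta + 2)))))%:E
        <= minimax_quantile (n%:R `^ (- gamma)) n (low_rank_holder_density K beta L))%E.
Proof.
move=> g0 hb L0.
have d0 : 0 < 1 - 2 `^ (- gamma) :> R.
  have E1 : 1 `^ gamma = 1 :> R by rewrite powR1.
  by rewrite subr_gt0 powRN invf_lt1 ?powR_gt0// -[ltLHS]E1 gt0_ltr_powR ?nnegrE ?ltr1n.
have [r0 r0_gt0 hr0] := half_power_small d0.
have r0R : 0 < r0%:R :> R by rewrite ltr0n.
(* The amplitude is a0 times its natural order; a0 absorbs the Holder constant of
   the bumps and the refinement of the mesh by r0. *)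
have [a0 a0_gt0 [a0_le a0_L]] : exists2 a0 : R, 0 < a0 & a0 <= 1 / 2 /\ a0 * (6 * (16 * r0%:R)) <= L.
  exists (Num.min (1 / 2) (L / (6 * (16 * r0%:R)))).
    by rewrite lt_min !divr_gt0 ?mulr_gt0 ?ltr0n.
  split; first by rewrite ge_min lexx.
  by rewrite -ler_pdivlMr ?mulr_gt0 ?ltr0n// ge_min lexx orbT.
have [k kE] : exists k : R, k = 2 ^+ 15 by exists (2 ^+ 15).
have k_gt0 : 0 < k by rewrite kE exprn_gt0.
have cube := @cube_lower_bound k kE; clear kE.
exists (a0 / (2 * k)); first by rewrite divr_gt0// mulr_gt0.
move=> K n K1 n2.
have b0 : 0 < beta by case/andP: hb.
have n1 : (1 <= n)%N by exact: ltnW.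
have [m [m1 mK mx mrate]] := lower_strips b0 K1 n1.
have := x_le_Q b0 n1 m1 mx; have := balance_n b0 n1 m1.
move: mrate; rewrite [(m%:R / n%:R) `^ _]balanceQ.
set Q := (n%:R / m%:R) `^ _; set rate := Num.min _ _; set x := n%:R `^ _.
move=> mrate nQ xQ.
have Q1 : 1 <= Q by exact: le_trans (x_ge1 b0 n1) xQ.
have Q0 : 0 < Q by exact: lt_le_trans Q1.
have mQ : m%:R <= Q by exact: le_trans xQ.
move: mrate nQ Q1 Q0 mQ; clear xQ mx; move: Q rate => Q rate mrate nQ Q1 Q0 mQ; clear x.
have [q q_gt0 /andP[q1 q2]] := nat_between Q1.
have QB0 : 0 < Q `^ (- beta) by rewrite powR_gt0.
have QB1 : Q `^ (- beta) <= 1.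
  by rewrite powRN invf_le1 ?powR_gt0// -(powRr0 Q) ler_powR// ltW.
have pQ : (8 * (r0 * q))%:R `^ beta <= (16 * r0%:R) * Q `^ beta.
  have h0 : 0 <= 16 * r0%:R :> R by rewrite mulr_ge0.
  apply: (@le_trans _ _ ((16 * r0%:R * Q) `^ beta)).
    apply: powR_le; rewrite ?(ltW b0)// !natrM.
    rewrite [leRHS](_ : _ = 8 * (r0%:R * (2 * Q))); last by ring.
    by rewrite !ler_pM2l.
  rewrite powRM ?(ltW Q0)// ler_wpM2r ?powR_ge0//; apply: powR_le_base.
    rewrite -natrM ler1n muln_gt0; exact: r0_gt0.
  by case/andP: hb => /ltW -> ->.
pose a := a0 * Q `^ (- beta).
have a_gt0 : 0 < a by rewrite mulr_gt0.
have a_le : a <= 1 / 2 by apply: le_trans a0_le; rewrite ler_piMr// ltW.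
have aL : a * (6 * (8 * (r0 * q))%:R `^ beta) <= L.
  apply: le_trans a0_L; rewrite /a -mulrA ler_pM2l// mulrCA ler_pM2l//.
  by rewrite mulrC powRN ler_pdivrMr ?powR_gt0.
have na : n%:R * a ^+ 2 <= (r0 * q * m)%:R / 2.
  rewrite /a exprMn mulrCA nQ.
  have h4 : a0 ^+ 2 <= 1 / 2.
    by rewrite expr2; apply: le_trans (ler_pM _ _ a0_le a0_le) _; rewrite ?(ltW a0_gt0)//; lra.
  apply: le_trans (ler_wpM2r _ h4) _; first by rewrite mulr_ge0// ltW.
  rewrite mul1r mulrC ler_pM2r ?invr_gt0// !natrM.
  rewrite [leRHS](_ : _ = m%:R * (r0%:R * q%:R)); last by ring.
  rewrite ler_wpM2l//; apply: le_trans q1 _; rewrite ler_peMl// ler1n.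
  exact: r0_gt0.
have arate : a0 / (2 * k) * rate <= a / k.
  apply: (@le_trans _ _ (a0 / (2 * k) * (2 * Q `^ (- beta)))).
    by apply: ler_wpM2l mrate; rewrite divr_ge0 ?(ltW a0_gt0)// mulr_ge0// ltW.
  by rewrite /a le_eqVlt; apply/orP; left; apply/eqP; field; rewrite gt_eqF.
move: a a_gt0 a_le aL na arate => a a_gt0 a_le aL na arate.
apply: le_ereal_inf_tmp => _ [t [t_gt0 ht] <-]; rewrite lee_fin.
rewrite leNgt; apply/negP => tlt.
have : ((1 - (1 / 2) ^+ r0)%:E <= (n%:R `^ (- gamma))%:E :> \bar R)%E.
  apply: le_trans ht; apply: le_ereal_inf_tmp => _ [fh efh <-].
  apply: (@le_trans _ _ (1 - (1 / 2) ^+ (r0 * q * m))%:E).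
    rewrite lee_fin lerD2l lerN2 ler_wiXn2l//; first lra.
    by rewrite -mulnA leq_pmulr// muln_gt0 q_gt0.
  apply: (@cube (r0 * q)%N m (r0 * q * m)%N n K a beta L t) => //.
  - by rewrite muln_gt0 r0_gt0.
  - have : (m <= q)%N by rewrite -(ler_nat R) (le_trans mQ).
    move=> /leq_trans; apply; rewrite mulnA leq_pmull// muln_gt0.
    exact: r0_gt0.
  - by rewrite a_gt0.
  - by apply: le_trans arate; exact: ltW.
rewrite lee_fin => h.
have : n%:R `^ (- gamma) <= 2 `^ (- gamma) :> R.
  rewrite !powRN lef_pV2 ?posrE ?powR_gt0//; last by rewrite ltr0n.
  by apply: powR_le; rewrite ?(ltW g0)// ler_nat.
move: h hr0; move: (n%:R `^ _) (2 `^ _) ((1 / 2) ^+ r0) => u v w; lra.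
Qed.

End lower.

(** * Uniform concentration of frequencies *)

Section concentration.
Variable R : realType.
Implicit Types (f g : R * R -> R).

Lemma iid_prob_le1 f n (A : set (n.-tuple (R * R))) :
  measurable_fun setT f -> (forall z, 0 <= f z) ->
  (\int[@leb2 R]_z (f z)%:E = 1)%E -> (iid_prob f A <= 1)%E.
Proof.
move=> mf f0 f1; elim: n A => [|n IH] A /=.
  by rewrite diracE; case: (_ \in _); rewrite lee_fin.
rewrite -f1; apply: ge0_le_integralT => z _.
  by rewrite mule_ge0 ?lee_fin ?iid_prob_ge0.
by rewrite -[leRHS]mule1; apply: lee_wpmul2l; rewrite ?lee_fin.
Qed.

(** Since exp(-x) >= 1 - x, the left side is at most 1 / (1 - x). *)
Lemma expR_le_quad (x : R) : x <= 1 / 2 -> expR x <= 1 + x + 2 * x ^+ 2.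
Proof.
move=> hx; have h := expR_ge1Dx (- x).
have e0 : 0 < expR x := expR_gt0 _.
have : (1 - x) * expR x <= 1.
  have : (1 - x) * expR x <= expR (- x) * expR x by rewrite ler_pM2r.
  by rewrite -expRD addNr expR0.
move=> h1; have x1 : 0 < 1 - x by lra.
rewrite -(ler_pM2l x1); apply: le_trans h1 _.
rewrite -subr_ge0 (_ : _ - _ = x ^+ 2 * (1 - 2 * x)); last by ring.
by rewrite mulr_ge0 ?sqr_ge0//; lra.
Qed.

(** Hoeffding's bound with a worse constant, from a quadratic bound of exp. *)
Lemma mgf_le f g (l : R) :
  measurable_fun setT f -> measurable_fun setT g -> (forall z, 0 <= f z) ->
  (\int[@leb2 R]_z (f z)%:E = 1)%E -> (forall z, `|g z| <= 1) ->
  (\int[@leb2 R]_z (f z * g z)%:E = 0)%E -> `|l| <= 1 / 2 ->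
  (\int[@leb2 R]_z (f z * expR (l * g z))%:E <= (expR (2 * l ^+ 2))%:E)%E.
Proof.
move=> mf mg f0 f1 g1 fg0 l2.
have intf : (@leb2 R).-integrable setT (EFin \o f).
  apply/integrableP; split; first exact/measurable_EFinP.
  by under eq_integral do rewrite gee0_abs ?lee_fin//; rewrite f1 ltry.
have mfg : measurable_fun setT (fun z => f z * g z) by exact: measurable_funM.
have intfg : (@leb2 R).-integrable setT (EFin \o (fun z => f z * g z)).
  apply: le_integrable intf => //; first exact/measurable_EFinP.
  move=> z _; rewrite lee_fin normrM (ger0_norm (f0 z)) ler_piMr//.
apply: (@le_trans _ _ (\int[@leb2 R]_z ((1 + 2 * l ^+ 2)%:E * (f z)%:E + l%:E * (f z * g z)%:E))%E).
  apply: ge0_le_integralT => z _; first by rewrite lee_fin mulr_ge0// expR_ge0.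
  have lg : `|l * g z| <= 1 / 2.
    by rewrite normrM -[leRHS]mulr1; apply: ler_pM.
  have gz2 : (g z) ^+ 2 <= 1 by rewrite -real_normK ?num_real// expr_le1.
  have : expR (l * g z) <= 1 + l * g z + 2 * l ^+ 2.
    apply: le_trans (expR_le_quad _) _; first by move: lg; rewrite ler_norml; case/andP.
    by rewrite lerD2l// exprMn ler_wpM2l// ler_piMr// sqr_ge0.
  move=> h; rewrite -!EFinM -EFinD lee_fin; apply: le_trans (ler_wpM2l (f0 z) h) _.
  by rewrite le_eqVlt; apply/orP; left; apply/eqP; ring.
rewrite integralD//; [|exact: integrableZl|exact: integrableZl].
rewrite !integralZl// f1 fg0 mule1 mule0 adde0 lee_fin.
exact: expR_ge1Dx.
Qed.

(** The union bound runs over the index and the sign of the deviation; the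
    exponential parameter is eta / 4. *)
Lemma concentration (J : finType) f (A : J -> set (R * R)) (pA : J -> R) (eta : R)
    n (Bad : set (seq (R * R))) :
  measurable_fun setT f -> (forall z, 0 <= f z) ->
  (\int[@leb2 R]_z (f z)%:E = 1)%E -> (forall j, measurable (A j)) ->
  (forall j, \int[@leb2 R]_z (f z * \1_(A j) z)%:E = (pA j)%:E)%E ->
  0 <= eta <= 1 -> (0 < n)%N ->
  (forall s, size s = n -> Bad s ->
     exists j, eta < `|(\sum_(z <- s) \1_(A j) z) / n%:R - pA j|) ->
  (iid_prob f [set s : n.-tuple (R * R) | Bad s] <=
    (2 * #|J|%:R * expR (- (n%:R * eta ^+ 2 / 8)))%:E)%E.
Proof.
move=> mf f0 f1 mA hpA heta n0 hBad.
have nR : 0 < n%:R :> R by rewrite ltr0n.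
have intf : (@leb2 R).-integrable setT (EFin \o f).
  apply/integrableP; split; first exact/measurable_EFinP.
  by under eq_integral do rewrite gee0_abs ?lee_fin//; rewrite f1 ltry.
have m1 j : measurable_fun setT (\1_(A j) : R * R -> R) by exact: measurable_indic.
have pA01 j : 0 <= pA j <= 1.
  rewrite -!lee_fin -hpA; apply/andP; split.
    by apply: integral_ge0 => z _; rewrite lee_fin mulr_ge0// indicE ler0n.
  rewrite -f1; apply: ge0_le_integralT => z _.
    by rewrite lee_fin mulr_ge0// indicE ler0n.
  by rewrite lee_fin ler_piMr// indicE lern1 leq_b1.
pose sg (b : bool) : R := (-1) ^+ b.
pose g (j : J * bool) z : R := sg j.2 * (\1_(A j.1) z - pA j.1).
pose l := eta / 4.
have sg1 b x : `|sg b * x| = `|x| by rewrite normrM normrX normrN1 expr1n mul1r.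
have mg j : measurable_fun setT (g j).
  by apply: measurable_cmul; apply: measurable_funB.
have g1 j z : `|g j z| <= 1.
  rewrite sg1; have := pA01 j.1; rewrite indicE; case: (z \in _) => h; rewrite ler_norml /=; lra.
have mfg j : measurable_fun setT (fun z => f z * \1_(A j) z) by exact: measurable_funM.
have fg0 j : (\int[@leb2 R]_z (f z * g j z)%:E = 0)%E.
  transitivity (\int[@leb2 R]_z ((sg j.2)%:E * (f z * \1_(A j.1) z)%:E + (- (sg j.2 * pA j.1))%:E * (f z)%:E))%E.
    by apply: eq_integral => z _; rewrite -!EFinM -EFinD /g; congr EFin; ring.
  have ifA : (@leb2 R).-integrable setT (fun z => (f z * \1_(A j.1) z)%:E).
    apply: le_integrable intf => //; first by apply/measurable_EFinP; exact: mfg.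
    move=> z _; rewrite lee_fin normrM (ger0_norm (f0 z)) ler_piMr//.
    by rewrite indicE normr_nat lern1 leq_b1.
  rewrite integralD//; [|exact: integrableZl|exact: integrableZl].
  rewrite !integralZl// f1 hpA mule1 -EFinM -EFinD.
  by rewrite subrr.
have l2 : `|l| <= 1 / 2 by rewrite ler_norml /l; lra.
have key := @iid_prob_le_sum R (J * bool)%type f (fun j z => expR (l * g j z))
  (fun=> expR (2 * l ^+ 2)) n 0 0 (fun=> expR (- (l * (n%:R * eta)))) Bad mf f0 f1.
have : (iid_prob f [set s : (n + 0).-tuple (R * R) | Bad s] <=
    (0 + \sum_(j : J * bool) expR (- (l * (n%:R * eta))) * expR (2 * l ^+ 2) ^+ n)%:E)%E.
  apply: key => //.
  - move=> j; apply: (@measurableT_comp _ _ _ _ _ _ (@expR R)); first exact: measurable_expR.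
    exact: measurable_cmul.
  - by move=> j; apply: mgf_le.
  move=> s sn _; rewrite add0r /= diracE.
  case: (boolP (_ \in _)) => [|_]; last first.
    by rewrite lee_fin sumr_ge0// => j _; rewrite mulr_ge0 ?expR_ge0 ?prodr_ge0// => z _; rewrite expR_ge0.
  rewrite inE /= cats0 => /(hBad s sn)[j hj].
  have [b hb] : exists b, n%:R * eta <= \sum_(z <- s) g (j, b) z.
    have gE b : \sum_(z <- s) g (j, b) z = sg b * (\sum_(z <- s) \1_(A j) z - n%:R * pA j).
      rewrite -mulr_sumr sumrB big_const_seq count_predT sn iter_addr_0.
      by rewrite mulr_natl.
    have SE : \sum_(z <- s) \1_(A j) z - n%:R * pA j =
        n%:R * ((\sum_(z <- s) \1_(A j) z) / n%:R - pA j).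
      by rewrite mulrBr mulrCA mulfV ?mulr1// gt_eqF.
    exists ((\sum_(z <- s) \1_(A j) z) / n%:R - pA j < 0); rewrite gE SE /sg mulrCA ler_pM2l//.
    apply: le_trans (ltW hj) _; case: ltrP => h; rewrite ?mulN1r ?mul1r//.
    by rewrite ltr0_norm.
    by rewrite ger0_norm.
  rewrite (bigD1 (j, b))//= lee_fin; apply: (@le_trans _ _ (expR (- (l * (n%:R * eta))) * \prod_(z <- s) expR (l * g (j, b) z))).
    rewrite -expR_sum -expRD -mulr_sumr -[leLHS](@expR0 R) ler_expR addrC -mulrBr.
    by rewrite mulr_ge0 ?subr_ge0// /l; lra.
  rewrite lerDl sumr_ge0// => i _; rewrite mulr_ge0 ?expR_ge0 ?prodr_ge0// => z _; rewrite expR_ge0//.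
rewrite addn0 add0r sumr_const card_prod card_bool => /le_trans; apply.
rewrite lee_fin -[leLHS]mulr_natr natrM mulrC (mulrC #|J|%:R) ler_wpM2l ?mulr_ge0//.
rewrite -expRM_natl -expRD ler_expR /l.
by rewrite le_eqVlt; apply/orP; left; apply/eqP; field.
Qed.

End concentration.

(** * Step functions on a box, and regularity of the densities *)

Section steps.
Variable R : realType.
Local Notation box := ((R * R) * (R * R))%type.
Implicit Types (q : box) (z : R * R).

Definition grid (a b : R) (p i : nat) : R := a + (b - a) * (i%:R / p%:R).
Definition cell (a b : R) (p i : nat) (x : R) : bool :=
  (grid a b p i <= x) && (x < grid a b p i.+1).

Definition proper q : bool := (q.1.1 < q.1.2) && (q.2.1 < q.2.2).
Definition in_box q z : bool := (q.1.1 <= z.1 <= q.1.2) && (q.2.1 <= z.2 <= q.2.2).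
Definition area q : R := (q.1.2 - q.1.1) * (q.2.2 - q.2.1).

(** The grid has p + 1 points per side; the last cell in each direction meets
    the box only in its boundary, and is kept so that the closed box is covered. *)
Definition step (p : nat) (h : 'I_p.+1 -> 'I_p.+1 -> R) q z : R :=
  \sum_i \sum_i' h i i' *
    (cell q.1.1 q.1.2 p i z.1 && cell q.2.1 q.2.2 p i' z.2)%:R.

(** A matrix of cell values for a density, times the area of the box.  Scaling
    by the area makes the matrix of a density bounded, however small its
    support is. *)
Definition hist (p : nat) (h : 'I_p.+1 -> 'I_p.+1 -> R) q z : R :=
  if proper q && in_box q z then step h q z / area q else 0.

Lemma area_gt0 q : proper q -> 0 < area q.
Proof. by move=> /andP[h1 h2]; rewrite mulr_gt0// subr_gt0. Qed.

Lemma cell_index (a b x : R) (p : nat) : a < b -> (0 < p)%N -> a <= x <= b ->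
  exists i : 'I_p.+1, [/\ forall i' : 'I_p.+1, cell a b p i' x = (i' == i),
    a <= grid a b p i <= b & `|x - grid a b p i| <= (b - a) / p%:R].
Proof.
move=> ab p0 /andP[ax xb].
have ba : 0 < b - a by rewrite subr_gt0.
have pR : 0 < p%:R :> R by rewrite ltr0n.
pose t := (x - a) / (b - a) * p%:R.
have t0 : 0 <= t by rewrite mulr_ge0 ?divr_ge0// ?subr_ge0// ltW.
have tp : t <= p%:R.
  by rewrite ler_piMl ?(ltW pR)// ler_pdivrMr// mul1r lerB.
have gE (j : nat) : grid a b p j = a + (b - a) / p%:R * j%:R.
  by rewrite /grid; congr (_ + _); rewrite -mulrA (mulrC p%:R^-1).
have bp : 0 < (b - a) / p%:R by rewrite divr_gt0.
have xE : x = a + (b - a) / p%:R * t.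
  by rewrite /t; field; rewrite !gt_eqF.
have le_grid (j : nat) : (grid a b p j <= x) = (j%:R <= t).
  by rewrite gE [X in _ <= X]xE lerD2l ler_pM2l.
have lt_grid (j : nat) : (x < grid a b p j) = (t < j%:R).
  by rewrite gE [X in X < _]xE ltrD2l ltr_pM2l.
have /andP[h1 h2] := truncn_itv t0.
have ip : (Num.truncn t < p.+1)%N by rewrite ltnS -(ler_nat R) (le_trans h1).
exists (Ordinal ip); split => /=.
- move=> i'; rewrite /cell le_grid lt_grid -truncn_eq// eq_sym.
  by apply/eqP/eqP => [e|->//]; apply: val_inj.
- rewrite -(ler_pM2l bp) in h1; rewrite gE lerDl mulr_ge0 ?(ltW bp)//=.
  by apply: le_trans xb; rewrite [leRHS]xE lerD2l.
- rewrite gE [X in `|X - _|]xE opprD addrACA subrr add0r -mulrBr normrM gtr0_norm//.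
  rewrite ger_pMr// ger0_norm ?subr_ge0// lerBlDl ltW//.
  by rewrite (lt_le_trans h2)// -natr1.
Qed.

Lemma step_at (p : nat) q z : proper q -> (0 < p)%N -> in_box q z ->
  exists i i' : 'I_p.+1,
  [/\ forall h : 'I_p.+1 -> 'I_p.+1 -> R, step h q z = h i i',
      in_box q (grid q.1.1 q.1.2 p i, grid q.2.1 q.2.2 p i'),
      `|z.1 - grid q.1.1 q.1.2 p i| <= (q.1.2 - q.1.1) / p%:R &
      `|z.2 - grid q.2.1 q.2.2 p i'| <= (q.2.2 - q.2.1) / p%:R].
Proof.
move=> /andP[h1 h2] p0 /andP[z1 z2].
have [i [ci gi di]] := cell_index h1 p0 z1; have [i' [ci' gi' di']] := cell_index h2 p0 z2.
exists i, i'; split => //; last by rewrite /in_box /= gi gi'.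
move=> h; rewrite /step (bigD1 i)//= (bigD1 i')//= ci ci' !eqxx mulr1.
rewrite big1 ?addr0 => [|j /negPf ji]; last by rewrite ci' ji andbF mulr0.
rewrite big1 ?addr0// => j /negPf ji; rewrite big1// => j' _.
by rewrite ci ji mulr0.
Qed.

Lemma measurable_natb d (T : measurableType d) (P : T -> bool) :
  measurable_fun setT P -> measurable_fun setT (fun x => (P x)%:R : R).
Proof.
move=> mP; rewrite (_ : (fun x => _) = (fun x => if P x then 1 else 0)).
  exact: measurable_fun_ifT.
by apply/funext => x; case: (P x).
Qed.

Section joint.
Context d (T : measurableType d).
Variables (a b x : T -> R).
Hypotheses (ma : measurable_fun setT a) (mb : measurable_fun setT b)
  (mx : measurable_fun setT x).

Lemma measurable_grid p i : measurable_fun setT (fun t => grid (a t) (b t) p i).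
Proof.
apply: measurable_funD => //; apply: measurable_funM => //.
exact: measurable_funB.
Qed.

Lemma measurable_cell p i : measurable_fun setT (fun t => cell (a t) (b t) p i (x t)).
Proof.
apply: measurable_and; first by apply: measurable_fun_ler => //; exact: measurable_grid.
by apply: measurable_fun_ltr => //; exact: measurable_grid.
Qed.
End joint.

Section joint2.
Context d (T : measurableType d).
Variables (q : T -> box) (z : T -> R * R).
Hypotheses (mq : measurable_fun setT q) (mz : measurable_fun setT z).

Let mz1 : measurable_fun setT (fun t => (z t).1).
Proof. exact: (measurableT_comp measurable_fst mz). Qed.
Let mz2 : measurable_fun setT (fun t => (z t).2).
Proof. exact: (measurableT_comp measurable_snd mz). Qed.
Let mq1 : measurable_fun setT (fun t => (q t).1).
Proof. exact: (measurableT_comp measurable_fst mq). Qed.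
Let mq2 : measurable_fun setT (fun t => (q t).2).
Proof. exact: (measurableT_comp measurable_snd mq). Qed.
Let mq11 : measurable_fun setT (fun t => (q t).1.1).
Proof. exact: (measurableT_comp measurable_fst mq1). Qed.
Let mq12 : measurable_fun setT (fun t => (q t).1.2).
Proof. exact: (measurableT_comp measurable_snd mq1). Qed.
Let mq21 : measurable_fun setT (fun t => (q t).2.1).
Proof. exact: (measurableT_comp measurable_fst mq2). Qed.
Let mq22 : measurable_fun setT (fun t => (q t).2.2).
Proof. exact: (measurableT_comp measurable_snd mq2). Qed.

Lemma measurable_step p (h : 'I_p.+1 -> 'I_p.+1 -> R) :
  measurable_fun setT (fun t => step h (q t) (z t)).
Proof.
apply: measurable_sum => i; apply: measurable_sum => i'; apply: measurable_cmul.
by apply: measurable_natb; apply: measurable_and; exact: measurable_cell.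
Qed.

(** Joint measurability in the box and the point, as the box is computed from
    the sample. *)
Lemma measurable_hist p (h : 'I_p.+1 -> 'I_p.+1 -> R) :
  measurable_fun setT (fun t => hist h (q t) (z t)).
Proof.
have -> : (fun t => hist h (q t) (z t)) = (fun t =>
    if proper (q t) && in_box (q t) (z t)
    then step h (q t) (z t) * area (q t) `^ (-1) else 0).
  apply/funext => t; rewrite /hist; case: ifP => // /andP[/area_gt0 /ltW a0 _].
  by rewrite powR_inv1.
apply: measurable_fun_ifT => //.
  apply: measurable_and; first by apply: measurable_and; exact: measurable_fun_ltr.
  by apply: measurable_and; apply: measurable_and; exact: measurable_fun_ler.
apply: measurable_funM; first exact: measurable_step.
apply: (@measurableT_comp _ _ _ _ _ _ (fun x : R => x `^ (-1))).
  exact: measurable_powR.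
by apply: measurable_funM; exact: measurable_funB.
Qed.

End joint2.

Definition box_set q : set (R * R) :=
  `[q.1.1, q.1.2]%classic `*` `[q.2.1, q.2.2]%classic.

Lemma box_setP q z : box_set q z <-> in_box q z.
Proof.
rewrite /box_set /in_box /= !in_itv /=; split => [[-> ->//]|/andP[-> ->]//].
Qed.

Lemma measurable_box q : measurable (box_set q).
Proof. exact: measurableX. Qed.

Lemma leb2_box q : proper q -> @leb2 R (box_set q) = (area q)%:E.
Proof. by move=> /andP[h1 h2]; rewrite leb2_rect ?ltW. Qed.

Lemma leb2_improper q : ~~ proper q -> @leb2 R (box_set q) = 0%E.
Proof.
move=> h; transitivity (@lebesgue_measure R `[q.1.1, q.1.2]%classic *
  @lebesgue_measure R `[q.2.1, q.2.2]%classic)%E; first exact: product_measure1E.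
rewrite !lebesgue_measure_itv /= !lte_fin; move: h; rewrite negb_and.
by case: ltP => //= _; [case: ltP => //= _|]; rewrite ?mule0 ?mul0e.
Qed.

Lemma integral_bounded_box f q (M : R) : 0 <= M -> (forall z, 0 <= f z) ->
  (forall z, in_box q z -> f z <= M) -> (forall z, ~~ in_box q z -> f z = 0) ->
  (\int[@leb2 R]_z (f z)%:E <= M%:E * @leb2 R (box_set q))%E.
Proof.
move=> M0 f0 fM fb.
apply: (@le_trans _ _ (\int[@leb2 R]_z (M%:E * (\1_(box_set q) z)%:E))%E).
  apply: ge0_le_integralT => z _; first by rewrite lee_fin.
  rewrite -EFinM lee_fin indicE; have [h|h] := boolP (in_box q z).
    by rewrite mem_set ?mulr1 ?fM//; exact/box_setP.
  by rewrite fb// mulr_ge0.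
rewrite ge0_integralZl_EFin//; last first.
  by apply/measurable_EFinP; apply: measurable_indic; exact: measurable_box.
by rewrite integral_leb2_indic//; exact: measurable_box.
Qed.

Lemma holder_power_small (L beta e : R) : 0 <= L -> 0 < beta -> 0 < e ->
  exists N : nat, forall n : nat, (N <= n)%N -> L * (n.+1%:R^-1) `^ beta <= e.
Proof.
move=> L0 b0 e0; have L1 : 0 < L + 1 by lra.
pose x : R := (e / (L + 1)) `^ (1 / beta).
have x0 : 0 < x by rewrite powR_gt0// divr_gt0.
exists (Num.truncn x^-1) => n Nn.
have h : n.+1%:R^-1 <= x.
  rewrite -[leRHS]invrK lef_pV2 ?posrE ?invr_gt0 ?ltr0n//.
  by apply: le_trans (ltW (truncnS_gt _)) _; rewrite ler_nat.
apply: (@le_trans _ _ ((L + 1) * x `^ beta)).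
  apply: ler_pM; rewrite ?powR_ge0//; first lra.
  by apply: ge0_ler_powR; rewrite ?nnegrE ?invr_ge0// ltW.
rewrite /x -powRrM mul1r mulVf ?gt_eqF// powRr1; last by rewrite divr_ge0// ltW.
by rewrite mulrC divfK// gt_eqF.
Qed.

Section density.
Variables (beta L : R) (f : R * R -> R).
Hypotheses (b0 : 0 < beta) (L0 : 0 <= L) (fH : holder_density beta L f).

Lemma holder_ge0 z : 0 <= f z. Proof. by case: fH. Qed.

Lemma holder_support : exists q, [/\ forall z, (f z != 0) = in_box q z &
  0 <= q.1.1 /\ q.1.2 <= 1 /\ 0 <= q.2.1 /\ q.2.2 <= 1].
Proof.
case: fH => _ _ [r1 [R1 [r2 [R2 [h1 h2 h3 h4 fs]]]]] _.
exists ((r1, R1), (r2, R2)); split; last by move: h1 h2 h3 h4; rewrite !in_itv /= => /andP[-> _] /andP[_ ->] /andP[-> _] /andP[_ ->].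
move=> z; apply/idP/idP => [h|/box_setP h].
  by move: (h : supp f z); rewrite fs => hz; exact/box_setP.
by have : supp f z by rewrite fs.
Qed.

Lemma box_square q z : 0 <= q.1.1 /\ q.1.2 <= 1 /\ 0 <= q.2.1 /\ q.2.2 <= 1 ->
  in_box q z -> @unit_square R z.
Proof. by move=> hq /andP[z1 z2]; apply/unit_squareE; split; lra. Qed.

Lemma holder_in q z z' : (forall z, (f z != 0) = in_box q z) ->
  in_box q z -> in_box q z' -> `|f z - f z'| <= L * `|z - z'| `^ beta.
Proof. by move=> fq zq z'q; case: fH => _ _ _; apply; rewrite /supp /= fq. Qed.

Lemma norm_le_pair z z' (r : R) : `|z.1 - z'.1| <= r -> `|z.2 - z'.2| <= r -> `|z - z'| <= r.
Proof. by move=> h1 h2; rewrite [leLHS]prod_normE ge_max h1 h2. Qed.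

Lemma unit_square_norm z z' : @unit_square R z -> @unit_square R z' -> `|z - z'| <= 1.
Proof.
move=> /unit_squareE[h1 h2] /unit_squareE[h3 h4].
by apply: norm_le_pair; rewrite ler_norml; lra.
Qed.

Lemma powR_le1 (x : R) : 0 <= x <= 1 -> x `^ beta <= 1.
Proof.
move=> /andP[x0 x1]; have E1 : 1 `^ beta = 1 :> R by rewrite powR1.
by rewrite -[leRHS]E1; apply: ge0_ler_powR; rewrite ?nnegrE// ltW.
Qed.

Lemma holder_bounded : exists2 M : R, 0 <= M & forall z, f z <= M.
Proof.
have [q [fq hq]] := holder_support.
have [[z0 hz0]|h] := pselect (exists z, in_box q z); last first.
  exists 0 => // z; have [->//|] := eqVneq (f z) 0; rewrite fq => zq.
  by exfalso; apply: h; exists z.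
exists (f z0 + L); first by rewrite addr_ge0// holder_ge0.
move=> z; have [->|] := eqVneq (f z) 0; first by rewrite addr_ge0// holder_ge0.
rewrite fq => zq; rewrite -lerBlDl; apply: le_trans (ler_norm _) _.
apply: le_trans (holder_in fq zq hz0) _; rewrite ler_piMr//; apply: powR_le1.
by rewrite normr_ge0 unit_square_norm//; apply: (box_square hq).
Qed.

Lemma holder_out_square z : ~ @unit_square R z -> f z = 0.
Proof.
have [q [fq hq]] := holder_support => h; apply/eqP; apply: contraPT h.
by rewrite fq => /(box_square hq) h1 h2; exact: h2.
Qed.

Lemma holder_integral : (\int[@leb2 R]_z (f z)%:E = 1)%E.
Proof.
rewrite -integral_unit_square; first by case: fH.
by move=> z /holder_out_square ->.
Qed.

(** A degenerate support has measure zero and cannot carry a bounded density of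
    mass 1. *)
Lemma holder_proper q : (forall z, (f z != 0) = in_box q z) -> proper q.
Proof.
move=> fq; apply/negPn/negP => h; have [M M0 hM] := holder_bounded.
have fb z : ~~ in_box q z -> f z = 0 by rewrite -fq negbK => /eqP.
have := integral_bounded_box M0 holder_ge0 (fun z _ => hM z) fb.
by rewrite holder_integral leb2_improper// mule0 lee_fin; lra.
Qed.

(** The Holder bound makes f a limit of step functions on its support. *)
Lemma measurable_holder : measurable_fun setT f.
Proof.
have [q [fq hq]] := holder_support.
have pq := holder_proper fq.
pose g (n : nat) z : R := if in_box q z then
  step (p := n.+1) (fun i i' => f (grid q.1.1 q.1.2 n.+1 i, grid q.2.1 q.2.2 n.+1 i')) q z else 0.
apply: (@measurable_fun_cvg _ _ _ _ g).
  move=> n; apply: measurable_fun_ifT => //; last exact: measurable_step.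
  have m1 : measurable_fun setT (fun z : R * R => z.1) by exact: measurable_fst.
  have m2 : measurable_fun setT (fun z : R * R => z.2) by exact: measurable_snd.
  by apply: measurable_and; apply: measurable_and; exact: measurable_fun_ler.
move=> z _; apply/cvgrPdist_le => e e0.
have [N hN] := holder_power_small L0 b0 e0.
near=> n; rewrite /g; have [zq|zq] := boolP (in_box q z); last first.
  by rewrite (_ : f z = 0) ?subrr ?normr0 ?ltW//; apply/eqP; rewrite -[_ == _]negbK fq.
have [i [i' [-> gq d1 d2]]] := step_at pq (ltn0Sn n) zq.
apply: le_trans (holder_in fq zq gq) _.
apply: le_trans (hN n _); last by near: n; exists N.
rewrite ler_wpM2l//; apply: ge0_ler_powR; rewrite ?nnegrE ?invr_ge0 ?(ltW b0)//.
have n0 : 0 < n.+1%:R^-1 :> R by rewrite invr_gt0.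
by apply: norm_le_pair => /=; [apply: le_trans d1 _|apply: le_trans d2 _];
  rewrite ler_piMl ?(ltW n0)//; lra.
Unshelve. all: end_near.
Qed.

End density.
End steps.

(** * The bounding box of a sample *)

Lemma last_success (P : nat -> Prop) (N : nat) : P 0%N -> ~ P N ->
  exists i, P i /\ ~ P i.+1.
Proof.
elim: N => [//|N IH] P0 PN; have [h|h] := pselect (P N); first by exists N.
exact: IH.
Qed.

Section quantile.
Variable R : realType.
Local Notation box := ((R * R) * (R * R))%type.
Implicit Types (u f : R * R -> R) (z : R * R) (s : seq (R * R)).

(** The mass F of the points below t is continuous in t, as a strip has small
    area and f is bounded; so on a fine enough mesh the first value of F above e
    is at most 2 e. *)
Lemma quantile f u (M e : R) :
  measurable_fun setT f -> (forall z, 0 <= f z) -> 0 <= M -> (forall z, f z <= M) ->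
  (forall z, ~ @unit_square R z -> f z = 0) ->
  (\int[@leb2 R]_z (f z)%:E = 1)%E ->
  measurable_fun setT u -> (forall z, @unit_square R z -> -1 <= u z <= 1) ->
  (forall a b, a <= b -> exists2 q : box, (@leb2 R (box_set q) <= (b - a)%:E)%E &
     forall z, @unit_square R z -> a <= u z < b -> in_box q z) ->
  0 < e < 1 ->
  exists t : R, (\int[@leb2 R]_z (f z * (u z < t)%R%:R)%:E <= (2 * e)%:E)%E /\
            (\int[@leb2 R]_z (f z * (t <= u z)%R%:R)%:E <= (1 - e)%:E)%E.
Proof.
move=> mf f0 M0 fM fsq f1 mu u1 ustrip he.
pose F t := (\int[@leb2 R]_z (f z * (u z < t)%R%:R)%:E)%E.
have mb (P : R * R -> bool) : measurable_fun setT P ->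
    measurable_fun setT (fun z => (f z * (P z)%:R)%:E).
  by move=> mP; apply/measurable_EFinP; apply: measurable_funM => //; exact: measurable_natb.
have mlt t : measurable_fun setT (fun z => u z < t) by exact: measurable_fun_ltr.
have mge t : measurable_fun setT (fun z => t <= u z) by exact: measurable_fun_ler.
have nn (b : bool) z : (0%R <= (f z * b%:R)%:E)%E.
  by rewrite lee_fin mulr_ge0// ler0n.
have addI (P Q : R * R -> bool) : measurable_fun setT P -> measurable_fun setT Q ->
    (\int[@leb2 R]_z (f z * (P z)%:R)%:E + \int[@leb2 R]_z (f z * (Q z)%:R)%:E =
     \int[@leb2 R]_z ((f z * (P z)%:R)%:E + (f z * (Q z)%:R)%:E))%E.
  move=> mP mQ; apply/esym; apply: (@ge0_integralD _ _ R (@leb2 R) setT) => //.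
  - exact: mb.
  - exact: mb.
have FG t : (F t + \int[@leb2 R]_z (f z * (t <= u z)%R%:R)%:E = 1)%E.
  rewrite (addI (fun z => u z < t) (fun z => t <= u z))//.
  rewrite -f1; apply: eq_integral => z _; rewrite -EFinD.
  by case: leP => _; rewrite /= ?mulr0 ?mulr1 ?addr0 ?add0r.
have Flip t t' : t <= t' -> (F t' <= F t + (M * (t' - t))%:E)%E.
  move=> tt'; have [q hq qin] := ustrip _ _ tt'.
  apply: (@le_trans _ _ (F t + \int[@leb2 R]_z (f z * (t <= u z < t')%R%:R)%:E)%E).
    rewrite (addI (fun z => u z < t) (fun z => t <= u z < t'))//; last exact: measurable_and.
    apply: ge0_le_integralT => z _; first exact: nn.
    rewrite -EFinD lee_fin -mulrDr ler_wpM2l//.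
    by case: ltP => h; case: ltP => h' //=; rewrite ?add0r ?addr0 ?lerDl ?ler0n.
  rewrite leeD2l// EFinM; apply: le_trans (_ : (M%:E * @leb2 R (box_set q) <= _)%E); last first.
    by apply: lee_wpmul2l; rewrite ?lee_fin.
  apply: integral_bounded_box => //.
  - by move=> z; rewrite mulr_ge0// ler0n.
  - by move=> z _; apply: le_trans (fM z); rewrite ler_piMr// lern1 leq_b1.
  move=> z zq; have [sz|/fsq ->] := pselect (@unit_square R z); last by rewrite mul0r.
  have [h|_] := boolP (t <= u z < t'); last by rewrite mulr0.
  by rewrite (qin z sz h) in zq.
have [N hN] : exists N : nat, 3 * M / e < N.+1%:R.
  by exists (Num.truncn (3 * M / e)); exact: truncnS_gt.
case/andP: he => e0 e1.
(* The coordinates lie in [-1, 1], so N + 1 steps of size h from -1 end at 2,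
   strictly beyond all the mass. *)
pose h : R := 3 / N.+1%:R.
have h0 : 0 <= h by rewrite divr_ge0.
have hM : M * h <= e.
  rewrite /h mulrCA mulrA ler_pdivrMr ?ltr0n//.
  by move: hN; rewrite ltr_pdivrMr// => /ltW; rewrite (mulrC e).
pose g (i : nat) : R := -1 + h * i%:R.
have [i [Fi Fi1]] : exists i : nat, (F (g i) <= e%:E)%E /\ ~ (F (g i.+1) <= e%:E)%E.
  apply: (@last_success (fun i => F (g i) <= e%:E)%E N.+1).
    rewrite /g mulr0 addr0 /F integral0_eq ?lee_fin ?(ltW e0)// => z _.
    have [sz|/fsq ->] := pselect (@unit_square R z); last by rewrite mul0r.
    by have /andP[z1 _] := u1 z sz; rewrite ltNge z1 mulr0.
  rewrite /g /h divfK ?pnatr_eq0// => h1.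
  have : (1 <= e%:E)%E.
    apply: le_trans h1; rewrite -f1; apply: ge0_le_integralT => z _; first by rewrite lee_fin.
    have [sz|/fsq ->] := pselect (@unit_square R z); last by rewrite mul0r.
    have /andP[_ z1] := u1 z sz; rewrite (_ : u z < -1 + 3) ?mulr1//.
    by apply: le_lt_trans z1 _; lra.
  by rewrite lee_fin leNgt e1.
exists (g i.+1); split.
  apply: le_trans (Flip (g i) _ _) _.
    by rewrite lerD2l ler_wpM2l// ler_nat.
  rewrite (_ : 2 * e = e + e); last by ring.
  rewrite EFinD leeD// lee_fin; apply: le_trans hM; rewrite ler_wpM2l//.
  by rewrite opprD addrACA subrr add0r -mulrBr -natrB// subSnn mulr1.
have := FG (g i.+1).
move/negP: Fi1; rewrite -ltNge.
have : (0 <= F (g i.+1))%E by apply: integral_ge0 => z _; exact: nn.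
have : (0 <= \int[@leb2 R]_z (f z * (g i.+1 <= u z)%R%:R)%:E)%E.
  by apply: integral_ge0 => z _; exact: nn.
case: (F _) => [x| |]//; case: (integral _ _ _) => [y| |]//.
rewrite !lee_fin lte_fin => y0 x0 ex [xy]; lra.
Qed.

(** The two coordinates and their opposites, so that the four sides of a box can
    be treated alike, all by minima. *)
Definition coord (k : bool * bool) z : R :=
  let x := if k.2 then z.2 else z.1 in if k.1 then - x else x.

(** The default 1 is the largest value of a coordinate on the unit square. *)
Definition lo u s : R := foldr (fun z m => Num.min (u z) m) 1 s.

Definition sample_box s : box :=
  ((lo (coord (false, false)) s, - lo (coord (true, false)) s),
   (lo (coord (false, true)) s, - lo (coord (true, true)) s)).

Lemma lo_le u s z : z \in s -> lo u s <= u z.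
Proof.
elim: s => [//|w s IH]; rewrite inE => /orP[/eqP->|/IH h] /=.
  by rewrite ge_min lexx.
by rewrite ge_min h orbT.
Qed.

Lemma lo_ge u s (c : R) : c <= 1 -> (forall z, z \in s -> c <= u z) -> c <= lo u s.
Proof.
move=> c1; elim: s => [//|w s IH] h /=; rewrite le_min h ?mem_head//=.
by apply: IH => z zs; apply: h; rewrite inE zs orbT.
Qed.

Lemma in_sample_box s z : ~~ in_box (sample_box s) z ->
  exists k, coord k z < lo (coord k) s.
Proof.
rewrite /in_box /= !negb_and -!ltNge => /orP[]/orP[] h.
- by exists (false, false).
- by exists (true, false); rewrite /coord /= ltrNl.
- by exists (false, true).
- by exists (true, true); rewrite /coord /= ltrNl.
Qed.

Lemma measurable_coord k : measurable_fun setT (coord k).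
Proof.
have m1 : measurable_fun setT (fun z : R * R => z.1) by exact: measurable_fst.
have m2 : measurable_fun setT (fun z : R * R => z.2) by exact: measurable_snd.
by case: k => [[] []]; rewrite /coord /=; [apply: measurable_funN|apply: measurable_funN| |].
Qed.

Lemma measurable_lo u n m : measurable_fun setT u -> (m <= n)%N ->
  measurable_fun setT (fun s : n.-tuple (R * R) => lo u (take m s)).
Proof.
move=> mu mn.
rewrite (_ : (fun s : n.-tuple (R * R) => lo u (take m s)) = fun s : n.-tuple (R * R) =>
    lo u [seq nth (0, 0) s i | i <- iota 0 m]); last first.
  by apply/funext => s; rewrite map_nth_iota0// size_tuple.
have : all (fun i => i < n)%N (iota 0 m).
  by apply/allP => i; rewrite mem_iota add0n => /andP[_ im]; exact: leq_trans im mn.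
elim: (iota 0 m) => [//|i l IH] /= /andP[il ln].
apply: measurable_minr; last exact: IH.
rewrite (_ : (fun x => _) = u \o (fun s : n.-tuple (R * R) => tnth s (Ordinal il))).
  by apply: measurableT_comp => //; exact: measurable_tnth.
by apply/funext => s /=; rewrite (tnth_nth (0, 0)).
Qed.

Lemma measurable_sample_box n m : (m <= n)%N ->
  measurable_fun setT (fun s : n.-tuple (R * R) => sample_box (take m s)).
Proof.
move=> mn; have ml k := measurable_lo (measurable_coord k) mn.
apply: measurable_fun_pair; apply: measurable_fun_pair => //;
  exact: measurable_funN.
Qed.

Lemma coord_bound k z : @unit_square R z -> -1 <= coord k z <= 1.
Proof.
by move=> /unit_squareE[h1 h2]; case: k => [[] []]; rewrite /coord /=; lra.
Qed.

Lemma coord_strip k (a b : R) : a <= b ->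
  exists2 q : box, (@leb2 R (box_set q) <= (b - a)%:E)%E &
     forall z, @unit_square R z -> a <= coord k z < b -> in_box q z.
Proof.
move=> ab; case: k => [[] []].
- exists ((0, 1), (- b, - a)).
    by rewrite leb2_rect/= ?lerN2// lee_fin; lra.
  by move=> z /unit_squareE[h1 h2]; rewrite /coord /in_box /= h1 /=; lra.
- exists ((- b, - a), (0, 1)).
    by rewrite leb2_rect/= ?lerN2// lee_fin; lra.
  by move=> z /unit_squareE[h1 h2]; rewrite /coord /in_box /= h2 /=; lra.
- exists ((0, 1), (a, b)).
    by rewrite leb2_rect/= ?lerN2// lee_fin; lra.
  by move=> z /unit_squareE[h1 h2]; rewrite /coord /in_box /= h1 /=; lra.
- exists ((a, b), (0, 1)).
    by rewrite leb2_rect/= ?lerN2// lee_fin; lra.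
  by move=> z /unit_squareE[h1 h2]; rewrite /coord /in_box /= h2 /=; lra.
Qed.

Section cover.
Variables (beta L : R) (f : R * R -> R) (e : R).
Hypotheses (b0 : 0 < beta) (L0 : 0 <= L) (fH : holder_density beta L f).
Hypothesis he : 0 < e < 1 / 8.

Let mf := measurable_holder b0 L0 fH.
Let f0 := holder_ge0 fH.
Let f1 := holder_integral fH.

Lemma quantiles : exists t : bool * bool -> R, forall k,
  (\int[@leb2 R]_z (f z * (coord k z < t k)%R%:R)%:E <= (2 * e)%:E)%E /\
  (\int[@leb2 R]_z (f z * (t k <= coord k z)%R%:R)%:E <= (1 - e)%:E)%E.
Proof.
have [M M0 fM] := holder_bounded b0 L0 fH.
have h k : exists t : R,
  (\int[@leb2 R]_z (f z * (coord k z < t)%R%:R)%:E <= (2 * e)%:E)%E /\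
  (\int[@leb2 R]_z (f z * (t <= coord k z)%R%:R)%:E <= (1 - e)%:E)%E.
  apply: (@quantile _ _ M) => //.
  - exact: (holder_out_square fH).
  - exact: measurable_coord.
  - exact: coord_bound.
  - exact: coord_strip.
  - by case/andP: he => -> /= /lt_trans; apply; lra.
exists (fun k => projT1 (cid (h k))) => k; exact: (projT2 (cid (h k))).
Qed.

(** If the sample reaches below each of the four quantiles, a point outside its
    bounding box lies below one of them, and these have mass at most 2 e each. *)
Lemma sample_box_mass (t : bool * bool -> R) s :
  (forall k, \int[@leb2 R]_z (f z * (coord k z < t k)%R%:R)%:E <= (2 * e)%:E)%E ->
  (forall k, exists2 z, z \in s & coord k z < t k) ->
  (\int[@leb2 R]_z (f z * (~~ in_box (sample_box s) z)%:R)%:E <= (8 * e)%:E)%E.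
Proof.
move=> ht hs.
have mk k : measurable_fun setT (fun z => (f z * (coord k z < t k)%R%:R)%:E).
  apply/measurable_EFinP; apply: measurable_funM => //; apply: measurable_natb.
  by apply: measurable_fun_ltr => //; exact: measurable_coord.
apply: (@le_trans _ _ (\int[@leb2 R]_z \sum_k (f z * (coord k z < t k)%R%:R)%:E)%E).
  apply: ge0_le_integralT => z _; first by rewrite lee_fin mulr_ge0 ?ler0n.
  have [h|/in_sample_box[k hk]] := boolP (in_box (sample_box s) z).
    by rewrite /= mulr0; apply: sume_ge0 => k _; rewrite lee_fin mulr_ge0 ?ler0n.
  rewrite (bigD1 k)//= (_ : coord k z < t k); last first.
    have [w ws wt] := hs k; apply: lt_trans hk _; exact: le_lt_trans (lo_le _ ws) wt.
  rewrite leeDl//; apply: sume_ge0 => j _; rewrite lee_fin mulr_ge0 ?ler0n//.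
rewrite ge0_integral_sum//; last first.
  by move=> k z _; rewrite lee_fin mulr_ge0 ?ler0n.
apply: le_trans (lee_sum _ (fun k _ => ht k)) _.
rewrite sumEFin lee_fin sumr_const card_prod card_bool.
by rewrite (_ : (2 * 2)%N = 4%N)//; lra.
Qed.

Lemma sample_box_sub q s : (forall z, (f z != 0) = in_box q z) ->
  0 <= q.1.1 /\ q.1.2 <= 1 /\ 0 <= q.2.1 /\ q.2.2 <= 1 ->
  all (fun z => f z != 0) s ->
  forall z, in_box (sample_box s) z -> in_box q z.
Proof.
move=> fq hq /allP fs z.
have pq := holder_proper b0 L0 fH fq.
have sq w : w \in s -> in_box q w by move=> /fs; rewrite fq.
have h1 : q.1.1 <= lo (coord (false, false)) s.
  apply: lo_ge; first by move: pq hq => /andP[]; lra.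
  by move=> w /sq /andP[/andP[]].
have h2 : - q.1.2 <= lo (coord (true, false)) s.
  apply: lo_ge; first by move: pq hq => /andP[]; lra.
  by move=> w /sq /andP[/andP[_ h] _]; rewrite /coord /= lerN2.
have h3 : q.2.1 <= lo (coord (false, true)) s.
  apply: lo_ge; first by move: pq hq => /andP[]; lra.
  by move=> w /sq /andP[_ /andP[]].
have h4 : - q.2.2 <= lo (coord (true, true)) s.
  apply: lo_ge; first by move: pq hq => /andP[]; lra.
  by move=> w /sq /andP[_ /andP[_ h]]; rewrite /coord /= lerN2.
by rewrite /in_box /=; lra.
Qed.

Lemma sample_box_proper s :
  (\int[@leb2 R]_z (f z * (~~ in_box (sample_box s) z)%:R)%:E <= (8 * e)%:E)%E ->
  proper (sample_box s).
Proof.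
move=> hm; apply/negPn/negP => h.
have [M M0 fM] := holder_bounded b0 L0 fH.
have mbox : measurable_fun setT (in_box (sample_box s)).
  have m1 : measurable_fun setT (fun z : R * R => z.1) by exact: measurable_fst.
  have m2 : measurable_fun setT (fun z : R * R => z.2) by exact: measurable_snd.
  by apply: measurable_and; apply: measurable_and; exact: measurable_fun_ler.
have mb (P : R * R -> bool) : measurable_fun setT P ->
    measurable_fun setT (fun z => (f z * (P z)%:R)%:E).
  by move=> mP; apply/measurable_EFinP; apply: measurable_funM => //; exact: measurable_natb.
have hin : (\int[@leb2 R]_z (f z * (in_box (sample_box s) z)%:R)%:E <= 0)%E.
  apply: le_trans (integral_bounded_box (q := sample_box s) M0 _ _ _) _.
  - by move=> z; rewrite mulr_ge0 ?ler0n.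
  - by move=> z _; apply: le_trans (fM z); rewrite ler_piMr// lern1 leq_b1.
  - by move=> z /negPf ->; rewrite mulr0.
  - by rewrite leb2_improper// mule0.
have : (1 <= (8 * e)%:E)%E.
  apply: le_trans hm; rewrite -[leRHS]add0e; apply: le_trans (leeD2r _ hin).
  rewrite -f1 -ge0_integralD//; first last.
  - by apply: mb; exact: measurable_neg.
  - by move=> z _; rewrite lee_fin mulr_ge0 ?ler0n.
  - exact: mb.
  - by move=> z _; rewrite lee_fin mulr_ge0 ?ler0n.
  apply: ge0_le_integralT => z _; first by rewrite lee_fin.
  by rewrite -EFinD -mulrDr; case: (in_box _ _); rewrite /= ?addr0 ?add0r mulr1.
by rewrite lee_fin; case/andP: he => _; lra.
Qed.

End cover.
End quantile.

(** * Selection among finitely many candidates *)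

Section bounded_measurable.
Variable R : realType.
Implicit Types (f g h : R * R -> R).

Definition bounded_mfun h :=
  measurable_fun setT h /\ exists M : R, forall z, `|h z| <= M.

Definition integral_square h : R := \int[@leb2 R]_(z in @unit_square R) h z.

Lemma bounded_mfun_integrable h : bounded_mfun h ->
  (@leb2 R).-integrable (@unit_square R) (EFin \o h).
Proof. by move=> [mh [M hM]]; apply: (bounded_integrable_square (M := M)). Qed.

Lemma bounded_mfunD g h : bounded_mfun g -> bounded_mfun h ->
  bounded_mfun (fun z => g z + h z).
Proof.
move=> [mg [M gM]] [mh [N hN]]; split; first exact: measurable_funD.
by exists (M + N) => z; apply: le_trans (ler_normD _ _) (lerD (gM z) (hN z)).
Qed.

Lemma bounded_mfunB g h : bounded_mfun g -> bounded_mfun h ->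
  bounded_mfun (fun z => g z - h z).
Proof.
move=> [mg [M gM]] [mh [N hN]]; split; first exact: measurable_funB.
by exists (M + N) => z; apply: le_trans (ler_normB _ _) (lerD (gM z) (hN z)).
Qed.

Lemma bounded_mfun_norm h : bounded_mfun h -> bounded_mfun (fun z => `|h z|).
Proof.
move=> [mh [M hM]]; split; first exact: measurableT_comp.
by exists M => z; rewrite normr_id.
Qed.

Lemma bounded_mfun_test h (P : R * R -> bool) : bounded_mfun h ->
  measurable_fun setT P -> bounded_mfun (fun z => h z * (P z)%:R).
Proof.
move=> [mh [M hM]] mP; split.
  by apply: measurable_funM => //; exact: measurable_natb.
exists M => z; apply: le_trans (hM z); rewrite normrM ler_piMr// ger0_norm ?ler0n//.
by rewrite lern1 leq_b1.
Qed.

Let msq := @measurable_unit_square R.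

Lemma integral_squareB g h : bounded_mfun g -> bounded_mfun h ->
  integral_square (fun z => g z - h z) = integral_square g - integral_square h.
Proof. by move=> bg bh; apply: RintegralB => //; exact: bounded_mfun_integrable. Qed.

Lemma integral_squareD g h : bounded_mfun g -> bounded_mfun h ->
  integral_square (fun z => g z + h z) = integral_square g + integral_square h.
Proof. by move=> bg bh; apply: RintegralD => //; exact: bounded_mfun_integrable. Qed.

Lemma le_integral_square g h : bounded_mfun g -> bounded_mfun h ->
  (forall z, g z <= h z) -> integral_square g <= integral_square h.
Proof. by move=> bg bh gh; apply: le_Rintegral => //; exact: bounded_mfun_integrable. Qed.

Lemma norm_integral_square_test g h (P : R * R -> bool) :
  bounded_mfun g -> bounded_mfun h -> measurable_fun setT P ->
  `|integral_square (fun z => g z * (P z)%:R) - integral_square (fun z => h z * (P z)%:R)|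
   <= integral_square (fun z => `|g z - h z|).
Proof.
move=> bg bh mP; rewrite -integral_squareB; try exact: bounded_mfun_test.
apply: le_trans (le_normr_Rintegral _ _) _ => //.
  by apply: bounded_mfun_integrable; apply: bounded_mfunB; exact: bounded_mfun_test.
apply: le_integral_square.
- by apply: bounded_mfun_norm; apply: bounded_mfunB; exact: bounded_mfun_test.
- by apply: bounded_mfun_norm; exact: bounded_mfunB.
move=> z; rewrite -mulrBl normrM ler_piMr// ger0_norm ?ler0n//.
by rewrite lern1 leq_b1.
Qed.

Lemma integral_square_EFin h : bounded_mfun h ->
  (\int[@leb2 R]_(z in @unit_square R) (h z)%:E)%E = (integral_square h)%:E.
Proof.
move=> bh; rewrite /integral_square /Rintegral fineK//.
by apply: integrable_fin_num => //; exact: bounded_mfun_integrable.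
Qed.

Lemma L1_dist_EFin g h : bounded_mfun g -> bounded_mfun h ->
  L1_dist g h = (integral_square (fun z => `|g z - h z|))%:E.
Proof.
move=> bg bh; rewrite -integral_square_EFin//.
by apply: bounded_mfun_norm; exact: bounded_mfunB.
Qed.

Lemma integral_square_triangle f g h :
  bounded_mfun f -> bounded_mfun g -> bounded_mfun h ->
  integral_square (fun z => `|f z - h z|) <=
  integral_square (fun z => `|f z - g z|) + integral_square (fun z => `|g z - h z|).
Proof.
move=> bf bg bh; have b1 := bounded_mfun_norm (bounded_mfunB bf bg).
have b2 := bounded_mfun_norm (bounded_mfunB bg bh).
rewrite -integral_squareD//; apply: le_integral_square.
- by apply: bounded_mfun_norm; exact: bounded_mfunB.
- exact: bounded_mfunD.
by move=> z; exact: ler_distD.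
Qed.

Section yatracos.
Variables (J : finType) (f : R * R -> R) (g : J -> R * R -> R)
  (emp : J -> J -> R) (e eta : R) (j0 : J).
Hypotheses (bf : bounded_mfun f) (bg : forall j, bounded_mfun (g j)).

Definition test (k l : J) z : bool := g l z < g k z.

Hypotheses (f_near : integral_square (fun z => `|g j0 z - f z|) <= e)
  (emp_near : forall k l,
     `|emp k l - integral_square (fun z => f z * (test k l z)%:R)| <= eta).

Definition fits (tau : R) (j : J) : Prop := forall k l,
  `|integral_square (fun z => g j z * (test k l z)%:R) - emp k l| <= tau.

Let mtest k l : measurable_fun setT (test k l).
Proof. by apply: measurable_fun_ltr; [case: (bg l)|case: (bg k)]. Qed.

Lemma yatracos_fits : fits (e + eta) j0.
Proof.
move=> k l; have := norm_integral_square_test (bg j0) bf (mtest k l).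
move=> /le_trans /(_ f_near); have := emp_near k l; rewrite !ler_norml; lra.
Qed.

(** The L_1 distance of g j and g j0 is a sum of two differences of masses, on
    the set where g j0 < g j and on the opposite one.  Both are sets on which
    the candidates have been compared with the frequencies. *)
Lemma yatracos_close j : fits (e + eta) j ->
  integral_square (fun z => `|g j z - f z|) <= 5 * e + 4 * eta.
Proof.
move=> fj; have fj0 := yatracos_fits.
have bt i k l : bounded_mfun (fun z => g i z * (test k l z)%:R) by exact: bounded_mfun_test.
apply: le_trans (integral_square_triangle (bg j) (bg j0) bf) _.
suff : integral_square (fun z => `|g j z - g j0 z|) <= 4 * (e + eta).
  by move: f_near; lra.
have -> : (fun z => `|g j z - g j0 z|) = (fun z =>
    (g j z * (test j j0 z)%:R - g j0 z * (test j j0 z)%:R) +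
    (g j0 z * (test j0 j z)%:R - g j z * (test j0 j z)%:R)).
  apply/funext => z; rewrite /test; case: (ltrgtP (g j0 z) (g j z)) => h; last rewrite h; rewrite /=; ring.
rewrite integral_squareD; try exact: bounded_mfunB.
rewrite !integral_squareB//.
have := fj j j0; have := fj j0 j; have := fj0 j j0; have := fj0 j0 j.
rewrite !ler_norml; lra.
Qed.
End yatracos.

End bounded_measurable.

Section measurable_fits.
Variable R : realType.
Context d (T : measurableType d).

Lemma measurable_integral_square (F : T -> R * R -> R) :
  (forall t z, 0 <= F t z) -> measurable_fun setT (fun p : T * (R * R) => F p.1 p.2) ->
  measurable_fun setT (fun t => integral_square (F t)).
Proof.
move=> F0 mF; rewrite /integral_square /Rintegral.
apply: (measurableT_comp (fine_measurable measurableT)).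
pose H (p : T * (R * R)) := (F p.1 p.2 * \1_(@unit_square R) p.2)%:E.
rewrite (_ : (fun t => _) = fun t => (\int[@leb2 R]_z H (t, z))%E); last first.
  apply/funext => t; rewrite integral_mkcond; apply: eq_integral => z _.
  rewrite /H /= indicE /patch; case: ifPn => _; first by rewrite mulr1.
  by rewrite mulr0.
have mH : measurable_fun setT H.
  apply/measurable_EFinP; apply: measurable_funM => //.
  exact: (measurableT_comp (measurable_indic (@measurable_unit_square R))).
have := @measurable_fun_fubini_tonelli_F _ _ _ _ R (@leb2 R) _ mH; apply.
by move=> q; rewrite lee_fin mulr_ge0// indicE ler0n.
Qed.

Lemma measurable_all (I : Type) (P : I -> T -> bool) (r : seq I) :
  (forall i, measurable_fun setT (P i)) ->
  measurable_fun setT (fun t => all (P ^~ t) r).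
Proof.
move=> mP; elim: r => [|i r IH] /=; first exact: measurable_cst.
exact: measurable_and.
Qed.

Fixpoint first_fit (J : Type) (ok : J -> bool) (G : J -> R) (r : seq J) : R :=
  if r is j :: r' then if ok j then G j else first_fit ok G r' else 0.

Lemma measurable_first_fit (J : Type) (ok : J -> T -> bool) (G : J -> T -> R) (r : seq J) :
  (forall j, measurable_fun setT (ok j)) -> (forall j, measurable_fun setT (G j)) ->
  measurable_fun setT (fun t => first_fit (ok ^~ t) (G ^~ t) r).
Proof.
move=> mok mG; elim: r => [|j r IH] /=; first exact: measurable_cst.
exact: measurable_fun_ifT.
Qed.
End measurable_fits.

(** The same candidate is selected whatever G is.  Below G is the evaluation of
    the candidates at a point, so the estimate is one candidate everywhere. *)
Lemma first_fitP (R : realType) (J : eqType) (ok : J -> bool) (r : seq J) :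
  (exists2 j, j \in r & ok j /\ forall G : J -> R, first_fit ok G r = G j) \/
  (forall j, j \in r -> ~~ ok j) /\ forall G : J -> R, first_fit ok G r = 0.
Proof.
elim: r => [|j r IH] /=; first by right.
have [oj|noj] := boolP (ok j); first by left; exists j; rewrite ?mem_head.
case: IH => [[i ir [oi hi]]|[h1 h2]]; first by left; exists i; rewrite ?inE ?ir ?orbT.
by right; split => // i; rewrite inE => /orP[/eqP->//|/h1].
Qed.

Section estimator.
Variable R : realType.
Local Notation box := ((R * R) * (R * R))%type.
Implicit Types (f : R * R -> R) (q : box) (s : seq (R * R)).

Section hist_bounds.
Variables (p : nat) (h : 'I_p.+1 -> 'I_p.+1 -> R).

Lemma hist_ge0 q z : (forall i i', 0 <= h i i') -> 0 <= hist h q z.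
Proof.
move=> h0; rewrite /hist; case: ifP => // /andP[/area_gt0/ltW a0 _].
rewrite divr_ge0//; apply: sumr_ge0 => i _; apply: sumr_ge0 => i' _.
by rewrite mulr_ge0.
Qed.

Lemma bounded_hist q : bounded_mfun (hist h q).
Proof.
split.
  apply: (measurable_hist (q := fun=> q) (z := id)); first exact: measurable_cst.
  exact: measurable_id.
exists ((\sum_i \sum_i' `|h i i'|) * `|(area q)^-1|) => z.
have S0 : 0 <= \sum_i \sum_i' `|h i i'|.
  by apply: sumr_ge0 => i _; apply: sumr_ge0 => i' _.
rewrite /hist; case: ifP => _; last by rewrite normr0 mulr_ge0.
rewrite normrM ler_wpM2r//; apply: le_trans (ler_norm_sum _ _ _) _.
apply: ler_sum => i _; apply: le_trans (ler_norm_sum _ _ _) _.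
apply: ler_sum => i' _; rewrite normrM ler_piMr// ger0_norm ?ler0n//.
by rewrite lern1 leq_b1.
Qed.
End hist_bounds.

Section scheffe.
Variables (J : finType) (p : nat) (h : J -> 'I_p.+1 -> 'I_p.+1 -> R) (n1 n2 : nat)
  (tau : R).
Hypothesis h0 : forall j i i', 0 <= h j i i'.

Definition cand s (j : J) : R * R -> R := hist (h j) (sample_box (take n1 s)).

Definition freq s (k l : J) : R :=
  (\sum_(z <- drop n1 s) (test (cand s) k l z)%:R) / n2%:R.

Definition fit s (j : J) : bool :=
  all (fun kl : J * J => `|integral_square (fun z => cand s j z *
      (test (cand s) kl.1 kl.2 z)%:R) - freq s kl.1 kl.2| <= tau) (enum {: J * J}).

(** The first n1 points fix the box on which the candidates live; the other
    points select the first candidate whose masses fit the frequencies. *)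
Definition box_estimator s z : R := first_fit (fit s) (cand s ^~ z) (enum J).

Lemma fitP s j : fit s j <-> fits (cand s) (freq s) tau j.
Proof.
split => [/allP fj k l|fj]; last by apply/allP => -[k l] _; exact: fj.
by have := fj (k, l); rewrite mem_enum; apply.
Qed.

Lemma bounded_box_estimator s : bounded_mfun (box_estimator s).
Proof.
have [[j _ [_ hj]]|[_ hj]] := first_fitP R (fit s) (enum J).
  have -> : box_estimator s = cand s j by apply/funext => z; exact: hj.
  exact: bounded_hist.
have -> : box_estimator s = cst 0 by apply/funext => z; exact: hj.
by split => //; exists 0 => z; rewrite normr0.
Qed.

Section joint.
Context d (T : measurableType d).
Variables (s : T -> (n1 + n2).-tuple (R * R)) (z : T -> R * R).
Hypotheses (ms : measurable_fun setT s) (mz : measurable_fun setT z).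

Lemma measurable_cand j : measurable_fun setT (fun t => cand (s t) j (z t)).
Proof.
apply: measurable_hist => //.
exact: (measurableT_comp (measurable_sample_box (leq_addr n2 n1)) ms).
Qed.

Lemma measurable_test k l : measurable_fun setT (fun t => test (cand (s t)) k l (z t)).
Proof. by apply: measurable_fun_ltr; exact: measurable_cand. Qed.
End joint.

Lemma measurable_freq k l :
  measurable_fun setT (fun s : (n1 + n2).-tuple (R * R) => freq s k l).
Proof.
apply: measurable_funM => //.
rewrite (_ : (fun s : (n1 + n2).-tuple (R * R) => _) = fun s : (n1 + n2).-tuple (R * R) =>
    \sum_(i < n2) (test (cand s) k l (tnth s (rshift n1 i)))%:R : R); last first.
  apply/funext => s; rewrite (big_nth (0, 0)) size_drop size_tuple addKn big_mkord.
  by apply: eq_bigr => i _; rewrite nth_drop (tnth_nth (0, 0)).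
apply: measurable_sum => i; apply: measurable_natb.
apply: (measurable_test (s := id)); first exact: measurable_id.
exact: measurable_tnth.
Qed.

Lemma measurable_fit j :
  measurable_fun setT (fun s : (n1 + n2).-tuple (R * R) => fit s j).
Proof.
apply: measurable_all => -[k l] /=; apply: measurable_fun_ler; last exact: measurable_cst.
apply: measurableT_comp => //; apply: measurable_funB; last exact: measurable_freq.
apply: (measurable_integral_square (F := fun (s : (n1 + n2).-tuple (R * R)) z =>
  cand s j z * (test (cand s) k l z)%:R)).
  by move=> s z; rewrite mulr_ge0 ?ler0n ?hist_ge0.
have ms := @measurable_fst _ _ ((n1 + n2).-tuple (R * R)) (R * R)%type.
have mz := @measurable_snd _ _ ((n1 + n2).-tuple (R * R)) (R * R)%type.
apply: measurable_funM; first exact: (measurable_cand ms mz).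
by apply: measurable_natb; exact: (measurable_test ms mz).
Qed.

Lemma box_estimator_estimators :
  @estimators R (n1 + n2) (fun s : (n1 + n2).-tuple (R * R) => box_estimator s).
Proof.
have ms := @measurable_fst _ _ ((n1 + n2).-tuple (R * R)) (R * R)%type.
have mz := @measurable_snd _ _ ((n1 + n2).-tuple (R * R)) (R * R)%type.
split; last by move=> s; apply: bounded_mfun_integrable; exact: bounded_box_estimator.
apply: (measurable_first_fit (ok := fun j (t : (n1 + n2).-tuple (R * R) * (R * R)) => fit t.1 j)
  (G := fun j (t : (n1 + n2).-tuple (R * R) * (R * R)) => cand t.1 j t.2)).
- by move=> j; exact: (measurableT_comp (measurable_fit j) ms).
- by move=> j; exact: (measurable_cand ms mz).
Qed.

End scheffe.

Section risk.
Variables (beta L : R) (f : R * R -> R) (e : R).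
Hypotheses (b0 : 0 < beta) (L0 : 0 <= L) (fH : holder_density beta L f).
Hypothesis he : 0 < e < 1 / 8.
Variables (J : finType) (p : nat) (h : J -> 'I_p.+1 -> 'I_p.+1 -> R) (n1 n2 : nat).
Hypothesis n2_gt0 : (0 < n2)%N.
Hypothesis approx : forall s, all (fun z => f z != 0) s ->
  (\int[@leb2 R]_z (f z * (~~ in_box (sample_box s) z)%:R)%:E <= (8 * e)%:E)%E ->
  exists j, integral_square (fun z => `|hist (h j) (sample_box s) z - f z|) <= 10 * e.

Lemma bounded_holder : bounded_mfun f.
Proof.
split; first exact: measurable_holder b0 L0 fH.
have [M M0 fM] := holder_bounded b0 L0 fH; exists M => z.
by rewrite ger0_norm// (holder_ge0 fH).
Qed.

(** The first term bounds the probability that the first subsample stays above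
    one of the four quantiles.  Otherwise the candidates are fixed by the first
    subsample and the frequencies in the second one concentrate.  The constants:
    an approximation error 10 e and deviations at most e give 5 (10 e) + 4 e. *)
Lemma box_estimator_risk :
  (iid_prob f [set s : (n1 + n2).-tuple (R * R) |
     (54 * e)%:E < L1_dist (box_estimator h n1 n2 (11 * e) s) f] <=
   (4 * (1 - e) ^+ n1 + 2 * (#|J| ^ 2)%:R * expR (- (n2%:R * e ^+ 2 / 8)))%:E)%E.
Proof.
have mf := measurable_holder b0 L0 fH; have f0 := holder_ge0 fH.
have f1 := holder_integral fH; have bf := bounded_holder.
have [t ht] := quantiles b0 L0 fH he.
pose q : R := 2 * (#|J| ^ 2)%:R * expR (- (n2%:R * e ^+ 2 / 8)).
have q0 : 0 <= q by rewrite mulr_ge0 ?expR_ge0.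
have -> : 4 * (1 - e) ^+ n1 + q = q + \sum_(k : bool * bool) 1 * (1 - e) ^+ n1.
  by rewrite sumr_const card_prod card_bool mul1r addrC -[in RHS]mulr_natl.
have mk k : measurable_fun setT (fun z => (t k <= coord k z)%R%:R : R).
  by apply: measurable_natb; apply: measurable_fun_ler => //; exact: measurable_coord.
apply: (@iid_prob_le_sum R _ f (fun k z => (t k <= coord k z)%R%:R) (fun=> 1 - e) n1 n2 q
  (fun=> 1) [set s | ((54 * e)%:E < L1_dist (box_estimator h n1 n2 (11 * e) s) f)%E]) => //.
- by move=> k; case: (ht k).
move=> s1 size1 fs1.
have [[k hk]|good] := pselect (exists k, forall z, z \in s1 -> t k <= coord k z).
  apply: le_trans (iid_prob_le1 _ _ _ _) _ => //.
  rewrite lee_fin -[leLHS]add0r lerD// (bigD1 k)//= big_seq.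
  rewrite big1 ?mulr1 => [|z /hk -> //]; rewrite lerDl.
  apply: sumr_ge0 => j _; rewrite mul1r; apply: prodr_ge0 => z _; exact: ler0n.
have {}good k : exists2 z, z \in s1 & coord k z < t k.
  apply: contrapT => h1; apply: good; exists k => z zs.
  by rewrite leNgt; apply/negP => h2; apply: h1; exists z.
have hm := sample_box_mass b0 L0 fH (fun k => (ht k).1) good.
have [j0 hj0] := approx fs1 hm.
pose g j := hist (h j) (sample_box s1).
have bg j : bounded_mfun (g j) by exact: bounded_hist.
have mtest k l : measurable_fun setT (test g k l).
  by apply: measurable_fun_ltr; [case: (bg l)|case: (bg k)].
pose A (kl : J * J) : set (R * R) := [set z | test g kl.1 kl.2 z].
have AE kl z : \1_(A kl) z = (test g kl.1 kl.2 z)%:R :> R.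
  rewrite indicE; congr (nat_of_bool _)%:R.
  by apply/idP/idP => [/set_mem|h1]; last exact: mem_set.
apply: (@le_trans _ _ q%:E); last first.
  rewrite lee_fin lerDl; apply: sumr_ge0 => j _; rewrite mul1r; apply: prodr_ge0 => z _; exact: ler0n.
have -> : q = 2 * #|{: J * J}|%:R * expR (- (n2%:R * e ^+ 2 / 8)).
  by rewrite /q card_prod mulnn.
apply: (@concentration R _ f A
  (fun kl => integral_square (fun z => f z * (test g kl.1 kl.2 z)%:R)) e n2
  (fun s2 => ((54 * e)%:E < L1_dist (box_estimator h n1 n2 (11 * e) (s1 ++ s2)) f)%E)) => //.
- move=> kl; rewrite -[A kl]setTI; exact: (mtest kl.1 kl.2).
- move=> kl; rewrite -integral_square_EFin; last exact: bounded_mfun_test.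
  rewrite integral_unit_square; last first.
    by move=> z /(holder_out_square fH) ->; rewrite mul0r.
  by under eq_integral do rewrite AE.
- by move: he; lra.
move=> s2 size2 bad; apply: contrapT => hno.
have emp_near k l : `|(\sum_(z <- s2) (test g k l z)%:R) / n2%:R -
    integral_square (fun z => f z * (test g k l z)%:R)| <= e.
  rewrite leNgt; apply/negP => hlt; apply: hno; exists (k, l) => /=.
  by under eq_bigr do rewrite AE.
have candE : cand h n1 (s1 ++ s2) = g by rewrite /cand take_cat size1 ltnn subnn take0 cats0.
have freqE k l : freq h n1 n2 (s1 ++ s2) k l = (\sum_(z <- s2) (test g k l z)%:R) / n2%:R.
  by rewrite /freq candE drop_cat size1 ltnn subnn drop0.
have tauE : 11 * e = 10 * e + e by ring.
have fitE j : fit h n1 n2 (11 * e) (s1 ++ s2) j <->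
    fits g (fun k l => (\sum_(z <- s2) (test g k l z)%:R) / n2%:R) (10 * e + e) j.
  rewrite (fitP h n1 n2) candE -tauE; split => hf k l; have := hf k l; by rewrite freqE.
have [[j _ [/fitE fj hj]]|[hnone _]] :=
    first_fitP R (fit h n1 n2 (11 * e) (s1 ++ s2)) (enum J); last first.
  have := hnone j0; rewrite mem_enum => /(_ isT) /negP; apply; apply/fitE.
  exact: yatracos_fits bf bg hj0 emp_near.
have estE : box_estimator h n1 n2 (11 * e) (s1 ++ s2) = g j.
  by apply/funext => z; rewrite /box_estimator hj candE.
move: bad; rewrite /= estE L1_dist_EFin// lte_fin ltNge => /negP; apply.
apply: le_trans (yatracos_close bf bg hj0 emp_near fj) _.
by rewrite le_eqVlt; apply/orP; left; apply/eqP; ring.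
Qed.
End risk.

End estimator.

(** * Nets of low-rank and of smooth matrices *)

Section factorization.
Variable F : realFieldType.

(** M is the identity except in column k, so its row k has a single nonzero
    entry, with cofactor 1. *)
Lemma det_replaced_column r (M : 'M[F]_r) (k : 'I_r) :
  (forall i j, j != k -> M i j = (i == j)%:R) -> \det M = M k k.
Proof.
move=> hM; rewrite (expand_det_row _ k) (bigD1 k)//= big1 ?addr0; last first.
  by move=> j jk; rewrite hM// eq_sym (negPf jk) mul0r.
rewrite /cofactor (_ : row' k (col' k M) = 1%:M); last first.
  apply/matrixP => i j; rewrite !mxE hM; last by rewrite eq_sym neq_lift.
  by rewrite (inj_eq lift_inj).
by rewrite det1 mulr1 -signr_odd oddD addbb expr0 mulr1.
Qed.

(** Choose r columns with the largest determinant in absolute value.  By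
    Cramer's rule the coordinates of any other column in this basis are ratios
    of such determinants, hence at most 1. *)
Lemma max_volume_factor r n (W : 'M[F]_(r, n)) : row_free W ->
  exists (g : 'I_r -> 'I_n) (T : 'M[F]_(r, n)),
    W = colsub g W *m T /\ forall k j, `|T k j| <= 1.
Proof.
move=> fW; have fW' : row_full W^T by rewrite /row_full mxrank_tr.
(* Some choice of columns is invertible, so the largest volume is positive. *)
pose g0 : {ffun 'I_r -> 'I_n} := [ffun i => fullrankfun fW' i].
pose vol (g : {ffun 'I_r -> 'I_n}) : F := `|\det (colsub g W)|.
have vol0 : 0 < vol g0.
  rewrite /vol normr_gt0 -unitfE -unitmxE -unitmx_tr.
  rewrite (_ : (colsub g0 W)^T = rowsub (fullrankfun fW') W^T); last first.
    by apply/matrixP => i j; rewrite !mxE ffunE.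
  by have := fullrowsub_unit fW'.
pose g := [arg max_(g > g0) vol g]%O.
have gmax g' : vol g' <= vol g.
  by rewrite /g; case: arg_maxP => // i _; apply.
have uS : colsub g W \in unitmx.
  by rewrite unitmxE unitfE -normr_gt0 (lt_le_trans vol0).
pose T := invmx (colsub g W) *m W.
have WE : W = colsub g W *m T by rewrite mulKVmx.
exists g, T; split => // k j.
have Tg i l : T i (g l) = (i == l)%:R.
  have : colsub g T = 1%:M.
    rewrite -(mulVmx uS) /T; apply/matrixP => a b; rewrite !mxE.
    by apply: eq_bigr => c _; rewrite !mxE.
  by move/matrixP => /(_ i l); rewrite !mxE.
pose g' : {ffun 'I_r -> 'I_n} := [ffun l => if l == k then j else g l].
have := gmax g'; rewrite /vol.
have -> : colsub g' W = colsub g W *m colsub g' T.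
  apply/matrixP => a b; rewrite [in LHS]WE !mxE; apply: eq_bigr => c _.
  by congr (_ * _); rewrite [RHS]mxE.
rewrite det_mulmx normrM ger_pMr; last exact: lt_le_trans vol0 _.
rewrite (@det_replaced_column _ _ k); first by rewrite mxE ffunE eqxx.
by move=> a b /negPf bk; rewrite mxE ffunE bk.
Qed.

(** The first factor consists of columns of A itself, so it inherits every bound
    on the entries of A; it is padded with zeros up to the inner dimension K. *)
Lemma bounded_factorization K m n (A : 'M[F]_(m, n)) (U : 'M[F]_(m, K)) (V : 'M[F]_(K, n)) :
  A = U *m V -> exists (C : 'I_K -> 'I_m -> F) (T : 'I_K -> 'I_n -> F),
  [/\ forall i j, A i j = \sum_k C k i * T k j,
      forall k, C k = (fun=> 0) \/ exists j, forall i, C k i = A i j &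
      forall k j, `|T k j| <= 1].
Proof.
move=> AE; pose r := \rank A.
have rK : (r <= K)%N.
  by rewrite /r AE (leq_trans (mxrankM_maxl _ _))// rank_leq_col.
have [g [T [WE T1]]] := max_volume_factor (row_base_free A).
have AE2 : A = colsub g A *m T.
  rewrite -{1}(mulmx_base A) {1}WE mulmxA; congr (_ *m _).
  apply/matrixP => i k; rewrite [RHS]mxE.
  have /matrixP/(_ i (g k)) <- := mulmx_base A; rewrite !mxE.
  by apply: eq_bigr => c _; rewrite !mxE.
pose ext (d : nat) (H : 'I_r -> 'I_d -> F) (k : nat) (i : 'I_d) : F :=
  if @insub _ (fun x => x < r)%N 'I_r k is Some k' then H k' i else 0.
exists (fun k i => ext m (fun k' i => A i (g k')) k i), (fun k j => ext n T k j).
split.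
- move=> i j; rewrite {1}AE2 mxE.
  pose G (k : nat) : F := ext m (fun k' i => A i (g k')) k i * ext n T k j.
  transitivity (\sum_(k < r) G k).
    apply: eq_bigr => k _; rewrite /G /ext valK.
    by rewrite !mxE.
  rewrite (big_ord_widen K G rK) [RHS](bigID (fun k : 'I_K => (k < r)%N))/=.
  rewrite [X in _ = _ + X]big1 ?addr0// => k nk.
  by rewrite /ext insubN// mul0r.
- move=> k; rewrite /ext; case: insubP => [k' _ _|_]; last by left.
  by right; exists (g k').
- by move=> k j; rewrite /ext; case: insubP => [k' _ _|_] //; rewrite normr0 ler01.
Qed.
End factorization.

Section nets.
Variables (R : realType) (p : nat).
Implicit Types (G : 'I_p.+1 -> 'I_p.+1 -> R) (e B : R).

Definition nonneg_net (J : finType) (h : J -> 'I_p.+1 -> 'I_p.+1 -> R) e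
    (P : ('I_p.+1 -> 'I_p.+1 -> R) -> Prop) :=
  (forall j i i', 0 <= h j i i') /\
  forall G, P G -> exists j, forall i i', `|h j i i' - G i i'| <= e.

(** Clipping makes the elements of a net nonnegative at no cost. *)
Lemma clip_close (x y : R) : 0 <= y -> `|Num.max 0 x - y| <= `|x - y|.
Proof.
move=> y0; case: (leP 0 x) => // x0.
by rewrite sub0r normrN (ger0_norm y0) ltr0_norm ?subr_lt0 ?(lt_le_trans x0)//; lra.
Qed.

Lemma truncn_mesh (x B d : R) : 0 < d -> 0 <= x <= B ->
  (Num.truncn (x / d) <= Num.truncn (B / d))%N /\
  0 <= x - (Num.truncn (x / d))%:R * d <= d.
Proof.
move=> d0 /andP[x0 xB]; split; first by apply: le_truncn; rewrite ler_pM2r ?invr_gt0.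
have /andP[h1 h2] := truncn_itv (divr_ge0 x0 (ltW d0)).
move: h1 h2; rewrite ler_pdivlMr// ltr_pdivrMr// -natr1 mulrDl mul1r.
by move=> h1 /ltW h2; rewrite subr_ge0 h1 lerBlDl.
Qed.

(** Rounding both factors of [bounded_factorization] to multiples of d changes
    each of the K products by at most (1 + B) d. *)
Lemma low_rank_net (K : nat) B e : (0 < K)%N -> 0 <= B -> 0 < e ->
  let d := e / (K%:R * (1 + B)) in
  let D := (Num.truncn ((B + 2) / d)).+1 in
  exists (J : finType) (h : J -> 'I_p.+1 -> 'I_p.+1 -> R),
  (#|J| = D ^ (2 * K * p.+1))%N /\
  nonneg_net h e (fun G => (forall i i', 0 <= G i i' <= B) /\
    exists u v : 'I_K -> 'I_p.+1 -> R, forall i i', G i i' = \sum_k u k i * v k i').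
Proof.
move=> K0 B0 e0 d D; have KR : 0 < K%:R :> R by rewrite ltr0n.
have d0 : 0 < d by rewrite divr_gt0// mulr_gt0// ltr_wpDr.
pose I := ('I_K * 'I_p.+1)%type.
pose J := ({ffun I -> 'I_D} * {ffun I -> 'I_D})%type.
pose C (j : J) k i : R := (j.1 (k, i))%:R * d.
pose T (j : J) k i : R := (j.2 (k, i))%:R * d - 1.
exists J, (fun j i i' => Num.max 0 (\sum_k C j k i * T j k i')).
split.
  by rewrite card_prod !card_ffun !card_ord card_prod !card_ord -expnD -mulnA mul2n addnn.
split; first by move=> j i i'; rewrite le_max lexx.
move=> G [hG [u [v Guv]]].
pose A := \matrix_(i, i') G i i'.
have AE : A = (\matrix_(i, k) u k i) *m (\matrix_(k, i') v k i').
  by apply/matrixP => i i'; rewrite !mxE Guv; apply: eq_bigr => k _; rewrite !mxE.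
have [C0 [T0 [GE hC hT]]] := bounded_factorization AE.
have C0B k i : 0 <= C0 k i <= B.
  have [->|[j ->]] := hC k; first by rewrite lexx.
  by rewrite mxE.
have T0B k i : 0 <= T0 k i + 1 <= B + 2.
  by have := hT k i; rewrite ler_norml; lra.
have C0B' k i : 0 <= C0 k i <= B + 2 by have := C0B k i; lra.
pose j : J := ([ffun ki => inord (Num.truncn (C0 ki.1 ki.2 / d))],
               [ffun ki => inord (Num.truncn ((T0 ki.1 ki.2 + 1) / d))]).
exists j => i i'; apply: le_trans (clip_close _ _) _; first by case/andP: (hG i i').
have -> : G i i' = A i i' by rewrite mxE.
rewrite GE -sumrB; apply: le_trans (ler_norm_sum _ _ _) _.
have hCj k : 0 <= C0 k i - C j k i <= d.
  rewrite /C ffunE inordK /=; first exact: (truncn_mesh d0 (C0B' k i)).2.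
  by rewrite ltnS; exact: (truncn_mesh d0 (C0B' k i)).1.
have hTj k : 0 <= T0 k i' - T j k i' <= d.
  have -> : T0 k i' - T j k i' = (T0 k i' + 1) - (j.2 (k, i'))%:R * d by rewrite /T; ring.
  rewrite ffunE inordK /=; first exact: (truncn_mesh d0 (T0B k i')).2.
  by rewrite ltnS; exact: (truncn_mesh d0 (T0B k i')).1.
have Cj0 k : 0 <= C j k i by rewrite mulr_ge0 ?(ltW d0).
apply: (@le_trans _ _ (\sum_(k < K) (d * (1 + B)))); last first.
  rewrite sumr_const card_ord -mulr_natr /d le_eqVlt; apply/orP; left; apply/eqP.
  by rewrite -mulrA (mulrC (1 + B)) divfK// gt_eqF// mulr_gt0// ltr_wpDr.
apply: ler_sum => k _.
have -> : C j k i * T j k i' - C0 k i * T0 k i' =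
   - ((C0 k i - C j k i) * T0 k i' + C j k i * (T0 k i' - T j k i')) by ring.
rewrite normrN; apply: le_trans (ler_normD _ _) _; rewrite (mulrDr d) mulr1; apply: lerD.
  rewrite normrM -[leRHS]mulr1 ler_pM//; have := hCj k; case/andP => h1 h2.
  by rewrite ger0_norm.
rewrite normrM (mulrC d) ler_pM//.
- by rewrite ger0_norm//; have := hCj k; have := C0B k i; lra.
- by rewrite ger0_norm; have := hTj k; lra.
Qed.

(** Rounded down to multiples of e, neighbouring entries differ by -1, 0 or 1
    steps.  So the rounded matrix is encoded by one entry, the increments along
    the row 0 and then the increments along each column. *)
Lemma smooth_net B e : 0 <= B -> 0 < e ->
  exists (J : finType) (h : J -> 'I_p.+1 -> 'I_p.+1 -> R),
  (#|J| = (Num.truncn (B / e)).+1 * 3 ^ (p.+1 * p.+1))%N /\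
  nonneg_net h e (fun G => [/\ forall i i', 0 <= G i i' <= B,
     forall i (k : nat), (k < p)%N -> `|G i (inord k) - G i (inord k.+1)| <= e &
     forall i' (k : nat), (k < p)%N -> `|G (inord k) i' - G (inord k.+1) i'| <= e]).
Proof.
move=> B0 e0; pose D := (Num.truncn (B / e)).+1.
pose J := ('I_D * {ffun 'I_p.+1 * 'I_p.+1 -> 'I_3})%type.
pose c (j : J) (k l : nat) : R := (j.2 (inord k, inord l))%:R - 1.
pose v (j : J) (i i' : 'I_p.+1) : R :=
  ((j.1)%:R + \sum_(0 <= k < i') c j 0%N k.+1 + \sum_(0 <= k < i) c j k.+1 i') * e.
exists J, (fun j i i' => Num.max 0 (v j i i')); split.
  by rewrite card_prod card_ffun !card_ord card_prod !card_ord.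
split; first by move=> j i i'; rewrite le_max lexx.
move=> G [GB G2 G1].
pose Q (k l : nat) : nat := Num.truncn (G (inord k) (inord l) / e).
have Q0 k l : ((Q k l)%:R <= G (inord k) (inord l) / e < (Q k l).+1%:R).
  by apply: truncn_itv; rewrite divr_ge0 ?(ltW e0)//; case/andP: (GB (inord k) (inord l)).
have near_Q (k l k' l' : nat) : `|G (inord k) (inord l) - G (inord k') (inord l')| <= e ->
    ((Q k' l').+1 - Q k l < 3)%N /\
    ((Q k' l').+1 - Q k l)%:R - 1 = (Q k' l')%:R - (Q k l)%:R :> R.
  move=> h; have /andP[a1 a2] := Q0 k l; have /andP[b1 b2] := Q0 k' l'.
  have h' : `|G (inord k) (inord l) / e - G (inord k') (inord l') / e| <= 1.
    by rewrite -mulrBl normrM (gtr0_norm (_ : 0 < e^-1)) ?invr_gt0// ler_pdivrMr// mul1r.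
  move: h'; rewrite ler_norml => /andP[h1 h2].
  have l1 : (Q k l < (Q k' l').+2)%N by rewrite -(ltr_nat R) -(natr1 (Q k' l').+1); lra.
  have l2 : (Q k' l' < (Q k l).+2)%N by rewrite -(ltr_nat R) -(natr1 (Q k l).+1); lra.
  split; first by lia.
  by rewrite natrB ?ltnS// -natr1; ring.
pose j : J := (inord (Q 0%N 0%N),
  [ffun kl : 'I_p.+1 * 'I_p.+1 => if kl.1 == ord0 then inord ((Q 0%N kl.2).+1 - Q 0%N kl.2.-1)
     else inord ((Q kl.1 kl.2).+1 - Q kl.1.-1 kl.2)]).
have inordE (i : 'I_p.+1) : inord i = i by exact: inord_val.
have cE1 (k : nat) : (k < p)%N -> c j 0%N k.+1 = (Q 0%N k.+1)%:R - (Q 0%N k)%:R.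
  move=> kp; have [h1 h2] := near_Q 0%N k 0%N k.+1 (G2 _ _ kp).
  rewrite /c ffunE /= (_ : inord 0 == ord0 = true); last by apply/eqP/val_inj; rewrite /= inordK.
  by rewrite !(inordK (_ : k.+1 < p.+1)%N)//= inordK.
have cE2 (k : nat) (i' : 'I_p.+1) : (k < p)%N -> c j k.+1 i' = (Q k.+1 i')%:R - (Q k i')%:R.
  move=> kp; have := near_Q k i' k.+1 i'; rewrite inordE => /(_ (G1 _ _ kp))[h1 h2].
  rewrite /c ffunE /= ifF; last first.
    by apply/negP => /eqP/(congr1 val); rewrite /= inordK.
  by rewrite inordE !(inordK (_ : k.+1 < p.+1)%N)//= inordK.
exists j => i i'; apply: le_trans (clip_close _ _) _; first by case/andP: (GB i i').
have -> : v j i i' = (Q i i')%:R * e.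
  rewrite /v; congr (_ * e).
  have -> : \sum_(0 <= k < i') c j 0%N k.+1 = (Q 0%N i')%:R - (Q 0%N 0%N)%:R.
    rewrite -(telescope_sumr (fun k => (Q 0%N k)%:R))// !big_nat.
    apply: eq_bigr => k /andP[_ ki]; apply: cE1; exact: leq_trans ki (leq_ord i').
  have -> : \sum_(0 <= k < i) c j k.+1 i' = (Q i i')%:R - (Q 0%N i')%:R.
    rewrite -(telescope_sumr (fun k => (Q k i')%:R))// !big_nat.
    apply: eq_bigr => k /andP[_ ki]; apply: cE2; exact: leq_trans ki (leq_ord i).
  rewrite /= inordK; first by ring.
  rewrite ltnS; apply: le_truncn; rewrite ler_pM2r ?invr_gt0//.
  by case/andP: (GB (inord 0) (inord 0)).
have [_] := truncn_mesh e0 (GB i i').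
have -> : Num.truncn (G i i' / e) = Q i i' by rewrite /Q !inordE.
by rewrite ler_norml; lra.
Qed.

End nets.

(** * Approximation of a density on the bounding box *)

Section sampled.
Variable R : realType.

Lemma grid_itv (a b : R) p i : a <= b -> (0 < p)%N -> (i <= p)%N ->
  a <= grid a b p i <= b.
Proof.
move=> ab p0 ip; have pR : 0 < p%:R :> R by rewrite ltr0n.
have h : 0 <= (i%:R / p%:R : R) <= 1.
  by rewrite divr_ge0//= ler_pdivrMr// mul1r ler_nat.
have : 0 <= (b - a) * (i%:R / p%:R) <= b - a.
  by case/andP: h => h1 h2; rewrite mulr_ge0 ?subr_ge0//= ler_piMr ?subr_ge0.
by rewrite /grid; lra.
Qed.

Lemma gridS (a b : R) p i : grid a b p i.+1 - grid a b p i = (b - a) / p%:R.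
Proof. by rewrite /grid -natr1; ring. Qed.

Variables (beta L : R) (f : R * R -> R) (e : R) (p : nat) (s : seq (R * R)).
Hypotheses (b0 : 0 < beta) (L0 : 0 <= L) (fH : holder_density beta L f).
Hypothesis he : 0 < e < 1 / 8.
Hypotheses (p0 : (0 < p)%N) (hp : L * p%:R^-1 `^ beta <= e).
Hypothesis fs : all (fun z => f z != 0) s.
Hypothesis hm : (\int[@leb2 R]_z (f z * (~~ in_box (sample_box s) z)%:R)%:E <= (8 * e)%:E)%E.

Local Notation q := (sample_box s).
Let pq : proper q := sample_box_proper b0 L0 fH he hm.
Let a0 : 0 < area q := area_gt0 pq.

Lemma sampled_support z : in_box q z -> @unit_square R z /\ f z != 0.
Proof.
have [q' [fq hq]] := holder_support fH => zq.
have zq' := sample_box_sub b0 L0 fH fq hq fs zq.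
by rewrite fq; split => //; exact: box_square hq zq'.
Qed.

Lemma sampled_sides : q.1.2 - q.1.1 <= 1 /\ q.2.2 - q.2.1 <= 1.
Proof.
move: (pq) => /andP[h1 h2].
have [|/unit_squareE[x0 y0] _] := @sampled_support (q.1.1, q.2.1).
  by rewrite /in_box /= !lexx !ltW.
have [|/unit_squareE[x1 y1] _] := @sampled_support (q.1.2, q.2.2).
  by rewrite /in_box /= !lexx !ltW.
by move: x0 y0 x1 y1 => /=; lra.
Qed.

Lemma sampled_area_le1 : area q <= 1.
Proof.
have [s1 s2] := sampled_sides; move: (pq) => /andP[h1 h2].
by rewrite /area; apply: mulr_ile1; rewrite // subr_ge0 ltW.
Qed.

Lemma sampled_holder z z' (r : R) : in_box q z -> in_box q z' -> 0 <= r ->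
  `|z - z'| <= r -> `|f z - f z'| <= L * r `^ beta.
Proof.
move=> /sampled_support[_ fz] /sampled_support[_ fz'] r0 h.
case: fH => _ _ _ /(_ z z' fz fz') /le_trans; apply.
by rewrite ler_wpM2l//; apply: ge0_ler_powR; rewrite ?nnegrE// ltW.
Qed.

Lemma sampled_near z z' : in_box q z -> in_box q z' -> `|z - z'| <= p%:R^-1 ->
  `|area q * f z - area q * f z'| <= e.
Proof.
move=> zq zq' h; rewrite -mulrBr normrM gtr0_norm//; apply: le_trans hp.
apply: le_trans (_ : `|f z - f z'| <= _).
  by rewrite ler_piMl// sampled_area_le1.
by apply: sampled_holder; rewrite // invr_ge0.
Qed.

(** The values of f on the grid, with the normalization of [hist]. *)
Definition sampled (i i' : 'I_p.+1) : R :=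
  area q * f (grid q.1.1 q.1.2 p i, grid q.2.1 q.2.2 p i').

Lemma grid_in (i i' : nat) : (i <= p)%N -> (i' <= p)%N ->
  in_box q (grid q.1.1 q.1.2 p i, grid q.2.1 q.2.2 p i').
Proof. by move: (pq) => /andP[h1 h2] hi hi'; rewrite /in_box /= !grid_itv// ltW. Qed.

Let side_le (x : R) : x <= 1 -> x / p%:R <= p%:R^-1.
Proof. by move=> x1; rewrite ler_piMl// invr_ge0. Qed.

(** Otherwise f would have mass at least 2 on the box. *)
Lemma sampled_low_value : exists2 z, in_box q z & area q * f z <= 2.
Proof.
apply: contrapT => hno.
have h z : in_box q z -> 2 / area q <= f z.
  move=> zq; rewrite leNgt; apply/negP => fz; apply: hno; exists z => //.
  by rewrite mulrC -ler_pdivlMr// ltW.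
suff : (2%:E <= \int[@leb2 R]_z (f z)%:E)%E.
  by rewrite (holder_integral fH) lee_fin; lra.
apply: (@le_trans _ _ (\int[@leb2 R]_z ((2 / area q)%:E * (\1_(box_set q) z)%:E))%E).
  rewrite ge0_integralZl_EFin//; first last.
  - by rewrite divr_ge0// ltW.
  - by apply/measurable_EFinP; apply: measurable_indic; exact: measurable_box.
  rewrite integral_leb2_indic; last exact: measurable_box.
  by rewrite leb2_box// -EFinM divfK// gt_eqF.
apply: ge0_le_integralT => z _.
  by rewrite -EFinM lee_fin mulr_ge0 ?indicE ?ler0n// divr_ge0// ltW.
rewrite -EFinM lee_fin indicE; case: (boolP (z \in _)) => [/set_mem/box_setP zq|_].
  by rewrite mulr1 h.
by rewrite mulr0 (holder_ge0 fH).
Qed.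

Lemma sampled_bound i i' : 0 <= sampled i i' <= 2 + L.
Proof.
rewrite /sampled; have gq := grid_in (leq_ord i) (leq_ord i').
set z := (_, _) in gq *.
rewrite mulr_ge0 ?(holder_ge0 fH) ?(ltW a0)//=.
have [z0 z0q hz0] := sampled_low_value.
have hd : f z <= f z0 + L.
  rewrite -lerBlDl; apply: le_trans (ler_norm _) _.
  have := @sampled_holder z z0 1 gq z0q ler01; rewrite powR1 mulr1; apply.
  by apply: unit_square_norm; [case: (sampled_support gq)|case: (sampled_support z0q)].
apply: le_trans (_ : area q * (f z0 + L) <= _); first by rewrite ler_pM2l.
by rewrite mulrDr lerD// ler_piMl// sampled_area_le1.
Qed.

Lemma sampled_increment2 i k : (k < p)%N ->
  `|sampled i (inord k) - sampled i (inord k.+1)| <= e.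
Proof.
move=> kp; have [_ s2] := sampled_sides; move: (pq) => /andP[h1 h2].
rewrite /sampled !inordK ?ltnS ?(ltnW kp)//; apply: sampled_near.
- by apply: grid_in; rewrite ?leq_ord// ltnW.
- by apply: grid_in; rewrite ?leq_ord// ltnW.
apply: norm_le_pair => /=; first by rewrite subrr normr0 invr_ge0.
rewrite distrC gridS ger0_norm ?side_le// divr_ge0// subr_ge0 ltW//.
Qed.

Lemma sampled_increment1 i' k : (k < p)%N ->
  `|sampled (inord k) i' - sampled (inord k.+1) i'| <= e.
Proof.
move=> kp; have [s1 _] := sampled_sides; move: (pq) => /andP[h1 h2].
rewrite /sampled !inordK ?ltnS ?(ltnW kp)//; apply: sampled_near.
- by apply: grid_in; rewrite ?leq_ord// ltnW.
- by apply: grid_in; rewrite ?leq_ord// ltnW.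
apply: norm_le_pair => /=; last by rewrite subrr normr0 invr_ge0.
rewrite distrC gridS ger0_norm ?side_le// divr_ge0// subr_ge0 ltW//.
Qed.

Lemma sampled_low_rank K : low_rank K f ->
  exists u v : 'I_K -> 'I_p.+1 -> R, forall i i', sampled i i' = \sum_k u k i * v k i'.
Proof.
move=> [u [v [_ _ fuv]]].
exists (fun k i => area q * u k (grid q.1.1 q.1.2 p i)), (fun k i' => v k (grid q.2.1 q.2.2 p i')).
move=> i i'; rewrite /sampled.
have [/unit_squareE[/= hx hy] _] := sampled_support (grid_in (leq_ord i) (leq_ord i')).
rewrite fuv; [|by rewrite in_itv|by rewrite in_itv].
by rewrite mulr_sumr; apply: eq_bigr => k _; rewrite mulrA.
Qed.

(** The mass of f outside the box is at most 8 e.  Inside, the step function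
    and f differ by at most 2 e over the area of the box: e from the net and e
    from the oscillation of f in a cell. *)
Lemma sampled_close (h : 'I_p.+1 -> 'I_p.+1 -> R) :
  (forall i i', `|h i i' - sampled i i'| <= e) ->
  integral_square (fun z => `|hist h q z - f z|) <= 10 * e.
Proof.
move=> hG; have [e0 _] := andP he.
have bh : bounded_mfun (fun z => `|hist h q z - f z|).
  apply: bounded_mfun_norm; apply: bounded_mfunB; first exact: bounded_hist.
  exact: bounded_holder b0 L0 fH.
have mbox : measurable_fun setT (in_box q).
  have m1 : measurable_fun setT (fun z : R * R => z.1) by exact: measurable_fst.
  have m2 : measurable_fun setT (fun z : R * R => z.2) by exact: measurable_snd.
  by apply: measurable_and; apply: measurable_and; exact: measurable_fun_ler.
have near_f z : in_box q z -> `|hist h q z - f z| <= 2 * e / area q.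
  move=> zq; rewrite /hist pq zq /=.
  have [i [i' [-> gq d1 d2]]] := step_at pq p0 zq.
  have -> : h i i' / area q - f z = (h i i' - area q * f z) / area q.
    by rewrite mulrBl mulrAC divff ?mul1r// gt_eqF.
  rewrite normrM (gtr0_norm (_ : 0 < (area q)^-1)) ?invr_gt0// ler_pM2r ?invr_gt0//.
  apply: le_trans (ler_distD (sampled i i') _ _) _.
  rewrite (_ : 2 * e = e + e); last by ring.
  rewrite lerD// distrC; apply: sampled_near => //.
  have [s1 s2] := sampled_sides.
  by apply: norm_le_pair => /=; [apply: le_trans d1 _|apply: le_trans d2 _]; exact: side_le.
rewrite -lee_fin -integral_square_EFin//.
rewrite (_ : (10 * e)%:E = ((2 * e)%:E + (8 * e)%:E)%E); last first.
  by rewrite -EFinD; congr _%:E; ring.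
pose g1 z : R := `|hist h q z - f z| * (in_box q z)%:R.
pose g2 z : R := f z * (~~ in_box q z)%:R.
have f0 := holder_ge0 fH.
have g10 z : 0 <= g1 z by rewrite mulr_ge0.
have g20 z : 0 <= g2 z by rewrite mulr_ge0.
apply: (@le_trans _ _ (\int[@leb2 R]_(z in @unit_square R) ((g1 z)%:E + (g2 z)%:E))%E).
  apply: ge0_le_integralT => z _; first by rewrite lee_fin.
  rewrite -EFinD lee_fin /g1 /g2; case: (boolP (in_box q z)) => zq.
    by rewrite mulr1 mulr0 addr0.
  by rewrite mulr0 mulr1 add0r /hist (negPf zq) andbF sub0r normrN ger0_norm.
have g0 z : ~ @unit_square R z -> ((g1 z)%:E + (g2 z)%:E = 0)%E.
  move=> hz; rewrite -EFinD /g1 /g2 (holder_out_square fH hz) mul0r addr0.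
  by case: (boolP (in_box q z)) => [/sampled_support[]//|_]; rewrite mulr0.
rewrite integral_unit_square// ge0_integralD//.
- apply: leeD => //.
  apply: le_trans (integral_bounded_box (q := q) (M := 2 * e / area q) _ _ _ _) _ => //.
  + by rewrite divr_ge0 ?(ltW a0)// mulr_ge0// ltW.
  + by move=> z zq; rewrite /g1 zq mulr1 near_f.
  + by move=> z /negPf zq; rewrite /g1 zq mulr0.
  + by rewrite leb2_box// -EFinM divfK// gt_eqF.
- by move=> z _; rewrite lee_fin.
- by apply/measurable_EFinP; case: (bounded_mfun_test bh mbox).
- by move=> z _; rewrite lee_fin.
- apply/measurable_EFinP; apply: (bounded_mfun_test (bounded_holder b0 L0 fH) _).1.
  exact: measurable_neg.
Qed.

End sampled.

(** * The upper bounds *)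

Section upper.
Variable R : realType.
Implicit Types (beta L : R) (G : set (R * R -> R)).

Lemma minimax_quantile_le delta n G (t : R) (fh : n.-tuple (R * R) -> R * R -> R) :
  0 < t -> @estimators R n fh ->
  (forall f, G f ->
     (iid_prob f [set s : n.-tuple (R * R) | t%:E < L1_dist (fh s) f] <= delta%:E)%E) ->
  (minimax_quantile delta n G <= t%:E)%E.
Proof.
move=> t0 efh hf; apply: ereal_inf_lbound; exists t => //; split => //.
apply: le_trans (_ : (ereal_sup [set iid_prob f [set s : n.-tuple (R * R) |
    t%:E < L1_dist (fh s) f] | f in G] <= _)%E).
  by apply: ereal_inf_lbound; exists fh.
by apply: ge_ereal_sup => _ [f Gf <-]; exact: hf.
Qed.

Lemma iid_prob_set0 (f : R * R -> R) n (A : set (n.-tuple (R * R))) :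
  (forall s, ~ A s) -> iid_prob f A = 0%E.
Proof.
elim: n A => [|n IH] A hA /=.
  by rewrite diracE memNset.
by rewrite integral0_eq// => z _; rewrite IH ?mule0// => s; exact: hA.
Qed.

(** The estimator 0 has error exactly 1, so it never exceeds it. *)
Lemma minimax_quantile_le1 beta L (delta : R) n G : 0 < beta -> 0 <= L -> 0 <= delta ->
  G `<=` holder_density beta L -> (minimax_quantile delta n G <= 1)%E.
Proof.
move=> b0 L0 d0 GH; apply: (@minimax_quantile_le _ _ _ _ (fun _ => cst 0)) => //.
  split; first exact: measurable_cst.
  by move=> s; apply: (bounded_integrable_square (M := 0)) => // z _; rewrite normr0.
move=> f /GH fH; rewrite iid_prob_set0 ?lee_fin// => s /=.
have -> : L1_dist (cst (0 : R)) f = 1%E.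
  case: (fH) => _ <- _ _; apply: eq_integral => z _.
  by rewrite sub0e abseN gee0_abs// lee_fin (holder_ge0 fH).
by rewrite ltxx.
Qed.

Lemma split_sample n : (2 <= n)%N -> exists n1 n2 : nat,
  [/\ n = (n1 + n2)%N, (n <= 3 * n1)%N, (n <= 2 * n2)%N & (0 < n2)%N].
Proof.
move=> n2; exists n./2, (n - n./2)%N.
have := odd_double_half n; rewrite -addnn; case: (odd n) => /= h; split; lia.
Qed.

(** With the sample cut in two halves, up to rounding, both error terms of
    [box_estimator_risk] are below multiples of exp(- n e^2 / 24); the
    first one is even of order exp(- n e / 3). *)
Lemma net_upper_bound beta L (delta e : R) n G p (J : finType)
    (h : J -> 'I_p.+1 -> 'I_p.+1 -> R) (P : ('I_p.+1 -> 'I_p.+1 -> R) -> Prop) :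
  (2 <= n)%N -> 0 < beta -> 0 <= L -> 0 < e < 1 / 8 -> (0 < p)%N ->
  L * p%:R^-1 `^ beta <= e -> G `<=` holder_density beta L -> nonneg_net h e P ->
  (forall f s, G f -> all (fun z => f z != 0) s ->
     (\int[@leb2 R]_z (f z * (~~ in_box (sample_box s) z)%:R)%:E <= (8 * e)%:E)%E ->
     P (sampled f s)) ->
  (4 + 2 * #|J|%:R ^+ 2) * expR (- (n%:R * e ^+ 2 / 24)) <= delta ->
  (minimax_quantile delta n G <= (54 * e)%:E)%E.
Proof.
move=> n2 b0 L0 he p0 hp GH [h0 net] sampledP hdelta.
have [m1 [m2 [nE h1 h2 m20]]] := split_sample n2; move: hdelta; rewrite nE => hdelta.
rewrite nE in h1 h2; have /andP[e0 e1] := he.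
apply: (minimax_quantile_le (fh := fun s : (m1 + m2).-tuple (R * R) =>
   box_estimator h m1 m2 (11 * e) s)); first by rewrite mulr_gt0.
  exact: box_estimator_estimators.
move=> f Gf; have fH := GH _ Gf.
apply: le_trans (box_estimator_risk b0 L0 fH he m1 m20 _) _.
  move=> s fs hm; have [j hj] := net _ (sampledP _ _ Gf fs hm).
  by exists j; apply: (sampled_close b0 L0 fH he p0 hp fs hm).
rewrite lee_fin; apply: le_trans hdelta; rewrite (mulrDl 4) natrX; apply: lerD.
  rewrite ler_pM2l//; apply: (@le_trans _ _ (expR (- e) ^+ m1)).
    apply: lerXn2r; rewrite ?nnegrE ?expR_ge0//; first by lra.
    exact: expR_ge1Dx.
  rewrite -expRM_natl ler_expR mulrN lerN2.
  have : (m1 + m2)%:R <= 3 * m1%:R :> R by rewrite -natrM ler_nat.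
  move: (m1 + m2)%N => N; set a := N%:R; set b := m1%:R => hab.
  have b00 : 0 <= b by rewrite /b.
  apply: (@le_trans _ _ (3 * b * e ^+ 2 / 24)).
    by rewrite ler_pM2r ?invr_gt0// ler_wpM2r// sqr_ge0.
  have -> : 3 * b * e ^+ 2 / 24 = b * e * (e / 8) by field.
  by rewrite ler_piMr ?mulr_ge0 ?(ltW e0)//; lra.
rewrite ler_wpM2l ?mulr_ge0 ?sqr_ge0// ler_expR lerN2.
have : (m1 + m2)%:R <= 2 * m2%:R :> R by rewrite -natrM ler_nat.
move: (m1 + m2)%N => N; set a := N%:R; set b := m2%:R => hab.
have b00 : 0 <= b by rewrite /b.
apply: (@le_trans _ _ (2 * b * e ^+ 2 / 24)).
  by rewrite ler_pM2r ?invr_gt0// ler_wpM2r// sqr_ge0.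
have := mulr_ge0 b00 (sqr_ge0 e); rewrite -(mulrA 2); lra.
Qed.

Lemma log_condition (N gamma X : R) (n : nat) : 1 <= N -> (0 < n)%N ->
  ln 6 + 2 * ln N + gamma * ln n%:R <= X ->
  (4 + 2 * N ^+ 2) * expR (- X) <= n%:R `^ (- gamma).
Proof.
move=> N1 n0 hX; have N0 : 0 < N by apply: lt_le_trans N1.
apply: (@le_trans _ _ (6 * N ^+ 2 * expR (- X))).
  rewrite ler_wpM2r ?expR_ge0//.
  have : 1 <= N ^+ 2 by rewrite expr_ge1// ltW.
  lra.
have -> : 6 * N ^+ 2 = expR (ln 6 + 2 * ln N).
  by rewrite expRD lnK ?posrE// expRM_natl lnK.
rewrite -expRD /powR gt_eqF ?ltr0n// ler_expR; lra.
Qed.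

Lemma ln2_gt0 : 0 < ln 2 :> R.
Proof. by rewrite ln_gt0// ltr1n. Qed.

Lemma mesh_rate beta (x r : R) (p : nat) : 0 <= beta -> 0 < x -> x <= p%:R ->
  r = x `^ (- beta) -> p%:R^-1 `^ beta <= r.
Proof.
move=> b0 x0 xp ->; rewrite powRN -powR_invl ?(ltW x0)//; apply: powR_le => //.
by rewrite lef_pV2// posrE (lt_le_trans x0).
Qed.

(** Here l stands for log n and y for K times the mesh parameter.  The error
    squared carries l^3, of which one factor pays for the size of the net, log
    N of order y l; the two others are only bounded below, by lam^2. *)
Lemma low_rank_entropy (lam l y W A r w C2 gamma : R) :
  0 < lam -> lam <= l -> 1 <= y -> 0 <= C2 -> 0 <= gamma -> 1 <= A ->
  W = 16 * C2 + gamma + ln 6 / lam -> 24 * W <= A * lam ^+ 2 ->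
  w * r ^+ 2 = y ->
  ln 6 + 16 * y * C2 * l + gamma * l <= w * (A * (r * l `^ (3 / 2))) ^+ 2 / 24.
Proof.
move=> lam0 laml y1 C20 g0 A1 WE hW wr.
have l0 : 0 < l by apply: lt_le_trans laml.
have ln60 : 0 <= ln 6 :> R by rewrite ln_ge0// ler1n.
have l3 : (l `^ (3 / 2)) ^+ 2 = l ^+ 3.
  by rewrite -powR_mulrn ?powR_ge0// -powRrM divfK// powR_mulrn// ltW.
rewrite !exprMn l3 (_ : w * _ = A ^+ 2 * (w * r ^+ 2) * l ^+ 3); last by ring.
rewrite wr.
have yl : l <= y * l by rewrite ler_peMl// ltW.
have h1 : ln 6 <= ln 6 / lam * (y * l).
  rewrite -mulrA ler_peMr// -[leLHS](mulVf (lt0r_neq0 lam0)) ler_pM2l ?invr_gt0//.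
  exact: le_trans laml yl.
have h2 : gamma * l <= gamma * (y * l) by rewrite ler_wpM2l.
apply: (@le_trans _ _ (W * (y * l))).
  rewrite WE; move: h1; set z := ln 6 / lam => h1.
  have -> : (16 * C2 + gamma + z) * (y * l) = 16 * y * C2 * l + gamma * (y * l) + z * (y * l).
    by ring.
  by lra.
have h3 : 24 * W <= A ^+ 2 * l ^+ 2.
  apply: le_trans hW _; apply: ler_pM; rewrite ?sqr_ge0 ?(le_trans ler01)//.
    by rewrite expr2 ler_peMl// (le_trans ler01).
  by rewrite !expr2 ler_pM// ltW.
have yl0 : 0 <= y * l by apply: le_trans yl; exact: ltW.
rewrite (_ : _ / 24 = A ^+ 2 * l ^+ 2 / 24 * (y * l)); last by ring.
by rewrite ler_wpM2r// ler_pdivlMr// mulrC.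
Qed.

(** The number of levels D in the net is polynomial in n, because the error is at
    least 1 / n and K <= n; if K > n the claimed error is at least 1. *)
Lemma low_rank_upper_bound (gamma beta L : R) : 0 < gamma -> 0 < beta <= 1 -> 0 <= L ->
  exists2 A, 0 < A & forall K n : nat, (1 <= K)%N -> (2 <= n)%N ->
    (minimax_quantile (n%:R `^ (- gamma)) n (low_rank_holder_density K beta L) <=
     (54 * (A * ((K%:R / n%:R) `^ (beta / (2 * beta + 1)) * (ln n%:R) `^ (3 / 2))))%:E)%E.
Proof.
move=> g0 /andP[b0 b1] L0; pose lam : R := ln 2; have lam0 : 0 < lam := ln2_gt0.
pose B := 2 + L; pose C1 := (B + 2) * (1 + B); have B0 : 0 <= B by rewrite /B; lra.
have C10 : 1 <= C1.
  by rewrite -[leLHS]mulr1 ler_pM//; rewrite /B; lra.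
pose C2 := ln (C1 + 1) / lam + 2.
have C20 : 0 <= C2.
  by rewrite addr_ge0// divr_ge0 ?(ltW lam0)// ln_ge0//; lra.
pose W := 16 * C2 + gamma + ln 6 / lam.
have W0 : 0 <= W.
  by rewrite /W !addr_ge0 ?mulr_ge0 ?(ltW g0)// ?invr_ge0 ?(ltW lam0)// ln_ge0// ler1n.
pose lam32 := lam `^ (3 / 2); have lam320 : 0 < lam32 by exact: powR_gt0.
(* The first term makes the net fine enough for the Holder bound, the second pays
   for the entropy and the confidence, the last gives A <= A^2. *)
pose A := (L + 1) / lam32 + 24 * W / lam ^+ 2 + 1.
have lam2 : 0 < lam ^+ 2 by rewrite exprn_gt0.
have t1 : 0 <= (L + 1) / lam32 by rewrite divr_ge0 ?(ltW lam320)// addr_ge0.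
have t2 : 0 <= 24 * W / lam ^+ 2 by rewrite divr_ge0 ?(ltW lam2)// mulr_ge0.
have A1 : 1 <= A by rewrite /A; lra.
have hAL : L + 1 <= A * lam32 by rewrite -ler_pdivrMr// /A; lra.
have hAW : 24 * W <= A * lam ^+ 2 by rewrite -ler_pdivrMr// /A; lra.
have A0 : 0 < A by apply: lt_le_trans A1.
exists A => // K n K1 n2.
have n0 : (0 < n)%N by apply: leq_trans n2.
have nR : 0 < n%:R :> R by rewrite ltr0n.
have KR : 0 < K%:R :> R by rewrite ltr0n.
pose l : R := ln n%:R; rewrite -/l.
have laml : lam <= l by rewrite ler_ln ?posrE// ler_nat.
have l0 : 0 < l by apply: lt_le_trans laml.
pose r : R := (K%:R / n%:R) `^ (beta / (2 * beta + 1)); rewrite -/r.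
have r0 : 0 < r by rewrite powR_gt0// divr_gt0.
pose e := A * (r * l `^ (3 / 2)); rewrite -/e.
have l32 : lam32 <= l `^ (3 / 2) by apply: powR_le => //; exact: ltW.
have rL : (L + 1) * r <= e.
  rewrite /e mulrCA mulrC ler_pM2l//; apply: le_trans hAL _.
  by rewrite ler_pM2l.
have re : r <= e by apply: le_trans rL; rewrite ler_peMl ?(ltW r0)//; lra.
have e0 : 0 < e by apply: lt_le_trans re.
have dn : 0 <= n%:R `^ (- gamma) :> R by exact: powR_ge0.
have GH : low_rank_holder_density K beta L `<=` holder_density beta L by move=> f [].
have [e8|e8] := ltP e (1 / 8); last first.
  apply: le_trans (minimax_quantile_le1 n b0 L0 dn GH) _.
  by rewrite lee_fin; lra.
have hr : 0 < 2 * beta + 1 by lra.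
have Kn : (K <= n)%N.
  rewrite leqNgt; apply/negP => nK; have : 1 <= r.
    have E1 : 1 `^ (beta / (2 * beta + 1)) = 1 :> R by rewrite powR1.
    rewrite -E1; apply: powR_le => //; first by rewrite divr_ge0// ltW.
    by rewrite ler_pdivlMr// mul1r ler_nat ltnW.
  by lra.
pose x : R := (n%:R / K%:R) `^ (1 / (2 * beta + 1)).
have x1 : 1 <= x.
  have E1 : 1 `^ (1 / (2 * beta + 1)) = 1 :> R by rewrite powR1.
  rewrite -E1; apply: powR_le => //; first by rewrite divr_ge0// ltW.
  by rewrite ler_pdivlMr// mul1r ler_nat.
have x0 : 0 < x by apply: lt_le_trans x1.
have rE : r = x `^ (- beta) by exact: balanceQ.
have nr : n%:R * r ^+ 2 = K%:R * x by rewrite rE; exact: balance_n.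
have [p p0 /andP[xp px]] := nat_between x1.
have hp : L * p%:R^-1 `^ beta <= e.
  apply: le_trans rL; apply: ler_pM; rewrite ?powR_ge0//; first by lra.
  exact: mesh_rate (ltW b0) x0 xp rE.
have [J [h [cardJ net]]] := low_rank_net p K1 B0 e0.
set D := (Num.truncn _).+1 in cardJ.
have hD : D%:R <= (C1 + 1) * n%:R ^+ 2.
  have n1 : 1 <= n%:R :> R by rewrite ler1n.
  have ie : e^-1 <= n%:R.
    rewrite -[leRHS]invrK lef_pV2 ?posrE ?invr_gt0//; apply: le_trans re.
    apply: (@le_trans _ _ (K%:R / n%:R)).
      by rewrite ler_peMl ?invr_ge0// ler1n.
    have -> : K%:R / n%:R = (n%:R / K%:R)^-1 :> R by rewrite invf_div.
    rewrite rE powRN lef_pV2 ?posrE ?powR_gt0 ?divr_gt0//.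
    have xr : x `^ (2 * beta + 1) = n%:R / K%:R by apply: powR_rootK => //; rewrite divr_ge0.
    by rewrite -xr ler_powR//; lra.
  have -> : (C1 + 1) * n%:R ^+ 2 = C1 * (n%:R * n%:R) + n%:R * n%:R by ring.
  rewrite /D -natr1; apply: lerD; last by rewrite -[leLHS]mulr1 ler_pM.
  have hB : 0 < 1 + B by rewrite ltr_wpDr.
  have -> : (B + 2) / (e / (K%:R * (1 + B))) = C1 * (K%:R * e^-1).
    by rewrite /C1; field; rewrite !gt_eqF.
  have h0 : 0 <= C1 * (K%:R * e^-1).
    by rewrite mulr_ge0 ?divr_ge0 ?(ltW e0)// (le_trans ler01 C10).
  have /andP[h1 _] := truncn_itv h0; apply: le_trans h1 _.
  rewrite ler_wpM2l ?(le_trans ler01 C10)//; apply: ler_pM; rewrite ?invr_ge0 ?(ltW e0)//.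
  by rewrite ler_nat.
have D1 : 1 <= D%:R :> R by rewrite ler1n.
have lnD : ln D%:R <= C2 * l.
  apply: le_trans (_ : ln ((C1 + 1) * n%:R ^+ 2) <= _).
    by rewrite ler_ln ?posrE ?(lt_le_trans ltr01 D1)//; apply: lt_le_trans hD; exact: lt_le_trans D1.
  rewrite lnM ?posrE ?exprn_gt0//; last by lra.
  rewrite lnXn// -/l -(mulr_natl l) /C2 (mulrDl (_ / lam)) lerD2r.
  have : 0 <= ln (C1 + 1) by rewrite ln_ge0//; lra.
  by move=> h0; rewrite -mulrA ler_peMr// -[leLHS](mulVf (lt0r_neq0 lam0)) ler_pM2l ?invr_gt0.
apply: (net_upper_bound n2 b0 L0 _ p0 hp GH net); first by rewrite e0.
  move=> f s [fH flr] fs hm; split.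
    by move=> i i'; apply: (sampled_bound b0 L0 fH _ p0 fs hm); rewrite e0.
  by apply: (sampled_low_rank b0 L0 fH _ p0 fs hm) => //; rewrite e0.
have NE : #|J|%:R = D%:R ^+ (2 * K * p.+1) :> R by rewrite cardJ natrX.
apply: log_condition => //; first by rewrite NE exprn_ege1.
rewrite NE lnXn ?(lt_le_trans ltr01 D1)// -/l.
have y1 : 1 <= K%:R * x by rewrite -[leLHS]mulr1 ler_pM// ler1n.
apply: le_trans (low_rank_entropy lam0 laml y1 C20 (ltW g0) A1 erefl hAW nr).
rewrite lerD2r lerD2l -(mulr_natl (ln D%:R)).
have hp1 : (2 * K * p.+1)%:R <= 8 * (K%:R * x).
  have : (2 * K * p.+1)%:R <= (4 * (K * p))%:R :> R.
    rewrite ler_nat -mulnA (_ : 4 * (K * p) = 2 * (K * (p + p)))%N; last by ring.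
    by rewrite !leq_mul2l -[X in (X <= _)%N]addn1 leq_add2l p0 !orbT.
  move=> h3; apply: le_trans h3 _; rewrite !natrM.
  have : K%:R * p%:R <= K%:R * (2 * x) by rewrite ler_pM2l.
  lra.
rewrite (_ : 16 * (K%:R * x) * C2 * l = 2 * (8 * (K%:R * x) * (C2 * l))); last by ring.
rewrite ler_pM2l//; apply: ler_pM => //; exact: ln_ge0.
Qed.

(** No rank is involved.  As beta <= 1, log n is at most 4 x^2 with
    x = n^(1/(2 beta + 2)), so it is absorbed by the size of the net and leaves
    no logarithm in the rate. *)
Lemma smooth_upper_bound (gamma beta L : R) : 0 < gamma -> 0 < beta <= 1 -> 0 <= L ->
  exists2 A, 0 < A & forall (n : nat) (G : set (R * R -> R)), (2 <= n)%N ->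
    G `<=` holder_density beta L ->
    (minimax_quantile (n%:R `^ (- gamma)) n G <=
     (54 * (A * n%:R `^ (- (beta / (2 * beta + 2)))))%:E)%E.
Proof.
move=> g0 /andP[b0 b1] L0; pose B := 2 + L; have B0 : 0 <= B by rewrite /B; lra.
pose W := ln 6 + 2 * ln (B + 1) + (2 + gamma) * 4 + 32 * ln 3.
have lnB0 : 0 <= ln (B + 1) by rewrite ln_ge0//; lra.
have ln30 : 0 <= ln 3 :> R by rewrite ln_ge0// ler1n.
have ln60 : 0 <= ln 6 :> R by rewrite ln_ge0// ler1n.
have W0 : 0 <= W.
  by rewrite /W; move: lnB0 ln30 ln60 g0; move: (ln _) (ln _) (ln _) => a b c; lra.
pose A := L + 1 + 24 * W; have A1 : 1 <= A by rewrite /A; lra.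
have A0 : 0 < A by apply: lt_le_trans A1.
exists A => // n G n2 GH.
have n0 : (0 < n)%N by apply: leq_trans n2.
have n1 : 1 <= n%:R :> R by rewrite ler1n.
have nR : 0 < n%:R :> R by rewrite ltr0n.
have hb : 0 < 2 * beta + 2 by lra.
pose x : R := n%:R `^ (1 / (2 * beta + 2)).
have x1 : 1 <= x by exact: x_ge1.
have x0 : 0 < x by apply: lt_le_trans x1.
have xn : x `^ (2 * beta + 2) = n%:R by apply: powR_rootK.
pose r : R := n%:R `^ (- (beta / (2 * beta + 2))); rewrite -/r.
have rE : r = x `^ (- beta).
  by rewrite /r /x -powRrM; congr (_ `^ _); field; rewrite gt_eqF.
have r0 : 0 < r by exact: powR_gt0.
have nr : n%:R * r ^+ 2 = x ^+ 2.
  rewrite rE -xn -!powR_mulrn ?powR_ge0 ?(ltW x0)// -powRrM -powRD; last first.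
    by apply/implyP => _; rewrite gt_eqF.
  by congr (_ `^ _); ring.
have rn : n%:R^-1 <= r.
  by rewrite rE powRN lef_pV2 ?posrE ?powR_gt0// -xn ler_powR//; lra.
pose e := A * r; rewrite -/e.
have rL : L * r <= e by rewrite /e ler_pM2r// /A; lra.
have re : r <= e by rewrite /e ler_peMl// ltW.
have e0 : 0 < e by apply: lt_le_trans re.
have dn : 0 <= n%:R `^ (- gamma) :> R by exact: powR_ge0.
have [e8|e8] := ltP e (1 / 8); last first.
  apply: le_trans (minimax_quantile_le1 n b0 L0 dn GH) _.
  by rewrite lee_fin; lra.
have [p p0 /andP[xp px]] := nat_between x1.
have hp : L * p%:R^-1 `^ beta <= e.
  apply: le_trans rL; rewrite ler_wpM2l//.
  exact: mesh_rate (ltW b0) x0 xp rE.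
have [J [h [cardJ net]]] := smooth_net p B0 e0.
set D := (Num.truncn _).+1 in cardJ.
have D1 : 1 <= D%:R :> R by rewrite ler1n.
have D0 : 0 < D%:R :> R by apply: lt_le_trans D1.
have hD : D%:R <= (B + 1) * n%:R.
  have -> : (B + 1) * n%:R = B * n%:R + n%:R by ring.
  rewrite /D -natr1; apply: lerD => //.
  have /andP[h1 _] := truncn_itv (divr_ge0 B0 (ltW e0)); apply: le_trans h1 _.
  by rewrite ler_wpM2l// -[leRHS]invrK lef_pV2 ?posrE ?invr_gt0// (le_trans rn).
pose l : R := ln n%:R.
have lnD : ln D%:R <= ln (B + 1) + l.
  rewrite /l -lnM ?posrE//; last by lra.
  by rewrite ler_ln ?posrE//; apply: lt_le_trans hD.
have lx : l <= 4 * x ^+ 2.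
  rewrite /l -xn ln_powR; have lx0 : 0 <= ln x by exact: ln_ge0.
  apply: (@le_trans _ _ (4 * ln x)); first by rewrite ler_wpM2r//; lra.
  rewrite ler_pM2l//; apply: le_trans (ltW (ln_sublinear x0)) _.
  by rewrite expr2 ler_peMl// ltW.
apply: (net_upper_bound n2 b0 L0 _ p0 hp GH net); first by rewrite e0.
  move=> f s /GH fH fs hm; have he : 0 < e < 1 / 8 by rewrite e0.
  split.
  - exact: (sampled_bound b0 L0 fH he p0 fs hm).
  - by move=> i k kp; apply: (sampled_increment2 b0 L0 fH he p0 hp fs hm).
  - by move=> i k kp; apply: (sampled_increment1 b0 L0 fH he p0 hp fs hm).
have NE : #|J|%:R = D%:R * 3 ^+ (p.+1 * p.+1) :> R by rewrite cardJ natrM natrX.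
have t1 : 1 <= 3 ^+ (p.+1 * p.+1) :> R by rewrite exprn_ege1// ler1n.
apply: log_condition => //; first by rewrite NE -[leLHS]mulr1 ler_pM.
rewrite NE lnM ?posrE ?(lt_le_trans ltr01 t1)// lnXn// -/l -(mulr_natl (ln 3)).
have y1 : 1 <= x ^+ 2 by rewrite expr_ge1// ltW.
have hpp : (p.+1 * p.+1)%:R <= 16 * x ^+ 2.
  have h4 : p.+1%:R <= 4 * x.
    by rewrite -natr1; lra.
  by rewrite natrM (_ : 16 * x ^+ 2 = (4 * x) * (4 * x)); [exact: ler_pM|ring].
have -> : n%:R * e ^+ 2 / 24 = A ^+ 2 * x ^+ 2 / 24.
  by rewrite /e exprMn mulrCA nr.
apply: (@le_trans _ _ (W * x ^+ 2)); last first.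
  have h3 : 24 * W <= A ^+ 2.
    by apply: (@le_trans _ _ A); [rewrite /A; lra|rewrite expr2 ler_peMl// ltW].
  by rewrite mulrAC ler_wpM2r ?sqr_ge0// ler_pdivlMr// mulrC.
have h3 : (p.+1 * p.+1)%:R * ln 3 <= 16 * x ^+ 2 * ln 3 by rewrite ler_wpM2r.
have h4 : gamma * l <= gamma * (4 * x ^+ 2) by rewrite ler_pM2l.
have h5 : ln 6 <= ln 6 * x ^+ 2 by rewrite ler_peMr.
have h6 : ln (B + 1) <= ln (B + 1) * x ^+ 2 by rewrite ler_peMr.
rewrite /W; move: h3 h4 h5 h6 lx lnD.
move: (ln 3) (ln 6) (ln (B + 1)) (ln D%:R) (x ^+ 2) => a b c d y.
have -> : (b + 2 * c + (2 + gamma) * 4 + 32 * a) * y =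
  b * y + 2 * (c * y) + 2 * (4 * y) + gamma * (4 * y) + 2 * (16 * y * a) by ring.
by lra.
Qed.

End upper.

(** * The minimax rates *)

Theorem corollary3 (R : realType) (gamma beta L : R)
    (gamma_gt0 : 0 < gamma) (beta_gt0 : 0 < beta) (beta_le1 : beta <= 1)
    (L_gt0 : 0 < L) :
  exists c C : R, [/\ 0 < c, 0 < C &
    forall K n : nat, (1 <= K)%N -> (2 <= n)%N ->
      ((c * Num.min ((K%:R / n%:R) `^ (beta / (2 * beta + 1)))
                    (n%:R `^ (- (beta / (2 * beta + 2)))))%:E
        <= minimax_quantile (n%:R `^ (- gamma)) n (low_rank_holder_density K beta L)
       <= (C * Num.min ((K%:R / n%:R) `^ (beta / (2 * beta + 1))
                          * (ln n%:R) `^ (3 / 2))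
                       (n%:R `^ (- (beta / (2 * beta + 2)))))%:E)%E].
Proof.
have hb : 0 < beta <= 1 by rewrite beta_gt0.
have [c c0 lower] := minimax_lower_bound gamma_gt0 hb L_gt0.
have [A1 A10 upper1] := low_rank_upper_bound gamma_gt0 hb (ltW L_gt0).
have [A2 A20 upper2] := smooth_upper_bound gamma_gt0 hb (ltW L_gt0).
exists c, (54 * (A1 + A2)); split => // [|K n K1 n2]; first by rewrite mulr_gt0 ?addr_gt0.
rewrite lower//=; case: (leP ((K%:R / n%:R) `^ _ * _)) => _.
  apply: le_trans (upper1 K n K1 n2) _; rewrite lee_fin -mulrA ler_pM2l//.
  by rewrite ler_wpM2r ?mulr_ge0 ?powR_ge0// lerDl ltW.
have GH : low_rank_holder_density K beta L `<=` holder_density beta L by move=> f [].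
apply: le_trans (upper2 n _ n2 GH) _; rewrite lee_fin -mulrA ler_pM2l//.
by rewrite ler_wpM2r ?powR_ge0// lerDr ltW.
Qed.
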